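(* Let $G$ be a totally disconnected, locally compact group. The following are equivalent: (i) $G$ has property (LD); (ii) $G$ is locally isomorphic to a profinite group of the form $\prod_{i \in I} L_i$, such that finitely many factors $L_i$ (possibly none) are just infinite profinite groups and the remaining factors are finite simple groups.
   Context: All groups are locally compact Hausdorff topological groups. A direct product always carries the product topology; in particular direct factors are closed subgroups. Property (LD): a totally disconnected locally compact group $G$ has property (LD) if for every closed subgroup $K$ of $G$ whose normalizer is open in $G$, there is an open subgroup $L$ of $K$ that is a direct factor of an open subgroup of $G$. A profinite group is just infinite if it is infinite and every nontrivial closed normal subgroup has finite index. Finite simple groups include the cyclic groups of prime order. The index set $I$ is arbitrary. A local isomorphism from $H$ to $K$ (both totally disconnected locally compact) is a continuous injective open homomorphism $\theta : U \to K$ where $U$ is an open subgroup of $H$; $H$ and $K$ are locally isomorphic if a local isomorphism between them exists. *)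

(* Defs.v *)
From HB Require Import structures.
From mathcomp Require Import all_boot.
From mathcomp Require Import all_classical.
From mathcomp Require Import topology.

Set Implicit Arguments.
Unset Strict Implicit.
Unset Printing Implicit Defensive.

Local Open Scope classical_set_scope.
Local Open Scope group_scope.

HB.mixin Record isTopologicalGroup G of Topological G & Group G := {
  mulg_continuous : continuous (fun z : G * G => z.1 * z.2) ;
  invg_continuous : continuous (fun x : G => x^-1)
}.

#[short(type="topologicalGroupType")]
HB.structure Definition TopologicalGroup :=
  {G of Topological G & Group G & isTopologicalGroup G}.

Definition prod_group (I : Type) (L : I -> topologicalGroupType) : Type :=
  prod_topology L.

Section ProdGroup.
Context (I : Type) (L : I -> topologicalGroupType).

HB.instance Definition _ :=
  Topological.copy (prod_group L) (prod_topology (fun i => L i : topologicalType)).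

Let one : prod_group L := fun i => 1.
Let inv (f : prod_group L) : prod_group L := fun i => (f i)^-1.
Let mul (f g : prod_group L) : prod_group L := fun i => f i * g i.

Let mulA : associative mul.
Proof. by move=> f g h; apply: functional_extensionality_dep => i; exact: mulgA. Qed.
Let mul1 : left_id one mul.
Proof. by move=> f; apply: functional_extensionality_dep => i; exact: mul1g. Qed.
Let mulr1 : right_id one mul.
Proof. by move=> f; apply: functional_extensionality_dep => i; exact: mulg1. Qed.
Let mulV : left_inverse one inv mul.
Proof. by move=> f; apply: functional_extensionality_dep => i; exact: mulVg. Qed.
Let mulrV : right_inverse one inv mul.
Proof. by move=> f; apply: functional_extensionality_dep => i; exact: mulgV. Qed.

HB.instance Definition _ :=
  isGroup.Build (prod_group L) mulA mul1 mulr1 mulV mulrV.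

Let proj_cts (i : I) : continuous (fun f : prod_group L => f i).
Proof. exact: (@proj_continuous {classic I} (fun i => L i : topologicalType) i). Qed.

Let prod_cts (X : topologicalType) (F : X -> prod_group L) :
  (forall i, continuous (fun x => F x i)) -> continuous F.
Proof.
move=> cF x; apply/cvg_sup => i.
move=> A [B [[C oC <-] Cx] BA] /=.
apply: (filterS BA); apply: (cF i x); exact: open_nbhs_nbhs.
Qed.

Let mul_cts : continuous (fun z : prod_group L * prod_group L => z.1 * z.2).
Proof.
apply: prod_cts => i z.
pose p (w : prod_group L * prod_group L) := (w.1 i, w.2 i).
have p_cts : p w @[w --> z] --> p z.
  apply: cvg_pair => /=.
    apply: (@cvg_comp _ _ _ fst (fun f : prod_group L => f i)).
      exact: cvg_fst.
    exact: proj_cts.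
  apply: (@cvg_comp _ _ _ snd (fun f : prod_group L => f i)).
    exact: cvg_snd.
  exact: proj_cts.
exact: (@cvg_comp _ _ _ p (fun w => w.1 * w.2) _ _ _ p_cts
  (@mulg_continuous (L i) (p z))).
Qed.

Let inv_cts : continuous (fun f : prod_group L => f^-1).
Proof.
apply: prod_cts => i f.
exact: (@cvg_comp _ _ _ (fun f : prod_group L => f i) (fun x => x^-1) _ _ _
  (@proj_cts i f) (@invg_continuous (L i) (f i))).
Qed.

HB.instance Definition _ := isTopologicalGroup.Build (prod_group L) mul_cts inv_cts.

End ProdGroup.

Section Subgroups.
Context (G : groupType).
Implicit Types K N : set G.

Definition subgroup K := group_closed (mem K).

Definition normalizer K : set G := [set g | [set k ^ g | k in K] = K].

Definition normal_subgroup N := subgroup N /\ normalizer N = setT.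

Definition finite_index N := finite_set [set [set x * n | n in N] | x in setT].

End Subgroups.

(* Stated for arbitrary groups, as [simple] is restricted to [finGroupType]. *)
Definition simple_group (G : groupType) :=
  [set: G] <> [set 1] /\
  forall N : set G, normal_subgroup N -> N = [set 1] \/ N = setT.

Definition homeomorphism_on (T U : topologicalType) (A : set T) (B : set U)
    (f : T -> U) :=
  [/\ set_bij A B f, {within A, continuous f} &
      forall O : set T, O `<=` A -> open (O : set (subspace A)) ->
        open (f @` O : set (subspace B))].

Section TopologicalGroups.
Context (G : topologicalGroupType).
Implicit Types H K L M : set G.

Definition open_subgroup H := subgroup H /\ open H.

(* [H] is the direct product of its subgroups [L] and [M], with the product
   topology: multiplication is an isomorphism of topological groups from
   L x M onto H (a homomorphism because L and M commute elementwise). *)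
Definition internal_direct_product H L M :=
  [/\ subgroup L, subgroup M, (forall x y, L x -> M y -> commute x y) &
      homeomorphism_on (L `*` M) H (fun z => z.1 * z.2)].

Definition direct_factor L H := exists M, internal_direct_product H L M.

End TopologicalGroups.

Definition property_LD (G : topologicalGroupType) :=
  forall K : set G, subgroup K -> closed K -> open (normalizer K) ->
  exists L : set G,
    [/\ subgroup L, L `<=` K, open (L : set (subspace K)) &
        exists2 H : set G, open_subgroup H & direct_factor L H].

Definition profinite (G : topologicalGroupType) :=
  [/\ compact [set: G], hausdorff_space G & totally_disconnected [set: G]].

Definition just_infinite (G : topologicalGroupType) :=
  [/\ profinite G, infinite_set [set: G] &
      forall N : set G, normal_subgroup N -> closed N -> N <> [set 1] ->
        finite_index N].

(* A finite Hausdorff space is discrete. *)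
Definition finite_simple (G : topologicalGroupType) :=
  [/\ finite_set [set: G], hausdorff_space G & simple_group G].

(* [theta] is only meaningful on the open subgroup [U]; its values off [U] are
   unconstrained. *)
Definition local_isomorphism (G H : topologicalGroupType) (U : set G)
    (theta : G -> H) :=
  [/\ open_subgroup U,
      {in U &, {morph theta : x y / x * y}},
      {within U, continuous theta},
      set_inj U theta &
      forall O : set G, O `<=` U -> open O -> open (theta @` O)].

Definition locally_isomorphic (G H : topologicalGroupType) :=
  exists (U : set G) (theta : G -> H), local_isomorphism U theta.

(* Main.v *)
Require Import Defs.
From HB Require Import structures.
From mathcomp Require Import all_boot.
From mathcomp Require Import all_classical.
From mathcomp Require Import topology.
From Stdlib Require List.

(* Throughout, normal subgroups are taken inside a compact open subgroup, where
   (LD) says that every closed normal subgroup is, up to finite index, a direct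
   factor.

   (ii) => (i).  It suffices to find arbitrarily small open normal subgroups of
   the product in which every closed normal subgroup has a closed normal
   complement up to finite index; this property passes to commuting products.
   In a product of simple groups a minimal set of factors generating the group
   together with [K] gives a complement of [K].  If a just infinite group has no
   nontrivial abelian subgroup that is normal in an open normal subgroup, the
   conjugates of [K] meeting [K] trivially generate a complement; otherwise it
   is virtually a free Z_p-module of finite rank.

   (i) => (ii).  Let E be the closure of the union of the finite normal
   subgroups.  Virtually the group is E * R, where R has no finite normal
   subgroups.  The Melnikov subgroup of E is finite, so a smaller E has trivial
   Melnikov subgroup, and a maximal independent family of maximal open normal
   subgroups makes E a product of finite simple groups.  In R there is no
   infinite independent sequence of normal subgroups, so R has finitely many just
   infinite quotients R / M whose product contains R as an open subgroup. *)

Set Implicit Arguments.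
Unset Strict Implicit.
Unset Printing Implicit Defensive.

Local Open Scope classical_set_scope.
Local Open Scope group_scope.

(** The complements must live in arbitrarily small open subgroups because the [K] of (LD) is normal
    only in the open subgroup that normalizes it, and this may be small. In the other direction the
    obstacle is that the complement supplied by (LD) need not be normal and is known to commute only
    with a part of [K]. A normal complement is recovered as the centralizer of that part; where the
    part has a nontrivial centre this fails, and an averaged projection takes over. Infinitely many
    factors are harmless only when they are finite simple: an infinite normal [D n] contains a
    proper normal [D' n] of finite index, and the closed subgroup assembled from infinitely many
    [D' n] has no virtual complement, whereas simple factors leave no room for such a choice. The
    Melnikov subgroup is finite for a related reason: finite normal subgroups are dense in [E], so a
    maximal open normal subgroup of an infinite virtual factor of [E] can be chosen to extend to one
    of [E], and it would then miss a part of the Melnikov subgroup. *)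

Record sbg (G : groupType) (A : set G) : Prop := Sbg {
  sbg1 : A 1;
  sbgM : forall x y, A x -> A y -> A (x * y);
  sbgV : forall x, A x -> A x^-1 }.

(** Only one inclusion is asked; for a subgroup [B], using both [b] and its inverse gives equality
    ([conjS_norms]). *)
Definition norms (G : groupType) (B K : set G) :=
  forall b k, B b -> K k -> K (k ^ b).

Definition cents (G : groupType) (A B : set G) :=
  forall a b, A a -> B b -> commute a b.

Definition mulS (G : groupType) (A B : set G) : set G :=
  [set z | exists a b, [/\ A a, B b & z = a * b]].

Notation "A ** B" := (mulS A B) (at level 40, left associativity).

(* Finite index of [A] in [B]; for closed subgroups of a compact group this is
   the same as being relatively open. *)
Definition finidx (G : groupType) (A B : set G) :=
  exists s : seq G, forall b, B b -> exists2 x, x \in s & A (x^-1 * b).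

Definition core (G : groupType) (B A : set G) : set G :=
  [set x | forall b, B b -> A (x ^ b)].

(** * Subgroups, products and finite index in abstract groups *)

Section Algebra.
Context (G : groupType).
Implicit Types A B C K N T W : set G.

Lemma subgroupP A : subgroup A <-> sbg A.
Proof.
split=> [[A1 AB]|[A1 AM AV]].
  rewrite inE in A1.
  have AV x : A x -> A x^-1.
    by move=> Ax; have := AB 1 x; rewrite !inE div1g; exact.
  split=> // x y Ax Ay; have := AB x y^-1; rewrite !inE invgK; apply=> //.
  exact: AV.
split; first by rewrite inE.
by move=> x y; rewrite !inE => Ax Ay; apply: AM => //; exact: AV.
Qed.

Lemma sbgX A x n : sbg A -> A x -> A (x ^+ n).
Proof.
move=> sA Ax; elim: n => [|n IHn]; first by rewrite expg0; exact: sbg1.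
by rewrite expgS; exact: sbgM.
Qed.

Lemma sbgJ A x y : sbg A -> A x -> A y -> A (x ^ y).
Proof.
by move=> sA Ax Ay; apply: sbgM => //; [exact: sbgV|exact: sbgM].
Qed.

Lemma sbgVE A x : sbg A -> A x^-1 -> A x.
Proof. by move=> sA /(sbgV sA); rewrite invgK. Qed.

Lemma sbgMl A x y : sbg A -> A x -> A (x * y) -> A y.
Proof. by move=> sA Ax Axy; rewrite -(mulKg x y); apply: sbgM => //; exact: sbgV. Qed.

Lemma sbgMr A x y : sbg A -> A y -> A (x * y) -> A x.
Proof. by move=> sA Ay Axy; rewrite -(mulgK y x); apply: sbgM => //; exact: sbgV. Qed.

Lemma sbg_T : sbg [set: G].
Proof. by []. Qed.

Lemma sbg_1 : sbg [set 1 : G].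
Proof.
split=> //= [x y -> ->|x ->]; first by rewrite mulg1.
by rewrite invg1.
Qed.

Lemma sbgI A B : sbg A -> sbg B -> sbg (A `&` B).
Proof.
move=> sA sB; split; first by split; exact: sbg1.
  by move=> x y [? ?] [? ?]; split; exact: sbgM.
by move=> x [? ?]; split; exact: sbgV.
Qed.

Lemma sbg_bigcap I (D : set I) (F : I -> set G) :
  (forall i, D i -> sbg (F i)) -> sbg (\bigcap_(i in D) F i).
Proof.
move=> sF; split; first by move=> i /sF; exact: sbg1.
  by move=> x y Fx Fy i Di; apply: (sbgM (sF i Di)); [exact: Fx|exact: Fy].
by move=> x Fx i Di; apply: (sbgV (sF i Di)); exact: Fx.
Qed.

Lemma norms_self A : sbg A -> norms A A.
Proof. by move=> sA b k Ab Ak; exact: sbgJ. Qed.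

Lemma normsI B K N : norms B K -> norms B N -> norms B (K `&` N).
Proof. by move=> nK nN b k Bb [Kk Nk]; split; [exact: nK|exact: nN]. Qed.

Lemma normsS B B' K : B' `<=` B -> norms B K -> norms B' K.
Proof. by move=> sB nK b k /sB; exact: nK. Qed.

Lemma norms_bigcap I (D : set I) B (F : I -> set G) :
  (forall i, D i -> norms B (F i)) -> norms B (\bigcap_(i in D) F i).
Proof. by move=> nF b k Bb Fk i Di; apply: nF => //; exact: Fk. Qed.

Lemma normsM B K N : norms B K -> norms B N -> norms B (K ** N).
Proof.
move=> nK nN b _ Bb [k [n [Kk Nn ->]]]; exists (k ^ b), (n ^ b).
by split; [exact: nK|exact: nN|exact: conjMg].
Qed.

Lemma norms_mul A B K : norms A K -> norms B K -> norms (A ** B) K.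
Proof.
move=> nA nB _ k [a [b [Aa Bb ->]]] Kk; rewrite conjgM.
by apply: nB => //; exact: nA.
Qed.

Lemma norms1 B : norms B [set 1].
Proof. by move=> b _ _ ->; rewrite /= conj1g. Qed.

Lemma normsVE B K b k : sbg B -> norms B K -> B b -> K (k ^ b) -> K k.
Proof.
move=> sB nK Bb Kkb; rewrite -(conjgK b k); apply: nK => //; exact: sbgV.
Qed.

Lemma cents_norms A B : cents A B -> norms A B.
Proof.
by move=> cAB a b Aa Bb; rewrite conjgE -(cAB _ _ Aa Bb) mulKg.
Qed.

Lemma centsC A B : cents A B -> cents B A.
Proof. by move=> cAB b a Bb Aa; apply/commute_sym/cAB. Qed.

Lemma centsS A B A' B' : A' `<=` A -> B' `<=` B -> cents A B -> cents A' B'.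
Proof. by move=> sA sB cAB a b /sA Aa /sB Bb; exact: cAB. Qed.

Lemma commuteJ (x y : G) : x ^ y = x <-> commute x y.
Proof. by split=> [/conjg_fixP/commgP|/commgP/conjg_fixP]. Qed.

(* The commutator of [a] and [b] lies in [A `&` B]. *)
Lemma norms_cents A B : sbg A -> sbg B -> norms A B -> norms B A ->
  A `&` B = [set 1] -> cents A B.
Proof.
move=> sA sB nAB nBA AB1 a b Aa Bb; apply/commgP/eqP.
have : (A `&` B) [~ a, b]; last by rewrite AB1.
split; first by rewrite commgEl; apply: sbgM => //; [exact: sbgV|exact: nBA].
rewrite commgEr; apply: sbgM => //; apply: nAB => //; exact: sbgV.
Qed.

Lemma mulS_subl A B : B 1 -> A `<=` A ** B.
Proof. by move=> B1 a Aa; exists a, 1; rewrite mulg1. Qed.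

Lemma mulS_subr A B : A 1 -> B `<=` A ** B.
Proof. by move=> A1 b Bb; exists 1, b; rewrite mul1g. Qed.

Lemma mulSS A B A' B' : A `<=` A' -> B `<=` B' -> A ** B `<=` A' ** B'.
Proof. by move=> sA sB _ [a [b [/sA Aa /sB Bb ->]]]; exists a, b. Qed.

Lemma mulS_sub A B C : sbg C -> A `<=` C -> B `<=` C -> A ** B `<=` C.
Proof. by move=> sC sA sB _ [a [b [/sA Aa /sB Bb ->]]]; exact: sbgM. Qed.

Lemma sbg_mul A B : sbg A -> sbg B -> norms A B -> sbg (A ** B).
Proof.
move=> sA sB nAB; split.
- by exists 1, 1; rewrite mulg1; split=> //; exact: sbg1.
- move=> _ _ [a [b [Aa Bb ->]]] [a' [b' [Aa' Bb' ->]]].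
  exists (a * a'), (b ^ a' * b'); split; first exact: sbgM.
    by apply: sbgM => //; exact: nAB.
  by rewrite -[in LHS]mulgA (mulgA b a') (conjgC b a') !mulgA.
- move=> _ [a [b [Aa Bb ->]]]; exists a^-1, (b^-1 ^ a^-1); split.
  + exact: sbgV.
  + by apply: nAB; exact: sbgV.
  + by rewrite invgM; exact: conjgC.
Qed.

Lemma mulSC A B : sbg A -> norms A B -> A ** B = B ** A.
Proof.
move=> sA nAB; apply/seteqP; split=> _ [a [b [Aa Bb ->]]].
  exists (b ^ a^-1), a; split=> //; last by rewrite -conjgCV.
  by apply: nAB => //; exact: sbgV.
by exists b, (a ^ b); split=> //; [exact: nAB|rewrite -conjgC].
Qed.

Lemma sbg_mulC A B : sbg A -> sbg B -> norms B A -> sbg (A ** B).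
Proof. by move=> sA sB nBA; rewrite -mulSC//; exact: sbg_mul. Qed.

Lemma finidxS A A' B B' : A `<=` A' -> B' `<=` B -> finidx A B -> finidx A' B'.
Proof.
by move=> sA sB [s sP]; exists s => b /sB/sP[x xs Axb]; exists x => //; exact: sA.
Qed.

Lemma finidx_refl A B : A 1 -> sbg B -> B `<=` A -> finidx A B.
Proof.
by move=> A1 sB sBA; exists [:: 1] => b /sBA Ab; exists 1; rewrite ?mem_head// invg1 mul1g.
Qed.

Lemma finidx_trans A B C : finidx A B -> finidx B C -> finidx A C.
Proof.
move=> [s sP] [t tP]; exists [seq y * x | y <- t, x <- s] => c /tP[y yt /sP[x xs H]].
by exists (y * x); [exact: allpairs_f|rewrite invgM -mulgA].
Qed.

(** A representative whose coset meets [B] is traded for a point of [B] in the same coset; the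
    others are dropped. *)
Lemma finidx_in A B : sbg A -> finidx A B ->
  exists s : seq G, (forall x, x \in s -> B x) /\
    forall b, B b -> exists2 x, x \in s & A (x^-1 * b).
Proof.
move=> sA [s sP].
pose r x := xget 1 [set b | B b /\ A (x^-1 * b)].
pose t := [seq r x | x <- s & `[< exists b, B b /\ A (x^-1 * b) >]].
have rP x : (exists b, B b /\ A (x^-1 * b)) -> B (r x) /\ A (x^-1 * r x).
  by move=> [b Pb]; rewrite /r; case: xgetP => [z _ //|/(_ b)] /(_ Pb).
exists t; split=> [y /mapP[x]|b Bb].
  by rewrite mem_filter => /andP[/asboolP/rP[Brx _] _] ->.
have [x xs Axb] := sP b Bb; have ex : exists b, B b /\ A (x^-1 * b) by exists b.
exists (r x); first by apply: map_f; rewrite mem_filter xs andbT; exact/asboolP.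
have [_ Ar] := rP x ex.
have -> : (r x)^-1 * b = (x^-1 * r x)^-1 * (x^-1 * b).
  by rewrite invgM invgK -mulgA mulVKg.
by apply: sbgM => //; exact: sbgV.
Qed.

(** A coset of [A] and a coset of [A'] meet in at most one coset of the intersection, so one chosen
    point per pair is enough. *)
Lemma finidxI A A' B : sbg A -> sbg A' -> finidx A B -> finidx A' B ->
  finidx (A `&` A') B.
Proof.
move=> sA sA' [s sP] [t tP].
pose r (p : G * G) := xget 1 [set b | A (p.1^-1 * b) /\ A' (p.2^-1 * b)].
exists [seq r (x, y) | x <- s, y <- t] => b Bb.
have [x xs Ax] := sP b Bb; have [y yt Ay] := tP b Bb.
exists (r (x, y)); first exact: (allpairs_f (fun x y => r (x, y))).
have [A1 A2] : A (x^-1 * r (x, y)) /\ A' (y^-1 * r (x, y)).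
  by rewrite /r; case: xgetP => [z _ //|/(_ b)] /(_ (conj Ax Ay)).
have E z : (r (x, y))^-1 * b = (z^-1 * r (x, y))^-1 * (z^-1 * b).
  by rewrite invgM invgK -mulgA mulVKg.
split; [rewrite (E x)|rewrite (E y)].
  by apply: sbgM => //; exact: sbgV.
by apply: sbgM => //; exact: sbgV.
Qed.

Lemma finidx_finite A B : finidx A B -> finite_set A -> finite_set B.
Proof.
move=> [s sP] fA.
apply: (@sub_finite_set _ _ ((fun p => p.1 * p.2) @` ([set` s] `*` A))).
  move=> b /sP[x xs Ax]; exists (x, x^-1 * b); first by split.
  by rewrite /= mulVKg.
by apply: finite_image; apply: finite_setX => //; exact: finite_seq.
Qed.

Lemma finite_finidx A B : A 1 -> finite_set B -> finidx A B.
Proof.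
move=> A1 /finite_seqP[s ->]; exists s => b bs; exists b => //.
by rewrite mulVg.
Qed.

Lemma finidx_sub A B K : sbg A -> sbg K -> finidx A B -> K `<=` B ->
  finidx (A `&` K) K.
Proof.
move=> sA sK fAB sKB; apply: finidxI => //; last exact: finidx_refl (sbg1 sK) _ _.
exact: finidxS fAB.
Qed.

Lemma finidxJ A B g : finidx A B -> finidx [set x | A (x ^ g)] [set x | B (x ^ g)].
Proof.
move=> [s sP]; exists [seq x ^ g^-1 | x <- s] => b /sP[x xs Ax].
exists (x ^ g^-1); first exact: map_f.
by rewrite /= conjMg conjVg conjgKV.
Qed.

Lemma sbg_conj A g : sbg A -> sbg [set x | A (x ^ g)].
Proof.
move=> sA; split=> [|x y|x] /=; first by rewrite conj1g; exact: sbg1.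
  by rewrite conjMg; exact: sbgM.
by rewrite conjVg; exact: sbgV.
Qed.

Lemma sbg_core A B : sbg A -> sbg (core B A).
Proof.
move=> sA; split=> [b _|x y Ax Ay b Bb|x Ax b Bb] /=.
- by rewrite conj1g; exact: sbg1.
- by rewrite conjMg; apply: sbgM => //; [exact: Ax|exact: Ay].
- by rewrite conjVg; apply: sbgV => //; exact: Ax.
Qed.

Lemma norms_core A B : sbg B -> norms B (core B A).
Proof.
move=> sB b x Bb Ax c Bc /=; rewrite -conjgM; apply: Ax; exact: sbgM.
Qed.

Lemma core_sub A B : sbg B -> core B A `<=` A.
Proof. by move=> sB x /(_ 1 (sbg1 sB)); rewrite conjg1. Qed.

(** [A] normalizes itself, so the condition that [x ^ b] lies in [A] depends only on the coset of
    [b], and the core is a finite intersection. *)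
Lemma finidx_core A B : sbg A -> sbg B -> finidx A B -> finidx (core B A) B.
Proof.
move=> sA sB fA; have [s [sB' sP]] := finidx_in sA fA.
pose F (t : seq G) := [set x | forall y, y \in t -> A (x ^ y)].
have sF t : sbg (F t).
  split=> [y _|x z Fx Fz y yt|x Fx y yt].
  - by rewrite conj1g; exact: sbg1.
  - by rewrite conjMg; apply: sbgM => //; [exact: Fx|exact: Fz].
  - by rewrite conjVg; apply: sbgV => //; exact: Fx.
have {}sF' t : (forall x, x \in t -> B x) -> finidx (F t) B.
  elim: t => [_|y t IH Bt]; first exact: finidx_refl (sbg1 (sF _)) _ _.
  have By : B y by apply: Bt; exact: mem_head.
  have fJ : finidx [set x | A (x ^ y)] B.
    by apply: finidxS (@finidxJ A B y fA) => // x Bx /=; exact: sbgJ.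
  apply: finidxS (finidxI (sbg_conj _ sA) (sF t) fJ (IH _)) => //.
    by move=> x [/= Ax Fx] z; rewrite inE => /predU1P[-> //|]; exact: Fx.
  by move=> x xt; apply: Bt; rewrite inE xt orbT.
apply: finidxS (sF' s sB') => // x Fx b Bb.
have [y ys Ay] := sP b Bb; rewrite -(mulVKg y b) conjgM.
by apply: sbgJ => //; exact: Fx.
Qed.

End Algebra.

(** * Conjugates, finite normal closures and centralizers *)

Definition conjS (G : groupType) (T : set G) (x : G) : set G :=
  [set t ^ x | t in T].

Definition centralizer (G : groupType) (B T : set G) : set G :=
  B `&` [set x | forall t, T t -> commute x t].

Section FiniteNormalClosure.
Context (G : groupType).
Implicit Types A B C K N T W : set G.

Lemma conjSE T x : conjS T x = [set y | T (y ^ x^-1)].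
Proof.
apply/seteqP; split=> [_ [t Tt <-]|y Ty]; first by rewrite /= conjgK.
by exists (y ^ x^-1) => //; rewrite conjgKV.
Qed.

Lemma sbg_conjS T x : sbg T -> sbg (conjS T x).
Proof. by rewrite conjSE => sT; exact: sbg_conj. Qed.

Lemma conjS1 T : conjS T 1 = T.
Proof. by rewrite conjSE; apply/seteqP; split=> x /=; rewrite invg1 conjg1. Qed.

Lemma conjSM T x y : conjS T (x * y) = conjS (conjS T x) y.
Proof.
by rewrite !conjSE; apply/seteqP; split=> z /=; rewrite invgM conjgM.
Qed.

Lemma conjSS T T' x : T `<=` T' -> conjS T x `<=` conjS T' x.
Proof. by move=> sT _ [t /sT Tt <-]; exists t. Qed.

Lemma conjS_norms B T b : sbg B -> norms B T -> B b -> conjS T b = T.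
Proof.
move=> sB nT Bb; rewrite conjSE; apply/seteqP; split=> x /=.
  by apply: normsVE nT _ => //; exact: sbgV.
by apply: nT; exact: sbgV.
Qed.

Lemma norms_conjS B W T b : sbg B -> norms B W -> norms W T -> B b ->
  norms W (conjS T b).
Proof.
move=> sB nBW nWT Bb w _ Ww [t Tt <-]; rewrite conjSE /=.
have -> : ((t ^ b) ^ w) ^ b^-1 = t ^ (w ^ b^-1).
  by rewrite [w ^ _]conjgE invgK !conjgM.
by apply: nWT => //; apply: nBW => //; exact: sbgV.
Qed.

Lemma sub_conjS B W T b : norms B W -> T `<=` W -> B b -> conjS T b `<=` W.
Proof. by move=> nW sT Bb _ [t /sT Wt <-]; exact: nW. Qed.

(* The product of the finitely many conjugates of [T] in [B]. *)
Lemma finite_normal_closure B W T : sbg B -> sbg W -> norms B W ->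
    finidx W B -> sbg T -> finite_set T -> T `<=` W -> norms W T ->
  exists T', [/\ sbg T', finite_set T', T `<=` T', T' `<=` W & norms B T'].
Proof.
move=> sB sW nBW fW sT fT sTW nWT.
have [s [sB' sP]] := finidx_in sW fW.
pose P r := foldr (fun x Q => conjS T x ** Q) [set 1] r.
have PP r : (forall x, x \in r -> B x) ->
    [/\ sbg (P r), finite_set (P r), P r `<=` W, norms W (P r) &
        forall x, x \in r -> conjS T x `<=` P r].
  elim: r => [_|x r IH Br] /=.
    split=> //; [exact: sbg_1|by move=> _ ->; exact: sbg1|exact: norms1].
  have Bx : B x by apply: Br; exact: mem_head.
  have [|sPr fPr PW nP cP] := IH.
    by move=> y yr; apply: Br; rewrite inE yr orbT.
  have sx := sbg_conjS x sT; have nx := norms_conjS sB nBW nWT Bx.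
  have xW := sub_conjS nBW sTW Bx.
  split.
  - by apply: sbg_mul => //; exact: normsS nP.
  - apply: (@sub_finite_set _ _ ((fun p => p.1 * p.2) @` (conjS T x `*` P r))).
      by move=> _ [a [b [? ? ->]]]; exists (a, b).
    by apply: finite_image; apply: finite_setX => //; exact: finite_image.
  - exact: mulS_sub.
  - exact: normsM.
  - move=> y; rewrite inE => /predU1P[->|/cP yP].
      by apply: mulS_subl; exact: sbg1.
    by apply: subset_trans yP _; apply: mulS_subr; exact: sbg1.
have [sPs fPs PW nP cP] := PP s sB'.
(* [W] normalizes the conjugates of [T], so [conjS T b] depends only on the coset of [b] modulo [W]
   and already occurs among the factors. *)
have cB b : B b -> conjS T b `<=` P s.
  move=> Bb; have [x xs Wx] := sP b Bb.
  rewrite -(mulVKg x b) conjSM.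
  rewrite (@conjS_norms W)//; first exact: cP.
  by apply: (@norms_conjS B) => //; exact: sB'.
exists (P s); split=> //.
  by rewrite -(conjS1 T); apply: cB; exact: sbg1.
have: forall r b, (forall x, x \in r -> B x) -> B b -> forall p, P r p -> P s (p ^ b).
  elim=> [|x r IH] b Br Bb p /=; first by move=> ->; rewrite conj1g; exact: sbg1.
  move=> [_ [q [[t Tt <-] Pq ->]]]; rewrite conjMg; apply: sbgM => //.
    rewrite -conjgM; apply: (cB (x * b)); last by exists t.
    by apply: sbgM => //; apply: Br; exact: mem_head.
  by apply: IH => // y yr; apply: Br; rewrite inE yr orbT.
by move=> H b p Bb Pp; exact: (H s).
Qed.

Lemma sbg_centralizer B T : sbg B -> sbg (centralizer B T).
Proof.
move=> sB; split=> [|x y [Bx cx] [By cy]|x [Bx cx]].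
- by split=> [|t _]; [exact: sbg1|exact/commute_sym/commute1].
- split=> [|t Tt]; first exact: sbgM.
  by apply/commute_sym/commuteM; apply/commute_sym; [exact: cx|exact: cy].
- split=> [|t Tt]; first exact: sbgV.
  by apply/commute_sym/commuteV/commute_sym; exact: cx.
Qed.

Lemma commute_conj (x y g : G) : commute x y -> commute (x ^ g) (y ^ g).
Proof. by move=> cxy; rewrite /commute -!conjMg cxy. Qed.

Lemma norms_centralizer B T : sbg B -> norms B T -> norms B (centralizer B T).
Proof.
move=> sB nT b x Bb [Bx cx]; split=> [|t Tt]; first exact: sbgJ.
rewrite -(conjgKV b t); apply: commute_conj; apply: cx.
by apply: nT => //; exact: sbgV.
Qed.

End FiniteNormalClosure.

(** * Closed normal subgroups of compact groups *)

Record ncl (G : topologicalGroupType) (B N : set G) : Prop := Ncl {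
  ncl_sbg : sbg N;
  ncl_closed : closed N;
  ncl_sub : N `<=` B;
  ncl_norms : norms B N }.

(** The form in which total disconnectedness is used once van Dantzig's theorem is available. *)
Definition small_subgroups (G : topologicalGroupType) :=
  forall O : set G, nbhs 1 O -> exists V : set G, [/\ sbg V, open V & V `<=` O].

Lemma compact_directed (T : topologicalType) (K : set T) (F : set (set T)) :
  compact K -> F !=set0 -> (forall A, F A -> closed A) ->
  (forall A B, F A -> F B -> exists2 C, F C & C `<=` A `&` B) ->
  (forall A, F A -> A `&` K !=set0) -> exists2 x, K x & forall A, F A -> A x.
Proof.
move=> cK [A0 FA0] clF dirF neF.
pose Fi := filter_from F (fun A => A `&` K).
have fFi : Filter Fi.
  apply: filter_from_filter; first by exists A0.
  move=> A B FA FB; have [C FC CAB] := dirF A B FA FB; exists C => //.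
  by move=> x [/CAB[Ax Bx] Kx].
have pFi : ProperFilter Fi by exact: filter_from_proper.
have [|x [Kx clx]] := cK Fi pFi; first by exists A0 => // x [].
exists x => // A FA; apply: (clF A FA) => U Ux.
have [|z [[Az Kz] Uz]] := clx (A `&` K) U _ Ux; first by exists A.
by exists z.
Qed.

(** The sets [A] minus [U] are directed, closed and without common point, so by compactness one of
    them is empty. *)
Lemma directed_open (T : topologicalType) (K : set T) (F : set (set T)) U :
  compact K -> F !=set0 -> (forall A, F A -> closed A /\ A `<=` K) ->
  (forall A B, F A -> F B -> exists2 C, F C & C `<=` A `&` B) ->
  open U -> (forall x, (forall A, F A -> A x) -> U x) ->
  exists2 A, F A & A `<=` U.
Proof.
move=> cK [A0 FA0] clF dirF oU FU; apply: contrapT => nA.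
have [| | | |x _ Fx] := @compact_directed _ K [set A `&` ~` U | A in F] cK.
- by exists (A0 `&` ~` U), A0.
- by move=> _ [A FA <-]; apply: closedI; [have [] := clF A FA|exact: open_closedC].
- move=> _ _ [A FA <-] [A' FA' <-]; have [C FC CA] := dirF A A' FA FA'.
  by exists (C `&` ~` U); [exists C|move=> x [/CA[]]].
- move=> _ [A FA <-]; apply: contrapT => ne; apply: nA; exists A => // x Ax.
  apply: contrapT => nUx; apply: ne; exists x; split=> //.
  by have [_] := clF A FA; apply.
have [_] : (A0 `&` ~` U) x by apply: Fx; exists A0.
apply; apply: FU => A FA.
by have [] : (A `&` ~` U) x by apply: Fx; exists A.
Qed.

Section Topology.
Context (G : topologicalGroupType).
Implicit Types A B C K N O T V W : set G.

Lemma continuous_mulg (X : topologicalType) (f g : X -> G) :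
  continuous f -> continuous g -> continuous (fun x => f x * g x).
Proof.
move=> cf cg x.
apply: (@cvg_comp _ _ _ (fun x => (f x, g x)) (fun z => z.1 * z.2) _
  (nbhs (f x, g x))); last exact: (@mulg_continuous G (f x, g x)).
by apply: cvg_pair; [exact: cf|exact: cg].
Qed.

Lemma continuous_invg (X : topologicalType) (f : X -> G) :
  continuous f -> continuous (fun x => (f x)^-1).
Proof. by move=> cf x; apply: cvg_comp (cf x) _; exact: invg_continuous. Qed.

Lemma continuous_conjg (X : topologicalType) (f g : X -> G) :
  continuous f -> continuous g -> continuous (fun x => f x ^ g x).
Proof.
move=> cf cg; apply: continuous_mulg; first exact: continuous_invg.
exact: continuous_mulg.
Qed.

Lemma continuous_expg (X : topologicalType) (f : X -> G) n :
  continuous f -> continuous (fun x => f x ^+ n).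
Proof.
move=> cf; elim: n => [|n IHn].
  rewrite (_ : (fun x => _) = fun=> 1); first exact: cst_continuous.
  by apply/funext => x; rewrite expg0.
rewrite (_ : (fun x => _) = fun x => f x * f x ^+ n).
  exact: continuous_mulg.
by apply/funext => x; rewrite expgS.
Qed.

Lemma continuous_id (X : topologicalType) : continuous (@id X).
Proof. by move=> x; exact: cvg_id. Qed.

Lemma continuous_mulgl (a : G) : continuous (fun x : G => a * x).
Proof.
by apply: continuous_mulg; [exact: cst_continuous|exact: continuous_id].
Qed.

Lemma continuous_mulgr (a : G) : continuous (fun x : G => x * a).
Proof.
by apply: continuous_mulg; [exact: continuous_id|exact: cst_continuous].
Qed.

Lemma continuous_conjgl (a : G) : continuous (fun x : G => x ^ a).
Proof.
by apply: continuous_conjg; [exact: continuous_id|exact: cst_continuous].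
Qed.

Lemma closed_preimage (X Y : topologicalType) (f : X -> Y) (D : set Y) :
  continuous f -> closed D -> closed (f @^-1` D).
Proof. by move=> cf; apply: preimage_closed => x _; exact: cf. Qed.

Lemma open_preimage (X Y : topologicalType) (f : X -> Y) (D : set Y) :
  continuous f -> open D -> open (f @^-1` D).
Proof. by move=> cf; move/continuousP: cf; apply. Qed.

Lemma compact_mulS A B : compact A -> compact B -> compact (A ** B).
Proof.
move=> cA cB; rewrite (_ : A ** B = (fun z => z.1 * z.2) @` (A `*` B)).
  apply: continuous_compact; last exact: compact_setX.
  exact/continuous_subspaceT/mulg_continuous.
apply/seteqP; split=> [_ [a [b [? ? ->]]]|_ [[a b] [? ?] <-]].
  by exists (a, b).
by exists a, b.
Qed.

Lemma closure_ind A C : closed C -> A `<=` C -> closure A `<=` C.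
Proof. by move=> /closure_id {2}-> /closureS. Qed.

Lemma sbg_closure A : sbg A -> sbg (closure A).
Proof.
move=> sA; split.
- by apply: subset_closure; exact: sbg1.
- move=> x y Ax Ay.
  have H1 a : A a -> closure A (a * y).
    move=> Aa; apply: (closure_ind (C := (fun y => a * y) @^-1` closure A)) Ay.
      by apply: closed_preimage; [exact: continuous_mulgl|exact: closed_closure].
    by move=> b Ab; apply: subset_closure; exact: sbgM.
  apply: (closure_ind (C := (fun x => x * y) @^-1` closure A)) Ax => //.
  by apply: closed_preimage; [exact: continuous_mulgr|exact: closed_closure].
- move=> x; apply: (closure_ind (C := (fun x => x^-1) @^-1` closure A)).
    apply: closed_preimage; last exact: closed_closure.
    exact: invg_continuous.
  by move=> b Ab; apply: subset_closure; exact: sbgV.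
Qed.

Lemma norms_closure B K : norms B K -> norms B (closure K).
Proof.
move=> nK b x Bb; apply: (closure_ind (C := (fun x => x ^ b) @^-1` closure K)).
  by apply: closed_preimage; [exact: continuous_conjgl|exact: closed_closure].
by move=> k Kk; apply: subset_closure; exact: nK.
Qed.

Lemma closed_conj A g : closed A -> closed [set x | A (x ^ g)].
Proof. by move=> cA; apply: closed_preimage cA; exact: continuous_conjgl. Qed.

Lemma closed_core A B : closed A -> closed (core B A).
Proof.
move=> cA; rewrite (_ : core B A = \bigcap_(b in B) [set x | A (x ^ b)]) //.
by apply: closed_bigI => b _; exact: closed_conj.
Qed.

Lemma closed_coset A x : closed A -> closed [set b | A (x^-1 * b)].
Proof. by move=> cA; apply: closed_preimage cA; exact: continuous_mulgl. Qed.

Lemma open_coset A x : open A -> open [set b | A (x^-1 * b)].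
Proof. by move=> cA; apply: open_preimage cA; exact: continuous_mulgl. Qed.

Lemma open_sbg A : sbg A -> nbhs 1 A -> open A.
Proof.
move=> sA A1; rewrite openE => a Aa /=.
have H : nbhs a [set x | A (a^-1 * x)].
  by apply: (@continuous_mulgl a^-1 a); rewrite mulVg.
rewrite /interior; apply: (filterS _ H) => x /= Aax.
by rewrite -(mulVKg a x); exact: sbgM.
Qed.

Lemma open_nbhs1 A : sbg A -> open A -> nbhs 1 A.
Proof. by move=> sA oA; apply: open_nbhs_nbhs; split=> //; exact: sbg1. Qed.

Lemma open_closed_sbg A : sbg A -> open A -> closed A.
Proof.
move=> sA oA; rewrite -[A]setCK; apply: open_closedC.
rewrite openE => a nAa /=.
have H : nbhs a [set x | A (a^-1 * x)].
  by apply: (@continuous_mulgl a^-1 a); rewrite mulVg; exact: open_nbhs1.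
rewrite /interior; apply: (filterS _ H) => x /= Aax Ax.
apply: nAa; apply: sbgVE => //; rewrite -(mulgK x a^-1).
by apply: sbgM => //; exact: sbgV.
Qed.

(** The listed cosets other than [A] itself are finitely many, closed and miss 1; off them, a point
    of [B] lies in [A]. *)
Lemma finidx_nbhs A B : sbg A -> closed A -> finidx A B ->
  exists2 O, nbhs 1 O & O `&` B `<=` A.
Proof.
move=> sA cA [s sP].
exists [set b | forall x, x \in s -> ~ A x -> ~ A (x^-1 * b)]; last first.
  move=> b [ns /sP[x xs Axb]]; have [Ax|nAx] := pselect (A x).
    by rewrite -(mulVKg x b); exact: sbgM.
  by have := ns x xs nAx Axb.
elim: {sP} s => [|x s IH]; first by apply: filterE.
have [Ax|nAx] := pselect (A x).
  by apply: filterS IH => b H y; rewrite inE => /predU1P[->//|]; exact: H.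
have ox : open (~` [set b | A (x^-1 * b)]).
  by apply: closed_openC; exact: closed_coset.
have : nbhs 1 (~` [set b | A (x^-1 * b)]).
  apply: open_nbhs_nbhs; split=> //= Ax; apply: nAx.
  by apply: sbgVE => //; rewrite -(mulg1 x^-1).
move=> N1; apply: filterS (filterI N1 IH) => b [/= nb H] y.
by rewrite inE => /predU1P[->//|]; exact: H.
Qed.

(** Otherwise points of [B] avoiding more and more cosets would cluster at some [x] in [B], but near
    [x] every point of [B] lies in the coset of [x]. *)
Lemma nbhs_finidx A B O : sbg A -> sbg B -> compact B -> nbhs 1 O ->
  O `&` B `<=` A -> finidx A B.
Proof.
move=> sA sB cB O1 OBA; apply: contrapT => nf.
pose F := filter_from [set: seq G]
  (fun s => [set b | B b /\ forall x, x \in s -> ~ A (x^-1 * b)]).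
have FF : ProperFilter F.
  apply: filter_from_proper; first apply: filter_from_filter.
  - by exists [::].
  - move=> s t _ _; exists (s ++ t) => // b [Bb H]; split; split=> // x xs.
      by apply: H; rewrite mem_cat xs.
    by apply: H; rewrite mem_cat xs orbT.
  - move=> s _; apply: contrapT => ne; apply: nf; exists s => b Bb.
    apply: contrapT => H; apply: ne; exists b; split=> // x xs Axb.
    by apply: H; exists x.
have [|x [Bx clx]] := cB F FF; first by exists [::] => // b [].
have Ox : nbhs x [set b | O (x^-1 * b)].
  by apply: (@continuous_mulgl x^-1 x); rewrite mulVg.
have [|b [[Bb H] Ob]] :=
  clx [set b | B b /\ forall y, y \in [:: x] -> ~ A (y^-1 * b)] _ _ Ox.
  by exists [:: x].
apply: (H x (mem_head _ _)); apply: OBA; split=> //.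
by apply: sbgM => //; exact: sbgV.
Qed.

Lemma finidx_open A B : sbg A -> closed A -> A `<=` B -> sbg B -> open B ->
  finidx A B -> open A.
Proof.
move=> sA cA AB sB oB fA; apply: open_sbg => //.
have [O O1 OBA] := finidx_nbhs sA cA fA.
by apply: filterS (filterI O1 (open_nbhs1 sB oB)).
Qed.

Lemma ncl_core A B : sbg A -> closed A -> sbg B -> A `<=` B -> ncl B (core B A).
Proof.
move=> sA cA sB AB; split; first exact: sbg_core.
- exact: closed_core.
- by apply: subset_trans AB; exact: core_sub.
- exact: norms_core.
Qed.

Lemma nclI B N N' : ncl B N -> ncl B N' -> ncl B (N `&` N').
Proof.
case=> sN cN NB nN [sN' cN' N'B nN']; split; first exact: sbgI.
- exact: closedI.
- by move=> x [/NB].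
- exact: normsI.
Qed.

Lemma nclIr B C N : ncl B N -> sbg C -> closed C -> C `<=` B -> ncl C (N `&` C).
Proof.
case=> sN cN NB nN sC cC CB; split; first exact: sbgI.
- exact: closedI.
- by move=> x [].
- by apply: normsI; [exact: normsS nN|exact: norms_self].
Qed.

Lemma nclS B C N : ncl B N -> C `<=` B -> N `<=` C -> ncl C N.
Proof. by case=> sN cN NB nN CB NC; split=> //; exact: normsS nN. Qed.

Context (hG : hausdorff_space G).

Lemma closed_1 : closed [set 1 : G].
Proof. by apply: accessible_closed_set1; exact: hausdorff_accessible. Qed.

Lemma closed_finite A : finite_set A -> closed A.
Proof. by apply: accessible_finite_set_closed.1; exact: hausdorff_accessible. Qed.

Lemma ncl1 B : sbg B -> ncl B [set 1].
Proof.
move=> sB; split; [exact: sbg_1|exact: closed_1| |exact: norms1].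
by move=> _ ->; exact: sbg1.
Qed.

Lemma nclT B : sbg B -> closed B -> ncl B B.
Proof. by move=> sB cB; split=> //; exact: norms_self. Qed.

Lemma closed_mulS A B : compact A -> compact B -> closed (A ** B).
Proof. by move=> cA cB; apply: compact_closed => //; exact: compact_mulS. Qed.

Lemma ncl_compact B N : compact B -> ncl B N -> compact N.
Proof. by move=> cB [sN cN NB nN]; exact: subclosed_compact cN cB NB. Qed.

Lemma ncl_mul B N N' : sbg B -> compact B -> ncl B N -> ncl B N' -> ncl B (N ** N').
Proof.
move=> sB cB nN nN'; have [sN _ NB nBN] := nN; have [sN' _ N'B nBN'] := nN'.
split.
- by apply: sbg_mul => //; exact: normsS nBN'.
- by apply: closed_mulS; [exact: ncl_compact nN|exact: ncl_compact nN'].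
- exact: mulS_sub.
- exact: normsM.
Qed.

Lemma ncl_centralizer B T : sbg B -> closed B -> norms B T ->
  ncl B (centralizer B T).
Proof.
move=> sB cB nT; split; first exact: sbg_centralizer.
- apply: closedI => //.
  rewrite (_ : [set x | _] = \bigcap_(t in T) [set x | [set 1] [~ x, t]]).
    apply: closed_bigI => t _; apply: (@closed_preimage G G (fun x => [~ x, t])).
      apply: continuous_mulg; first by apply: continuous_invg; exact: continuous_id.
      exact: continuous_conjgl.
    exact: closed_1.
  apply/seteqP; split=> x H t Tt.
    by apply/eqP/commgP; exact: H.
  by apply/commgP/eqP; exact: H.
- by move=> x [].
- exact: norms_centralizer.
Qed.

Context (vdG : small_subgroups G).

Lemma small_ncl B O : sbg B -> compact B -> nbhs 1 O ->
  exists V, [/\ ncl B V, finidx V B & V `<=` O].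
Proof.
move=> sB cB O1; have [V [sV oV VO]] := vdG O1.
have cV := open_closed_sbg sV oV; have clB := compact_closed hG cB.
have sVB := sbgI sV sB.
have fV : finidx (V `&` B) B by apply: (@nbhs_finidx _ _ V) => //; exact: open_nbhs1.
exists (core B (V `&` B)); split.
- by apply: ncl_core => //; exact: closedI.
- exact: finidx_core.
- by move=> x /(core_sub sB) [/VO].
Qed.

Lemma ncl_separate B A : sbg B -> compact B -> closed A -> ~ A 1 ->
  exists V, [/\ ncl B V, finidx V B & forall x, V x -> ~ A x].
Proof.
move=> sB cB cA nA1.
have [|V [nV fV VA]] := small_ncl (O := ~` A) sB cB.
  by apply: open_nbhs_nbhs; split=> //; exact: closed_openC.
by exists V; split=> // x /VA.
Qed.

Lemma directed_small B (F : set (set G)) O : compact B -> F !=set0 ->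
  (forall A, F A -> closed A /\ A `<=` B) ->
  (forall A A', F A -> F A' -> exists2 C, F C & C `<=` A `&` A') ->
  (forall x, (forall A, F A -> A x) -> x = 1) -> nbhs 1 O ->
  exists2 A, F A & A `<=` O.
Proof.
move=> cB F0 clF dirF F1; rewrite nbhsE => -[U [oU U1] UO].
have [x Fx|A FA AU] := directed_open cB F0 clF dirF oU.
  by rewrite (F1 x Fx).
by exists A => //; exact: subset_trans UO.
Qed.

End Topology.

(** * Van Dantzig's theorem *)

Section VanDantzig.
Context (G : topologicalGroupType) (hG : hausdorff_space G).
Implicit Types A B C K N O T V W : set G.

Lemma small_nbhs_quotient O : nbhs (1 : G) O ->
  exists W, [/\ open W, W 1 & forall x y, W x -> W y -> O (x * y^-1)].
Proof.
move=> O1.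
have c : continuous (fun z : G * G => z.1 * z.2^-1).
  apply: continuous_mulg; first by move=> z; exact: cvg_fst.
  by apply: continuous_invg => z; exact: cvg_snd.
have : nbhs ((1 : G, 1 : G)) [set z : G * G | O (z.1 * z.2^-1)].
  by apply: (c (1, 1)); rewrite /= mulgV.
move=> [[/= P Q] [P1 Q1] PQ].
have PQ1 : nbhs (1 : G) (P `&` Q) by exact: filterI.
move: PQ1; rewrite nbhsE => -[W [oW W1] WPQ].
exists W; split=> // x y /WPQ[Px _] /WPQ[_ Qy].
exact: (PQ (x, y)).
Qed.

Lemma compact_separate A B : compact A -> compact B -> A `&` B = set0 ->
  exists U V : set G, [/\ open U, open V, A `<=` U, B `<=` V & U `&` V = set0].
Proof.
move=> cA cB AB0.
have cAV : compact [set x^-1 | x in A].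
  apply: continuous_compact => //; apply: continuous_subspaceT.
  exact: invg_continuous.
have oD : open (~` ([set x^-1 | x in A] ** B)).
  by apply: closed_openC; exact: closed_mulS.
have D1 : nbhs 1 (~` ([set x^-1 | x in A] ** B)).
  apply: open_nbhs_nbhs; split=> // -[_ [b [[a Aa <-] Bb /esym/mulg1_eq]]].
  rewrite invgK => ab.
  have : (A `&` B) a by split=> //; rewrite ab.
  by rewrite AB0.
(* The translates [A W] and [B W] are disjoint: a common point would put an element of [A^-1 B]
   among the quotients of elements of [W], which avoid that set. *)
have [W [oW W1 WD]] := small_nbhs_quotient D1.
have oM C : open [set x | exists2 a, C a & W (a^-1 * x)].
  rewrite (_ : [set x | _] = \bigcup_(a in C) [set x | W (a^-1 * x)]) //.
  by apply: bigcup_open => a _; exact: open_coset.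
exists [set x | exists2 a, A a & W (a^-1 * x)].
exists [set x | exists2 a, B a & W (a^-1 * x)]; split=> //.
- by move=> a Aa; exists a => //; rewrite mulVg.
- by move=> a Aa; exists a => //; rewrite mulVg.
- apply/seteqP; split=> // x [[a Aa Wa] [b Bb Wb]].
  have := WD _ _ Wa Wb; apply; exists a^-1, b; split=> //; first by exists a.
  by rewrite invgM invgK mulgA mulgK.
Qed.

(* In a compact set the component of a point is the intersection of the
   relatively clopen sets around it. *)
Lemma small_clopen K x O : totally_disconnected [set: G] -> compact K -> K x ->
  nbhs x O -> exists C, [/\ C x, C `<=` K, closed C, closed (K `\` C) & C `<=` O].
Proof.
move=> td cK Kx; rewrite nbhsE => -[U [oU Ux] UO].
have clK := compact_closed hG cK.
pose F := [set C | [/\ C x, C `<=` K, closed C & closed (K `\` C)]].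
have FK : F K by split=> //; rewrite setDv; exact: closed0.
have F0 : F !=set0 by exists K.
have clF A : F A -> closed A /\ A `<=` K by case.
have dirF A B : F A -> F B -> exists2 C, F C & C `<=` A `&` B.
  move=> [Ax AK cA cA'] [Bx BK cB cB']; exists (A `&` B) => //; split=> //.
  - by move=> z [/AK].
  - exact: closedI.
  - by rewrite setDIr; exact: closedU.
pose Q := [set z | forall A, F A -> A z].
suff Q1 : Q `<=` [set x].
  have [z /Q1 ->//|A [Ax AK cA cA'] AU] := directed_open cK F0 clF dirF oU.
  by exists A; split=> //; exact: subset_trans UO.
have Qx : Q x by move=> A [].
have QK : Q `<=` K by move=> z /(_ K FK).
have cQ : closed Q.
  rewrite (_ : Q = \bigcap_(A in F) A) //; apply: closed_bigI => A [] //.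
suff conQ : connected Q.
  by rewrite -(td x I) => z Qz; exists Q.
move=> B [b Bb] [C oC BC] [D cD BD].
have cB : closed B by rewrite BD; exact: closedI.
have cQB : closed (Q `\` B).
  by rewrite BC setDIr setDv set0U; apply: closedI => //; exact: open_closedC.
have BQ : B `<=` Q by rewrite BD => z [].
have [|||V [W [oV oW BV QW VW]]] := @compact_separate B (Q `\` B).
- by apply: subclosed_compact cB cK _; exact: subset_trans QK.
- by apply: subclosed_compact cQB cK _ => z [/QK].
- by rewrite setDE setICA setICr setI0.
have [|A [Ax AK cA cA'] AVW] := directed_open cK F0 clF dirF (openU oV oW).
  move=> z Qz; have [Bz|nBz] := pselect (B z); first by left; exact: BV.
  by right; apply: QW.
(* [A] is covered by two disjoint open sets, so its part around [x] is again relatively clopen and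
   contains all of [Q]; hence [Q] cannot be split. *)
have clopenpart V' W' : open V' -> open W' -> V' `&` W' = set0 ->
    A `<=` V' `|` W' -> V' x -> F (A `&` V').
  move=> oV' oW' VW' AVW' Vx; split=> //.
  - by move=> z [/AK].
  - rewrite (_ : A `&` V' = A `&` ~` W').
      by apply: closedI => //; exact: open_closedC.
    apply/seteqP; split=> z [Az Vz]; split=> //.
      by move=> Wz; have : (V' `&` W') z by []; rewrite VW'.
    by case: (AVW' z Az).
  - rewrite setDIr; apply: closedU => //.
    by apply: closedI => //; exact: open_closedC.
apply/seteqP; split=> // z Qz; apply: contrapT => nBz.
have [Bx|nBx] := pselect (B x).
  have [_ Vz] : (A `&` V) z by apply: Qz; apply: (clopenpart V W) => //; exact: BV.
  have : (V `&` W) z by split=> //; exact: QW.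
  by rewrite VW.
have [_ Wb] : (A `&` W) b.
  apply: (BQ b Bb); apply: (clopenpart W V) => //; first by rewrite setIC.
    by rewrite setUC.
  exact: QW.
have : (V `&` W) b by split=> //; exact: BV.
by rewrite VW.
Qed.

Lemma van_dantzig O : locally_compact [set: G] -> totally_disconnected [set: G] ->
  nbhs (1 : G) O -> exists V, [/\ sbg V, open V, compact V & V `<=` O].
Proof.
move=> lc td O1.
have [K K1 [cK clK]] : exists2 K, nbhs (1 : G) K & compact K /\ closed K.
  have [K K1 cK] := lc 1 I; exists K => //; move: K1.
  by rewrite /within /=; apply: filterS => x /(_ I).
have [C [C1 CK clC clKC CO]] :=
  small_clopen td cK (nbhs_singleton K1) (filterI O1 (nbhs_interior K1)).
have oC : open C.
  rewrite (_ : C = K° `&` ~` (K `\` C)).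
    by apply: openI; [exact: open_interior|exact: closed_openC].
  apply/seteqP; split=> [z Cz|z [/interior_subset Kz nKC]].
    by split; [have [] := CO z Cz|case].
  by apply: contrapT => nCz; apply: nKC.
have cC := subclosed_compact clC cK CK.
(* [H] consists of the elements that, together with their inverses, right translate [C] into itself;
   it lies in [C] because 1 does. *)
pose H := [set x | forall c, C c -> C (c * x) /\ C (c * x^-1)].
have sH : sbg H.
  split=> [c Cc|x y Hx Hy c Cc|x Hx c Cc].
  - by rewrite invg1 mulg1.
  - have [Cx CxV] := Hx c Cc; have [Cy CyV] := Hy c Cc.
    by rewrite invgM !mulgA; have [] := Hy _ Cx; have [] := Hx _ CyV.
  - by rewrite invgK; have [] := Hx c Cc.
(* Compactness of [C] turns a neighbourhood of 1 for each [c] into one that serves all [c]. *)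
have H1 : nbhs 1 H.
  have := (compact_near_coveringP C).1 cC G (nbhs (1 : G))
    (fun x c => C (c * x) /\ C (c * x^-1)) _.
  apply => c Cc.
  have c1 : continuous (fun z : G * G => z.1 * z.2) by exact: mulg_continuous.
  have c2 : continuous (fun z : G * G => z.1 * z.2^-1).
    apply: continuous_mulg; first by move=> z; exact: cvg_fst.
    by apply: continuous_invg => z; exact: cvg_snd.
  have n1 : nbhs (c, 1 : G) [set z : G * G | C (z.1 * z.2)].
    by apply: (c1 (c, 1)); rewrite /= mulg1; exact: open_nbhs_nbhs.
  have n2 : nbhs (c, 1 : G) [set z : G * G | C (z.1 * z.2^-1)].
    by apply: (c2 (c, 1)); rewrite /= invg1 mulg1; exact: open_nbhs_nbhs.
  exact: filterI n1 n2.
have HC : H `<=` C by move=> x /(_ 1 C1)[]; rewrite mul1g.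
have oH := open_sbg sH H1.
exists H; split=> //.
- exact: subclosed_compact (open_closed_sbg sH oH) cC HC.
- by move=> x /HC/CO[].
Qed.

Lemma small_subgroups_td : locally_compact [set: G] ->
  totally_disconnected [set: G] -> small_subgroups G.
Proof.
by move=> lc td O /(van_dantzig lc td)[V [sV oV _ VO]]; exists V.
Qed.

End VanDantzig.

(** * Topological generation and complements up to finite index *)

Definition cgen (G : topologicalGroupType) (X : set G) : set G :=
  \bigcap_(H in [set H | [/\ sbg H, closed H & X `<=` H]]) H.

(** The complement is normal as well, so it commutes with [K] by [norms_cents]; for compact [B] the
    product [K ** C] is then direct and relatively open. *)
Definition complemented (G : topologicalGroupType) (B : set G) :=
  forall K, ncl B K -> exists C, [/\ ncl B C, K `&` C = [set 1] & finidx (K ** C) B].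

Section Generation.
Context (G : topologicalGroupType).
Implicit Types A B C H K N W X : set G.

Lemma sbg_cgen X : sbg (cgen X).
Proof. by apply: sbg_bigcap => H []. Qed.

Lemma closed_cgen X : closed (cgen X).
Proof. by apply: closed_bigI => H []. Qed.

Lemma sub_cgen X : X `<=` cgen X.
Proof. by move=> x Xx H [_ _]; apply. Qed.

Lemma cgen_min X H : sbg H -> closed H -> X `<=` H -> cgen X `<=` H.
Proof. by move=> sH cH XH x; apply. Qed.

Lemma norms_cgen B X : norms B X -> norms B (cgen X).
Proof.
move=> nX b x Bb; apply: (cgen_min (H := [set x | cgen X (x ^ b)])).
- exact: sbg_conj (sbg_cgen X).
- by apply: closed_conj; exact: closed_cgen.
- by move=> y Xy; apply: sub_cgen; exact: nX.
Qed.

Lemma cgen_ncl B X : sbg B -> closed B -> X `<=` B -> norms B X -> ncl B (cgen X).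
Proof.
move=> sB cB XB nX; split.
- exact: sbg_cgen.
- exact: closed_cgen.
- exact: cgen_min.
- exact: norms_cgen.
Qed.

Lemma closed_centralizer1 (hG : hausdorff_space G) (a : G) :
  closed [set x | commute a x].
Proof.
rewrite (_ : [set x | _] = (fun x : G => [~ x, a]) @^-1` [set 1]).
  apply: closed_preimage (closed_1 hG).
  apply: continuous_mulg; first exact: continuous_invg (@continuous_id _).
  exact: continuous_conjgl.
apply/seteqP; split=> y.
  by move=> /commute_sym/commgP/eqP.
by move=> /eqP/commgP/commute_sym.
Qed.

Lemma sbg_centralizer1 (a : G) : sbg [set x | commute a x].
Proof.
split=> [|x y|x] /=; first exact: commute1.
  exact: commuteM.
exact: commuteV.
Qed.

Lemma cents_cgenr (hG : hausdorff_space G) A X : cents A X -> cents A (cgen X).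
Proof.
move=> cAX a x Aa; apply: (cgen_min (H := [set x | commute a x])).
- exact: sbg_centralizer1.
- exact: closed_centralizer1.
- by move=> y; exact: cAX.
Qed.

Lemma cents_cgen (hG : hausdorff_space G) X : cents X X -> cents (cgen X) (cgen X).
Proof. by move=> cX; apply: cents_cgenr => //; apply: centsC; exact: cents_cgenr. Qed.

Lemma closed_finidx A B : sbg A -> closed A -> sbg B -> A `<=` B -> finidx A B ->
  closed B.
Proof.
move=> sA cA sB AB fA; have [s [sB' sP]] := finidx_in sA fA.
have -> : B = [set b | exists2 x, x \in s & A (x^-1 * b)].
  apply/seteqP; split=> [b /sP//|b [x /sB' Bx /AB Bxb]].
  by rewrite -(mulVKg x b); exact: sbgM.
elim: {fA sP sB'} s => [|x s IH].
  rewrite (_ : [set b | _] = set0); first exact: closed0.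
  by apply/seteqP; split=> // b [].
rewrite (_ : [set b | _] = [set b | A (x^-1 * b)] `|`
    [set b | exists2 x, x \in s & A (x^-1 * b)]).
  by apply: closedU => //; exact: closed_coset.
apply/seteqP; split=> b.
  move=> [y]; rewrite inE => /predU1P[-> ?|ys ?]; [by left|right].
  by exists y.
move=> [Axb|[y ys Ayb]]; first by exists x => //; exact: mem_head.
by exists y => //; rewrite inE ys orbT.
Qed.

(** Since [A] need not be normal, two powers of [b] in one coset are found by the pigeonhole
    principle; their exponents differ by at most [size s], and the factorial is a common multiple
    for all [b]. *)
Lemma expg_finidx A B : sbg A -> sbg B -> finidx A B ->
  exists2 m, (0 < m)%N & forall b, B b -> A (b ^+ m).
Proof.
move=> sA sB [s sP].
have key b : B b -> exists2 d, (0 < d <= size s)%N & A (b ^+ d).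
  move=> Bb.
  have rP i : exists2 x, x \in s & A (x^-1 * b ^+ i) by apply: sP; exact: sbgX.
  pose r i := s2val (cid2 (rP i)).
  have rs i : r i \in s by exact: (s2valP (cid2 (rP i))).
  have rA i : A ((r i)^-1 * b ^+ i) by exact: (s2valP' (cid2 (rP i))).
  have nu : ~~ uniq [seq r i | i <- iota 0 (size s).+1].
    apply/negP => /(uniq_leq_size (s2 := s)); rewrite size_map size_iota ltnn.
    by move=> H; suff : false by []; apply: H => _ /mapP[i _ ->].
  have [i [j [ij jn rij]]] : exists i j, [/\ (i < j)%N, (j < (size s).+1)%N & r i = r j].
    apply: contrapT => nex; move/negP: nu; apply.
    rewrite map_inj_in_uniq ?iota_uniq// => i j; rewrite !mem_iota !add0n /= => iN jN rij.
    have [ij|ji|//] := ltngtP i j; exfalso; apply: nex.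
      by exists i, j.
    by exists j, i.
  exists (j - i)%N; first by rewrite subn_gt0 ij /= (leq_trans (leq_subr _ _)).
  have -> : b ^+ (j - i) = (b ^+ i)^-1 * b ^+ j.
    by rewrite -{2}(subnKC (ltnW ij)) expgnDr mulKg.
  have -> : (b ^+ i)^-1 * b ^+ j = ((r i)^-1 * b ^+ i)^-1 * ((r j)^-1 * b ^+ j).
    by rewrite rij invgM invgK -mulgA mulVKg.
  by apply: sbgM => //; exact: sbgV.
exists (size s)`!; first exact: fact_gt0.
move=> b /key[d /andP[d0 ds] Ad].
have /dvdnP[q ->] : d %| (size s)`!.
  by apply: dvdn_fact; rewrite d0.
by rewrite mulnC expgnA; exact: sbgX.
Qed.

End Generation.

Section Complemented.
Context (G : topologicalGroupType) (hG : hausdorff_space G).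
Implicit Types A B C K N W : set G.

Lemma complemented_mul B1 B2 : sbg B1 -> sbg B2 -> compact B1 -> compact B2 ->
  cents B1 B2 -> B1 `&` B2 = [set 1] -> complemented B1 -> complemented B2 ->
  complemented (B1 ** B2).
Proof.
move=> s1 s2 c1 c2 c12 B120 C1 C2 K nK.
have [sK cK KB nBK] := nK.
have n12 := cents_norms c12; have n21 := cents_norms (centsC c12).
have sB : sbg (B1 ** B2) by exact: sbg_mul.
have cB : compact (B1 ** B2) by exact: compact_mulS.
have B1B : B1 `<=` B1 ** B2 by apply: mulS_subl; exact: sbg1.
have B2B : B2 `<=` B1 ** B2 by apply: mulS_subr; exact: sbg1.
have cpK : compact K by exact: ncl_compact cB nK.
have n2K : norms B2 K by exact: normsS nBK.
have n1K : norms B1 K by exact: normsS nBK.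
(* [K1] is the projection of [K] to [B1] and [K2] the kernel of that projection on [K]; complements
   of the two multiply to a complement of [K]. *)
pose K1 := B1 `&` (K ** B2); pose K2 := K `&` B2.
have nK1 : ncl B1 K1.
  split.
  - by apply: sbgI => //; exact: sbg_mulC.
  - by apply: closedI; [exact: compact_closed|exact: closed_mulS].
  - by move=> x [].
  - by apply: normsI; [exact: norms_self|exact: normsM].
have nK2 : ncl B2 K2 by apply: nclIr nK s2 _ B2B; exact: compact_closed.
have [D1 [nD1 KD1 fD1]] := C1 _ nK1; have [D2 [nD2 KD2 fD2]] := C2 _ nK2.
have [sD1 cD1 D1B nBD1] := nD1; have [sD2 cD2 D2B nBD2] := nD2.
have cD12 : cents D1 D2 by exact: centsS c12.
exists (D1 ** D2); split.
- split.
  + by apply: sbg_mul => //; exact: cents_norms.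
  + by apply: (closed_mulS hG); [exact: ncl_compact c1 nD1|exact: ncl_compact c2 nD2].
  + exact: mulSS.
  + apply: normsM; apply: norms_mul => //; apply: cents_norms.
      by apply: centsC; exact: centsS c12.
    exact: centsS c12.
- apply/seteqP; split=> [x|_ ->]; last first.
    split; first exact: sbg1.
    by exists 1, 1; rewrite mulg1; split=> //; exact: sbg1.
  move=> [Kx [d1 [d2 [Dd1 Dd2 E]]]].
  have Kd1 : K1 d1.
    split; first exact: D1B.
    exists x, d2^-1; split=> //; last by rewrite E mulgK.
    by apply: sbgV => //; exact: D2B.
  have d11 : d1 = 1 by have : (K1 `&` D1) d1 by []; rewrite KD1.
  have : (K2 `&` D2) x; last by rewrite KD2.
  by rewrite E d11 mul1g; split=> //; split; [rewrite E d11 mul1g in Kx|exact: D2B].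
- have [s1' [sB1 sP1]] := finidx_in (sbg_mul (ncl_sbg nK1) sD1
    (normsS (ncl_sub nK1) nBD1)) fD1.
  have [s2' [sB2 sP2]] := finidx_in (sbg_mul (ncl_sbg nK2) sD2
    (normsS (ncl_sub nK2) nBD2)) fD2.
  exists [seq x * y | x <- s1', y <- s2'] => _ [w [t [Bw Bt ->]]].
  have [x xs [k1 [d1 [[Bk1 [k [u [Kk Bu Ek]]]] Dd1 Ew]]]] := sP1 w Bw.
  (* The correction [u] in [k1 = k * u] is absorbed into the second factor before the decomposition
     there. *)
  have [|y ys [k2 [d2 [[Kk2 Bk2] Dd2 Et]]]] := sP2 (u * t) _; first exact: sbgM.
  exists (x * y); first exact: allpairs_f.
  have By := sB2 y ys.
  exists (k ^ y * k2), (d1 * d2); split.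
  + by apply: sbgM => //; exact: n2K.
  + by exists d1, d2.
  + have -> : w = x * (k * u * d1) by rewrite -Ek -Ew mulVKg.
    have -> : t = u^-1 * (y * (k2 * d2)) by rewrite -Et mulVKg mulKg.
    have cd1u : commute d1 u^-1 by apply: commuteV; apply: c12 => //; exact: D1B.
    have cd1y : commute d1 y by apply: c12 => //; exact: D1B.
    have cd1k : commute d1 k2.
      by apply: c12 => //; exact: D1B.
    rewrite invgM conjgE !mulgA mulgVK.
    rewrite -!mulgA; congr (_ * _); congr (_ * _).
    rewrite (mulgA d1) cd1u -!mulgA; rewrite mulVKg.
    by rewrite (mulgA d1 y) cd1y -!mulgA (mulgA d1 k2) cd1k !mulgA.
Qed.

End Complemented.

(** * Powers, cyclic subgroups and finite index *)

Definition power (G : groupType) (A : set G) n : set G := [set x ^+ n | x in A].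

Lemma compact_locally_compact (T : topologicalType) :
  compact [set: T] -> locally_compact [set: T].
Proof.
move=> cT x _; exists setT; first exact: filterT.
by split=> //; exact: closedT.
Qed.

Lemma norms_normalizer (G : groupType) (N : set G) :
  norms setT N <-> normalizer N = setT.
Proof.
split=> [nN|nN g k _ Nk].
  apply/seteqP; split=> // g _; exact: (conjS_norms (sbg_T G) nN).
have /= <- : normalizer N g by rewrite nN.
by exists k.
Qed.

Lemma finite_index_finidx (G : groupType) (N : set G) : sbg N ->
  finite_index N <-> finidx N setT.
Proof.
move=> sN; split=> [/finite_seqP[s sE]|[s sP]].
  exists [seq xget 1 C | C : set G <- s] => b _.
  have bs : [set b * n | n in N] \in s.
    have : [set` s] [set b * n | n in N] by rewrite -sE; exists b.
    by [].
  exists (xget 1 [set b * n | n in N]); first exact: map_f.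
  case: xgetP => [_ _ [n Nn <-]|/(_ b)].
    by rewrite invgM mulgVK; exact: sbgV.
  by case; exists 1; [exact: sbg1|rewrite mulg1].
apply: (@sub_finite_set _ _ ((fun x => [set x * n | n in N]) @` [set` s])).
  move=> _ [b _ <-]; have [x xs Nxb] := sP b I; exists x => //.
  apply/seteqP; split=> _ [n Nn <-].
    exists ((x^-1 * b)^-1 * n); first by apply: sbgM => //; exact: sbgV.
    by rewrite invgM invgK -mulgA mulVKg.
  exists ((x^-1 * b) * n); first exact: sbgM.
  by rewrite mulgA mulVKg.
by apply: finite_image; exact: finite_seq.
Qed.

Lemma sbg_power (G : groupType) (A : set G) n : sbg A -> cents A A -> sbg (power A n).
Proof.
move=> sA cA; split.
- by exists 1; [exact: sbg1|exact: expg1n].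
- move=> _ _ [x Ax <-] [y Ay <-]; exists (x * y); first exact: sbgM.
  by apply: expgMn; exact: cA.
- by move=> _ [x Ax <-]; exists x^-1; [exact: sbgV|exact: expVgn].
Qed.

Lemma norms_power (G : groupType) (A B : set G) n : norms B A -> norms B (power A n).
Proof.
by move=> nA b _ Bb [x Ax <-]; exists (x ^ b); [exact: nA|rewrite conjXg].
Qed.

Lemma power_sub (G : groupType) (A : set G) n : sbg A -> power A n `<=` A.
Proof. by move=> sA _ [x Ax <-]; exact: sbgX. Qed.

Lemma power_mul (G : groupType) (A : set G) m n : power A (m * n) = power (power A m) n.
Proof.
apply/seteqP; split=> [_ [x Ax <-]|_ [_ [x Ax <-] <-]].
  by exists (x ^+ m); [exists x|rewrite expgnA].
by exists x => //; rewrite expgnA.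
Qed.

Lemma compact_power (G : topologicalGroupType) (A : set G) n :
  compact A -> compact (power A n).
Proof.
move=> cA; apply: continuous_compact => //; apply: continuous_subspaceT.
by apply: continuous_expg; exact: continuous_id.
Qed.

Lemma ncl_power (G : topologicalGroupType) (hG : hausdorff_space G) (A B : set G) n :
  compact B -> ncl B A -> cents A A -> ncl B (power A n).
Proof.
move=> cB [sA cA AB nA] cAA; split; first exact: sbg_power.
- apply: compact_closed => //; apply: compact_power.
  exact: subclosed_compact cA cB AB.
- by apply: subset_trans AB; exact: power_sub.
- exact: norms_power.
Qed.

Lemma finite_cyclic (G : groupType) (a : G) n : (0 < n)%N -> a ^+ n = 1 ->
  let C := [set x | exists i, x = a ^+ i] in [/\ sbg C, finite_set C & C a].
Proof.
move=> n0 an1 /=.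
have modn i : a ^+ i = a ^+ (i %% n).
  by rewrite {1}(divn_eq i n) expgnDr mulnC expgnA an1 expg1n mul1g.
split; last by exists 1%N; rewrite expg1.
  split; first by exists 0%N; rewrite expg0.
    by move=> _ _ [i ->] [j ->]; exists (i + j)%N; rewrite expgnDr.
  (* Only natural exponents occur; [i * n - i] stands for [-i] modulo [n], without truncation
     because [n] is positive. *)
  move=> _ [i ->]; exists (i * n - i)%N.
  rewrite -[LHS]mulg1 -[X in _ * X](expg1n G i) -an1 -expgnA mulnC.
  by rewrite -{1}(subnKC (leq_pmulr i n0)) expgnDr mulKg.
apply: (@sub_finite_set _ _ ((fun i => a ^+ i) @` `I_n)).
  by move=> _ [i ->]; exists (i %% n)%N; [exact: ltn_pmod|rewrite -modn].
exact: finite_image.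
Qed.

(** * Just infinite groups *)

Section JustInfinite.
Context (L : topologicalGroupType) (jL : just_infinite L).
Implicit Types A B C D K N V W X Y : set L.

Let cT : compact [set: L]. Proof. by case: jL => -[]. Qed.
Let hL : hausdorff_space L. Proof. by case: jL => -[]. Qed.
Let vdL : small_subgroups L.
Proof.
case: jL => -[c h t] _ _; apply: small_subgroups_td => //.
exact: compact_locally_compact.
Qed.

Lemma ji_finidx N : ncl setT N -> N <> [set 1] -> finidx N setT.
Proof.
move=> [sN cN _ nN] N1; apply/finite_index_finidx => //.
case: jL => _ _; apply=> //; split; first exact/subgroupP.
exact/norms_normalizer.
Qed.

Lemma ji_infinite N : finidx N setT -> ~ finite_set N.
Proof. by move=> fN /(finidx_finite fN); case: jL. Qed.

Section Abelian.
Context (A : set L) (nA : ncl setT A) (cA : cents A A) (A1 : A <> [set 1]).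

Let sA : sbg A := ncl_sbg nA.
Let fA : finidx A setT := ji_finidx nA A1.

(** A torsion element spans a finite subgroup normal in [A], whose normal closure is finite; if
    nontrivial, that closure would have finite index in an infinite group. *)
Lemma ji_torsion_free a n : A a -> (0 < n)%N -> a ^+ n = 1 -> a = 1.
Proof.
move=> Aa n0 an1; have [sC fC Ca] := finite_cyclic n0 an1.
set C := [set x | _] in sC fC Ca.
have CA : C `<=` A by move=> _ [i ->]; exact: sbgX.
have nC : norms A C by apply: cents_norms; exact: centsS cA.
have [C' [sC' fC' CC' _ nC']] := finite_normal_closure (sbg_T L) sA
  (ncl_norms nA) fA sC fC CA nC.
apply: contrapT => a1; suff : finidx C' setT by move/ji_infinite.
apply: ji_finidx; first by split=> //; exact: closed_finite.
by move=> E; apply: a1; have := CC' a Ca; rewrite E.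
Qed.

Lemma ji_expg_inj a b n : A a -> A b -> (0 < n)%N -> a ^+ n = b ^+ n -> a = b.
Proof.
move=> Aa Ab n0 E; apply: divg1_eq.
apply: (@ji_torsion_free _ n) => //; first by apply: sbgM => //; exact: sbgV.
by rewrite expgnFl ?E ?mulgV//; exact: cA.
Qed.

Lemma ji_power n : (0 < n)%N -> ncl setT (power A n) /\ finidx (power A n) setT.
Proof.
move=> n0; have nP : ncl setT (power A n) by exact: ncl_power.
split=> //; apply: ji_finidx => // P1; apply: A1.
apply/seteqP; split=> [a Aa|_ ->]; last exact: sbg1.
apply: ji_torsion_free n0 _ => //.
by have : power A n (a ^+ n) by [exists a]; rewrite P1.
Qed.

(** If [p]-th powers gave all of [A] for every prime, [A] would be divisible. A normal subgroup of
    finite index contains all [m]-th powers for some [m], so it would contain [A], and [A] would be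
    trivial. *)
Lemma ji_prime : exists2 p, prime p & power A p <> A.
Proof.
apply: contrapT => nex.
have all m : (0 < m)%N -> power A m = A.
  elim/ltn_ind: m => m IH m0.
  have [m1|m1] := leqP m 1.
    have -> : m = 1%N by apply/eqP; rewrite eqn_leq m1.
    by apply/seteqP; split=> [_ [x Ax <-]|x Ax]; [rewrite expg1|exists x; rewrite ?expg1].
  have pp := pdiv_prime m1; have /dvdnP[q E] := pdiv_dvd m.
  have q0 : (0 < q)%N by move: m0; rewrite E; case: (q).
  rewrite E power_mul IH//; last by rewrite E ltn_Pmulr// prime_gt1.
  by apply: contrapT => np; apply: nex; exists (pdiv m).
apply: A1; apply/seteqP; split=> [a Aa|_ ->]; last exact: sbg1.
apply: contrapT => a1.
have [| |V [nV fV VA]] := @ncl_separate L hL vdL setT [set a] (sbg_T L) cT.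
- exact: closed_finite.
- by move=> /esym.
have [m m0 mV] := expg_finidx (ncl_sbg nV) (sbg_T L) fV.
have : A a by []; rewrite -(all m m0) => -[b Ab ba].
by apply: (VA a) => //; rewrite -ba; exact: mV.
Qed.

Lemma power_pfactor_sub p i j : (i <= j)%N -> power A (p ^ j) `<=` power A (p ^ i).
Proof.
move=> ij; rewrite -(subnKC ij) expnD mulnC power_mul.
by move=> _ [_ [x Ax <-] <-]; exists (x ^+ (p ^ (j - i))) => //; exact: sbgX.
Qed.

(** If the intersection of the groups of [p ^ k]-th powers were nontrivial, it would have finite
    index and contain every [a ^+ m] for some [m]. Unique roots and Bezout then make every [a] a
    [p]-th power. *)
Lemma ji_power_cap p x : prime p -> power A p <> A ->
  (forall k, power A (p ^ k) x) -> x = 1.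
Proof.
move=> pp pA xP; apply: contrapT => x1; apply: pA.
have p0 := prime_gt0 pp.
pose N := \bigcap_(k in [set: nat]) power A (p ^ k).
have nN : ncl setT N.
  have nk k : ncl setT (power A (p ^ k)).
    by have [] := @ji_power (p ^ k); rewrite ?expn_gt0 ?p0.
  split=> //; first by apply: sbg_bigcap => k _; exact: ncl_sbg (nk k).
    by apply: closed_bigI => k _; exact: ncl_closed (nk k).
  by apply: norms_bigcap => k _; exact: ncl_norms (nk k).
have fN : finidx N setT.
  by apply: ji_finidx => // N1; apply: x1; have : N x by []; rewrite N1.
have [m m0 mN] := expg_finidx (ncl_sbg nN) (sbg_T L) fN.
apply/seteqP; split=> [|a Aa]; first exact: power_sub.
have [m' pm' mE] := pfactor_coprime pp m0.
(* The exponent is one more than that of [p] in [m], so one factor [p] survives the cancellation. *)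
have [b Ab bE] := mN a I (logn p m).+1 I.
have {}bE : a ^+ m' = b ^+ p.
  apply: (@ji_expg_inj _ _ (p ^ logn p m)); rewrite ?expn_gt0 ?p0//; try exact: sbgX.
  by rewrite -!expgnA -mE -expnS.
have m'0 : (0 < m')%N by move: m0; rewrite mE; case: (m').
have [u v uv _] := egcdnP p m'0.
have {}uv : (u * m' = v * p + 1)%N by rewrite uv gcdnC (eqP pm').
exists (b ^+ u / a ^+ v); first by apply: sbgM; [|exact: sbgX|apply: sbgV => //; exact: sbgX].
rewrite expgnFl; last by apply: cA; exact: sbgX.
rewrite -!expgnA (mulnC u) expgnA -bE -expgnA mulnC uv expgnDr expg1.
by rewrite (cA (sbgX _ sA Aa) Aa) mulgK.
Qed.

(* A closed procyclic subgroup of [A] is a copy of the p-adic integers. *)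
Lemma ji_procyclic a b : A a -> cgen [set a] b -> b <> 1 ->
  exists2 N, (0 < N)%N & cgen [set b] (a ^+ N).
Proof.
move=> Aa ab b1; have [p pp pA] := ji_prime; have p0 := prime_gt0 pp.
have pk k : ncl setT (power A (p ^ k)) /\ finidx (power A (p ^ k)) setT.
  by apply: ji_power; rewrite expn_gt0 p0.
(* [n] bounds the [p]-adic valuation of [b], and [p ^ n] is the exponent that works. *)
have [n nb] : exists n, ~ power A (p ^ n.+1) b.
  apply: contrapT => nex; apply: b1; apply: (ji_power_cap pp pA) => k.
  apply: (power_pfactor_sub (leqnSn k)).
  by apply: contrapT => nb; apply: nex; exists k.
exists (p ^ n)%N; first by rewrite expn_gt0 p0.
have Ab : A b.
  by apply: (cgen_min sA (ncl_closed nA)) ab => _ ->.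
apply: contrapT => nC.
(* a small power subgroup [D] separates [a ^+ (p ^ n)] from [cgen [set b]] *)
have [k kn Dk] : exists2 k, (n < k)%N &
    forall c, power A (p ^ k) c -> ~ cgen [set b] (a ^+ (p ^ n) * c).
  have [| | | | |U [k _ <-] UO] := @directed_small L setT
    [set power A (p ^ k) | k in setT] (~` [set c | cgen [set b] (a ^+ (p ^ n) * c)]) cT.
  - by exists (power A (p ^ 0)), 0%N.
  - by move=> _ [k _ <-]; split=> //; exact: ncl_closed (pk k).1.
  - move=> _ _ [i _ <-] [j _ <-]; exists (power A (p ^ maxn i j)); first by exists (maxn i j).
    by move=> c Pc; split; apply: power_pfactor_sub Pc; rewrite ?leq_maxl ?leq_maxr.
  - by move=> x H; apply: (ji_power_cap pp pA) => k; apply: H; exists k.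
  - apply: open_nbhs_nbhs; split; last by rewrite /= mulg1.
    apply: closed_openC.
    apply: (@closed_preimage L L (fun c => a ^+ (p ^ n) * c) (cgen [set b])).
      exact: continuous_mulgl.
    exact: closed_cgen.
  exists (maxn k n.+1); first by rewrite leq_max leqnn orbT.
  by move=> c /(power_pfactor_sub (leq_maxl k n.+1))/UO.
pose D := power A (p ^ k).
have sD : sbg D := ncl_sbg (pk k).1.
have DA : D `<=` A by exact: power_sub.
have Dp x : A x -> D (x ^+ (p ^ k)) by exists x.
(* [H] is the product of the cyclic group of [a] with [D]. It contains [D] with finite index, so it
   is closed, and [b] is some [a ^+ t] up to [D]. *)
pose H := [set x | A x /\ exists t, D (a ^- t * x)].
have sH : sbg H.
  split.
  - by split; [exact: sbg1|exists 0%N; rewrite expg0 invg1 mulg1; exact: sbg1].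
  - move=> x y [Ax [i Di]] [Ay [j Dj]]; split; first exact: sbgM.
    exists (i + j)%N; have -> : a ^- (i + j) * (x * y) = (a ^- i * x) * (a ^- j * y).
      rewrite addnC expgnDr invgM -!mulgA; congr (_ * _).
      by rewrite !mulgA (cA (sbgV sA (sbgX j sA Aa)) Ax).
    exact: sbgM.
  - move=> x [Ax [i Di]]; split; first exact: sbgV.
    exists (p ^ k * i - i)%N.
    have -> : a ^- (p ^ k * i - i) * x^-1 = (a ^+ i ^+ (p ^ k))^-1 * (a ^- i * x)^-1.
      have ii : (i <= p ^ k * i)%N by rewrite leq_pmull// expn_gt0 p0.
      rewrite -expgnA (mulnC i) -{2}(subnKC ii) expgnDr !invgM invgK.
      by rewrite (cA (sbgV sA Ax) (sbgX i sA Aa)) -mulgA mulKg.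
    by apply: sbgM => //; apply: sbgV => //; apply: Dp; exact: sbgX.
have DH : D `<=` H.
  by move=> x Dx; split; [exact: DA|exists 0%N; rewrite expg0 invg1 mul1g].
have cH : closed H.
  apply: closed_finidx sD (ncl_closed (pk k).1) sH DH _.
  exact: finidxS (pk k).2.
have [_ [t Dt]] : H b.
  apply: (cgen_min sH cH) ab => _ ->; split=> //; exists 1%N.
  by rewrite expg1 mulVg; exact: sbg1.
set c := a ^- t * b in Dt; have bE : b = a ^+ t * c by rewrite mulVKg.
clearbody c.
have ct : ~~ (p ^ n.+1 %| t)%N.
  apply/negP => /dvdnP[q tE]; apply: nb.
  rewrite bE; apply: (sbgM (ncl_sbg (pk n.+1).1)).
    by exists (a ^+ q); [exact: sbgX|rewrite tE expgnA].
  exact: power_pfactor_sub Dt.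
have t0 : (0 < t)%N by case: (t) ct; rewrite ?dvdn0.
(* The gcd of [t] and [p ^ k] is [p ^ j] with [j <= n], so some multiple [t * e] is congruent to
   [p ^ n] modulo [p ^ k]. Then [b ^+ e] lies in [a ^+ (p ^ n)] times [D], which the choice of [D]
   forbids. *)
have [u v uv _] := egcdnP (p ^ k) t0.
have /(dvdn_pfactor _ _ pp)[j jk gE] : (gcdn t (p ^ k) %| p ^ k)%N by exact: dvdn_gcdr.
have jn : (j <= n)%N.
  rewrite leqNgt; apply/negP => nj; move/negP: ct; apply.
  apply: dvdn_trans (dvdn_gcdl t (p ^ k)); rewrite gE.
  exact: dvdn_exp2l.
rewrite gE in uv.
have E : (t * (u * p ^ (n - j)) = p ^ k * (v * p ^ (n - j)) + p ^ n)%N.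
  by rewrite mulnA (mulnC t) uv mulnDl -expnD subnKC// -mulnA mulnCA.
set e := (u * p ^ (n - j))%N in E.
apply: (Dk (a ^+ (v * p ^ (n - j)) ^+ (p ^ k) * c ^+ e)).
  by apply: sbgM => //; [apply: Dp; exact: sbgX|exact: sbgX].
have -> : a ^+ (p ^ n) * (a ^+ (v * p ^ (n - j)) ^+ (p ^ k) * c ^+ e) = b ^+ e.
  rewrite bE [RHS]expgMn; last by apply: cA; [exact: sbgX|exact: DA].
  by rewrite -!expgnA E addnC expgnDr mulgA [(_ * p ^ k)%N]mulnC.
by apply: (sbgX e (sbg_cgen [set b])); exact: sub_cgen.
Qed.

End Abelian.
End JustInfinite.

(** * Complements in just infinite groups *)

Section JustInfiniteComplements.
Context (L : topologicalGroupType) (jL : just_infinite L).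
Implicit Types A B C D K N V W X Y : set L.

Let cT : compact [set: L]. Proof. by case: jL => -[]. Qed.
Let hL : hausdorff_space L. Proof. by case: jL => -[]. Qed.
Let vdL : small_subgroups L.
Proof.
case: jL => -[c h t] _ _; apply: small_subgroups_td => //.
exact: compact_locally_compact.
Qed.
Let sT : sbg [set: L] := sbg_T L.

Section Abelian.
Context A (nA : ncl setT A) (cA : cents A A) (A1 : A <> [set 1]).

Let sA : sbg A := ncl_sbg nA.
Let clA : closed A := ncl_closed nA.
Let cpA : compact A. Proof. exact: ncl_compact cT nA. Qed.
Let fA : finidx A setT := ji_finidx jL nA A1.

Definition procyclic_prod (t : seq L) : set L :=
  foldr (fun x P => cgen [set x] ** P) [set 1] t.

Lemma cgen1_sub x : A x -> cgen [set x] `<=` A.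
Proof. by move=> Ax; apply: cgen_min => // _ ->. Qed.

Lemma abelian_sbg_mul K K' : K `<=` A -> K' `<=` A -> sbg K -> sbg K' -> sbg (K ** K').
Proof.
by move=> KA KA' sK sK'; apply: sbg_mul => //; apply: cents_norms; exact: centsS cA.
Qed.

Lemma abelian_closed_mul K K' : K `<=` A -> K' `<=` A -> closed K -> closed K' ->
  closed (K ** K').
Proof.
by move=> KA KA' cK cK'; apply: closed_mulS => //; exact: subclosed_compact cpA _.
Qed.

Lemma procyclic_prodP t : (forall x, x \in t -> A x) ->
  [/\ sbg (procyclic_prod t), closed (procyclic_prod t) & procyclic_prod t `<=` A].
Proof.
elim: t => [_|x t IH At] /=.
  by split; [exact: sbg_1|exact: closed_1|move=> _ ->; exact: sbg1].
have [|sP cP PA] := IH; first by move=> y yt; apply: At; rewrite inE yt orbT.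
have xA : cgen [set x] `<=` A by apply: cgen1_sub; apply: At; exact: mem_head.
split.
- by apply: abelian_sbg_mul => //; exact: sbg_cgen.
- by apply: abelian_closed_mul => //; exact: closed_cgen.
- exact: mulS_sub.
Qed.

(** The first nontrivial component of [x] is singled out; those before it are trivial, so the
    cofactor lies in the product with [y] left out. This prepares an exchange argument. *)
Lemma procyclic_prod_split t x : (forall y, y \in t -> A y) ->
  procyclic_prod t x -> x <> 1 ->
  exists t1 y t2 b z, [/\ t = t1 ++ y :: t2, cgen [set y] b, b <> 1,
    procyclic_prod (t1 ++ t2) z & x = b * z].
Proof.
elim: t x => [x _ -> //|y t IH x At /= [b [z [yb tz E]]] x1].
have [b1|b1] := pselect (b = 1); last by exists [::], y, t, b, z.
have [|||t1 [y' [t2 [b' [z' [Et yb' b'1 tz' Ez]]]]]] := IH z.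
- by move=> w wt; apply: At; rewrite inE wt orbT.
- by [].
- by move=> z1; apply: x1; rewrite E b1 z1 mulg1.
exists (y :: t1), y', t2, b', z'; split=> //; first by rewrite Et.
- by exists 1, z'; rewrite mul1g; split=> //; exact: sbg1 (sbg_cgen _).
- by rewrite E b1 mul1g.
Qed.

Lemma procyclic_prod_sub t x : x \in t -> cgen [set x] `<=` procyclic_prod t.
Proof.
elim: t => //= y t IH; rewrite inE => /predU1P[<-|xt].
  apply: mulS_subl; elim: (t) => //= w t' IHt.
  by exists 1, 1; rewrite mulg1; split=> //; exact: sbg1 (sbg_cgen _).
by apply: subset_trans (IH xt) _; apply: mulS_subr; exact: sbg1 (sbg_cgen _).
Qed.

Lemma procyclic_prod_cat t1 y t2 : (forall x, x \in t1 ++ y :: t2 -> A x) ->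
  procyclic_prod (t1 ++ y :: t2) `<=` cgen [set y] ** procyclic_prod (t1 ++ t2).
Proof.
elim: t1 => [|x t1 IH] At; first by [].
move=> _ [b [c [xb tc ->]]].
have [w wt|d [e [yd te ->]]] := IH _ _ tc.
  by apply: At; rewrite inE wt orbT.
have Ab : A b by apply: cgen1_sub xb; apply: At; exact: mem_head.
have Ad : A d.
  by apply: cgen1_sub yd; apply: At; rewrite inE mem_cat mem_head !orbT.
exists d, (b * e); split=> //; first by exists b, e.
by rewrite !mulgA (cA Ab Ad).
Qed.

(** An exchange argument as for vector spaces: take a shortest list whose procyclic product together
    with [K] has finite index. If it met [K] nontrivially, a power of one generator would lie in the
    group generated by [K] and the others, and that generator could be left out. *)
Lemma ji_abelian_complement K : ncl A K ->
  exists C, [/\ ncl A C, K `&` C = [set 1] & finidx (K ** C) A].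
Proof.
move=> [sK cK KA _].
have [a Aa a1] : exists2 a, A a & a <> 1.
  apply: contrapT => nex; apply: A1; apply/seteqP; split=> [a Aa|_ ->]; last exact: sbg1.
  by apply: contrapT => a1; apply: nex; exists a.
have [s [_ sP]] := finidx_in sA fA.
pose s0 := [seq a ^ x | x <- s].
have s0A y : y \in s0 -> A y.
  by move=> /mapP[x _ ->]; apply: (ncl_norms nA).
have KP t : (forall x, x \in t -> A x) ->
    sbg (K ** procyclic_prod t) /\ closed (K ** procyclic_prod t).
  move=> /procyclic_prodP[sP' cP PA].
  by split; [exact: abelian_sbg_mul|exact: abelian_closed_mul].
(* Such lists exist: as [A] is abelian of finite index, some [a <> 1] has finitely many conjugates,
   and they generate a closed normal subgroup, which has finite index. *)
have f0 : finidx (K ** procyclic_prod s0) A.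
  have [sP0 cP0 PA0] := procyclic_prodP s0A.
  have Xn : norms setT [set a ^ g | g in setT].
    by move=> b _ _ [g _ <-]; exists (g * b) => //; rewrite conjgM.
  have XA : [set a ^ g | g in setT] `<=` procyclic_prod s0.
    move=> _ [g _ <-]; have [x xs Ax] := sP g I.
    have -> : a ^ g = a ^ x.
      rewrite -(mulVKg x g) conjgM; apply/commuteJ; apply: cA => //.
      by apply: (ncl_norms nA).
    by apply: (@procyclic_prod_sub _ (a ^ x)); [exact: map_f|exact: sub_cgen].
  have nN : ncl setT (cgen [set a ^ g | g in setT]) by apply: cgen_ncl => //; exact: closedT.
  have fN : finidx (cgen [set a ^ g | g in setT]) setT.
    apply: (ji_finidx jL) => // N1; apply: a1.
    have : cgen [set a ^ g | g in setT] a.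
      by apply: sub_cgen; exists 1 => //; rewrite conjg1.
    by rewrite N1.
  apply: finidxS fN => //; apply: subset_trans (mulS_subr (sbg1 sK)).
  exact: cgen_min.
have [n [t [tA tn ft min]]] : exists n t, [/\ (forall x, x \in t -> A x), size t = n,
    finidx (K ** procyclic_prod t) A &
    forall t', (forall x, x \in t' -> A x) -> (size t' < n)%N ->
      ~ finidx (K ** procyclic_prod t') A].
  pose Q n := exists t, [/\ (forall x, x \in t -> A x), size t = n &
    finidx (K ** procyclic_prod t) A].
  have exQ : exists n, `[< Q n >] by exists (size s0); apply/asboolP; exists s0.
  have [n /asboolP[t [tA tn ft]] minn] := ex_minnP exQ.
  exists n, t; split=> // t' t'A t'n ft'.
  have := minn (size t') (introT (asboolP _) _).
  by rewrite leqNgt t'n => /(_ (ex_intro _ t' (And3 t'A erefl ft'))).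
have [sPt cPt PtA] := procyclic_prodP tA.
exists (procyclic_prod t); split=> //.
  by split=> //; apply: cents_norms; exact: centsS cA.
apply/seteqP; split=> [x [Kx tx]|_ ->]; last by split; exact: sbg1.
apply: contrapT => x1.
have [t1 [y [t2 [b [z [tE yb b1 t12z xE]]]]]] := procyclic_prod_split tA tx x1.
have t12A w : w \in t1 ++ t2 -> A w.
  move=> wt; apply: tA; rewrite tE mem_cat inE.
  by move: wt; rewrite mem_cat => /orP[]->; rewrite ?orbT.
apply: (min (t1 ++ t2)) => //.
  by rewrite -tn tE !size_cat /= addnS.
have [sM clM] := KP _ t12A; set M := K ** _ in sM clM *.
have [sP12 _ P12A] := procyclic_prodP t12A.
have Ay : A y by apply: tA; rewrite tE mem_cat mem_head orbT.
have MA : M `<=` A by exact: mulS_sub.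
have Mb : M b.
  by exists x, z^-1; split=> //; [exact: sbgV|rewrite xE mulgK].
have [N N0 yN] := ji_procyclic jL nA cA A1 Ay yb b1.
have MyN : M (y ^+ N) by apply: cgen_min yN => // _ ->.
apply: finidx_trans ft.
have yM i : M (y ^+ i ^+ N) by rewrite -expgnA mulnC expgnA; exact: sbgX.
(* [M'] is generated by [y] and [M]. As [y ^+ N] is in [M], it contains [M] with finite index and is
   closed, so it contains [cgen [set y]]. *)
pose M' := [set g | A g /\ exists i, M (y ^- i * g)].
have sM' : sbg M'.
  split.
  - by split; [exact: sbg1|exists 0%N; rewrite expg0 invg1 mulg1; exact: sbg1].
  - move=> u v [Au [i Mi]] [Av [j Mj]]; split; first exact: sbgM.
    exists (i + j)%N; have -> : y ^- (i + j) * (u * v) = (y ^- i * u) * (y ^- j * v).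
      rewrite addnC expgnDr invgM -!mulgA; congr (_ * _).
      by rewrite !mulgA (cA (sbgV sA (sbgX j sA Ay)) Au).
    exact: sbgM.
  - move=> u [Au [i Mi]]; split; first exact: sbgV.
    exists (N * i - i)%N.
    have -> : y ^- (N * i - i) * u^-1 = (y ^+ i ^+ N)^-1 * (y ^- i * u)^-1.
      have ii : (i <= N * i)%N by rewrite leq_pmull.
      rewrite -expgnA (mulnC i) -{2}(subnKC ii) expgnDr !invgM invgK.
      by rewrite (cA (sbgV sA Au) (sbgX i sA Ay)) -mulgA mulKg.
    by apply: sbgM => //; exact: sbgV.
have MM' : M `<=` M'.
  by move=> u Mu; split; [exact: MA|exists 0%N; rewrite expg0 invg1 mul1g].
have fM' : finidx M M'.
  exists [seq y ^+ i | i <- iota 0 N] => g [Ag [i Mi]].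
  exists (y ^+ (i %% N)); first by apply: map_f; rewrite mem_iota ltn_pmod.
  have -> : y ^- (i %% N) * g = (y ^+ (i %/ N) ^+ N) * (y ^- i * g).
    rewrite -expgnA {3}(divn_eq i N) addnC expgnDr invgM -!mulgA.
    by rewrite mulVKg.
  exact: sbgM.
have clM' := closed_finidx sM clM sM' MM' fM'.
apply: finidxS fM' => //; apply: mulS_sub => //.
  by apply: subset_trans MM'; apply: mulS_subl; exact: sbg1.
rewrite tE; apply: subset_trans (procyclic_prod_cat _) _; first by rewrite -tE.
apply: mulS_sub => //; last first.
  by apply: subset_trans MM'; apply: mulS_subr; exact: sbg1.
apply: cgen_min => // _ ->; split=> //; exists 1%N.
by rewrite expg1 mulVg; exact: sbg1.
Qed.

End Abelian.

(* Shrinking [K] to [Y] by intersecting with its conjugates one at a time, as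
   long as the intersection is nontrivial. *)
Lemma conj_minimal W K (s : seq L) : ncl W K -> K <> [set 1] ->
  (forall x, x \in s -> ncl W (conjS K x)) ->
  exists Y, [/\ ncl W Y, Y <> [set 1], Y `<=` K &
    forall x, x \in s -> Y `<=` conjS K x \/ Y `&` conjS K x = [set 1]].
Proof.
move=> nK K1; elim: s => [|x s IH] ns; first by exists K; split.
have [|Y [nY Y1 YK Ys]] := IH; first by move=> y ys; apply: ns; rewrite inE ys orbT.
have [E|NE] := pselect (Y `&` conjS K x = [set 1]).
  exists Y; split=> // y; rewrite inE => /predU1P[->|/Ys//].
  by right.
exists (Y `&` conjS K x); split=> //.
- by apply: nclI => //; apply: ns; exact: mem_head.
- by move=> y [/YK].
- move=> y; rewrite inE => /predU1P[->|ys]; first by left=> z [].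
  have [H|H] := Ys y ys; [left=> z [/H]|right] => //.
  apply/seteqP; split=> z; first by move=> [[Yz _] Kz]; rewrite -H.
  move=> ->; have ss V : ncl W V -> V 1 by move=> /ncl_sbg/sbg1.
  split; first (split; first exact: ss nY).
    by apply: ss; apply: ns; exact: mem_head.
  by apply: ss; apply: ns; rewrite inE ys orbT.
Qed.

Lemma ncl_conjS W K x : ncl setT W -> ncl W K -> ncl W (conjS K x).
Proof.
move=> [sW cW _ nW] [sK cK KW nK]; split.
- exact: sbg_conjS.
- by rewrite conjSE; exact: closed_conj.
- exact: sub_conjS nW KW _.
- exact: norms_conjS sT nW nK _.
Qed.

Lemma conjS_disjoint Y K x : Y `&` K = [set 1] ->
  conjS Y x `&` conjS K x = [set 1].
Proof.
move=> YK; apply/seteqP; split=> [z|_ ->]; rewrite !conjSE /=.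
  by move=> H; have : (Y `&` K) (z ^ x^-1) by [];
    rewrite YK => /eqP; rewrite conjg_eq1 => /eqP.
by rewrite /= conj1g; have : (Y `&` K) 1 by rewrite YK.
Qed.

(** Conjugates of [K] by elements of one coset of [W] coincide, so a finite list covers all
    conjugates. *)
Lemma conj_minimal_all W K : ncl setT W -> finidx W setT -> ncl W K -> K <> [set 1] ->
  exists Y, [/\ ncl W Y, Y <> [set 1], Y `<=` K &
    forall x, Y `<=` conjS K x \/ Y `&` conjS K x = [set 1]].
Proof.
move=> nW fW nK K1; have [s sP] := fW.
have [|Y [nY Y1 YK H]] := @conj_minimal W K s nK K1.
  by move=> x _; exact: ncl_conjS.
exists Y; split=> // g; have [x xs Wx] := sP g I.
have -> : conjS K g = conjS K x; last exact: H.
rewrite -(mulVKg x g) conjSM.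
rewrite (@conjS_norms _ W) //; first exact: ncl_sbg nW.
exact: ncl_norms (ncl_conjS _ nW nK).
Qed.

Lemma range_conjS_norms (Y : set L) (P : set L) :
  (forall x b, P x -> P (x * b)) ->
  norms setT (\bigcup_(x in P) conjS Y x).
Proof.
move=> PM b _ _ [x Px [y Yy <-]]; exists (x * b); first exact: PM.
by exists y => //; rewrite conjgM.
Qed.

Lemma ji_conj_finidx Y : Y <> [set 1] -> Y 1 ->
  finidx (cgen (\bigcup_(x in setT) conjS Y x)) setT.
Proof.
move=> Y1 Y11; set X := \bigcup_(x in _) _.
have YX : Y `<=` cgen X.
  by move=> y Yy; apply: sub_cgen; exists 1 => //; rewrite conjS1.
apply: (ji_finidx jL).
  by apply: cgen_ncl => //; exact: range_conjS_norms.
move=> E; apply: Y1; apply/seteqP; split=> [y /YX|_ -> //].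
by rewrite E.
Qed.

(** [Y] and its conjugate by [x] either both lie in the abelian group [conjS K x], or are normal in
    [W] and meet trivially. Either way they commute, so the conjugates of [Y] generate an abelian
    group. *)
Lemma ji_abelian W K : ncl setT W -> finidx W setT -> ncl W K -> K <> [set 1] ->
  cents K K -> exists A, [/\ ncl setT A, cents A A & A <> [set 1]].
Proof.
move=> nW fW nK K1 cK.
have [Y [nY Y1 YK YP]] := conj_minimal_all nW fW nK K1.
have Y11 := sbg1 (ncl_sbg nY).
have YY x : cents Y (conjS Y x).
  have [H|H] := YP x.
    apply: (@centsS _ (conjS K x) (conjS K x)) => //; first exact: conjSS.
    by move=> _ _ [a Ka <-] [b Kb <-]; apply: commute_conj; exact: cK.
  have nYx := ncl_conjS x nW nY.
  apply: norms_cents; [exact: ncl_sbg nY|exact: ncl_sbg nYx| | |].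
  - by apply: normsS (ncl_norms nYx); exact: ncl_sub nY.
  - by apply: normsS (ncl_norms nY); exact: ncl_sub nYx.
  - apply/seteqP; split=> [z [Yz Yxz]|_ ->].
      by rewrite -H; split=> //; exact: conjSS YK _ Yxz.
    by split=> //; exact: sbg1 (ncl_sbg nYx).
set X := \bigcup_(x in setT) conjS Y x.
exists (cgen X); split.
- by apply: cgen_ncl => //; exact: range_conjS_norms.
- apply: cents_cgen => // _ _ [x _ [a Ya <-]] [y _ [b Yb <-]].
  have -> : b ^ y = (b ^ (y * x^-1)) ^ x by rewrite -conjgM mulgVK.
  by apply: commute_conj; apply: (YY (y * x^-1)) => //; exists b.
- move=> E; have := ji_conj_finidx Y1 Y11; rewrite -/X E => /(ji_infinite jL).
  by apply; exact: finite_set1.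
Qed.

(** [C] is generated by conjugates of [Y] meeting [K] trivially, so it commutes with [K]; the
    intersection of [K] and [C] is then abelian, hence trivial. Every other conjugate of [Y] lies in
    [K], so [K ** C] contains the normal subgroup generated by [Y]. *)
Lemma ji_nonabelian_complement W :
  (forall D, ncl W D -> cents D D -> D = [set 1]) ->
  ncl setT W -> finidx W setT -> complemented W.
Proof.
move=> noab nW fW K nK; have sW := ncl_sbg nW.
have clW := ncl_closed nW; have cW := ncl_compact cT nW.
have [K1|K1] := pselect (K = [set 1]).
  exists W; split; first exact: nclT.
    by rewrite K1; apply/seteqP; split=> [x []//|_ ->]; split=> //; exact: sbg1.
  apply: (finidx_refl _ sW); last by apply: mulS_subr; exact: sbg1 (ncl_sbg nK).
  exact: (mulS_subl (sbg1 sW) (sbg1 (ncl_sbg nK))).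
have [Y [nY Y1 YK YP]] := conj_minimal_all nW fW nK K1.
have Y11 := sbg1 (ncl_sbg nY).
pose P := [set x | conjS Y x `&` K = [set 1]].
pose C := cgen (\bigcup_(x in P) conjS Y x).
have PW x w : P x -> W w -> P (x * w).
  move=> Px Ww; rewrite /P /= conjSM -(conjS_norms sW (ncl_norms nK) Ww).
  exact: conjS_disjoint.
have nC : ncl W C.
  apply: cgen_ncl => //.
    by move=> z [x _ H]; exact: (ncl_sub (ncl_conjS x nW nY)) H.
  move=> w _ Ww [x Px [y Yy <-]]; exists (x * w); first exact: PW.
  by exists y => //; rewrite conjgM.
have cKC : cents K C.
  apply: cents_cgenr => //; apply: centsC => _ k [x Px [y Yy <-]] Kk.
  have nYx := ncl_conjS x nW nY.
  apply: (@norms_cents _ (conjS Y x) K) => //; last by exists y.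
  - exact: ncl_sbg nYx.
  - exact: ncl_sbg nK.
  - by apply: normsS (ncl_norms nK); exact: ncl_sub nYx.
  - by apply: normsS (ncl_norms nYx); exact: ncl_sub nK.
exists C; split=> //.
  apply: noab; first exact: nclI.
  by move=> x y [Kx _] [_ Cy]; exact: cKC.
have nKC : ncl W (K ** C) by exact: ncl_mul.
have : finidx (K ** C) setT; last exact: finidxS.
apply: finidxS (ji_conj_finidx Y1 Y11) => //.
apply: cgen_min; [exact: ncl_sbg nKC|exact: ncl_closed nKC|].
(* The dichotomy for [x^-1], conjugated back by [x], compares [conjS Y x] with [K] itself. *)
move=> z [x _ Yz]; have [H|H] := YP x^-1.
  apply: mulS_subl; first exact: sbg1 (ncl_sbg nC).
  have := conjSS H Yz; rewrite -conjSM mulVg conjS1; exact.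
apply: mulS_subr; first exact: sbg1 (ncl_sbg nK).
apply: sub_cgen; exists x => //.
by have := conjS_disjoint x H; rewrite -conjSM mulVg conjS1.
Qed.

Lemma ji_complemented O : nbhs (1 : L) O ->
  exists W, [/\ ncl setT W, finidx W setT, W `<=` O & complemented W].
Proof.
move=> O1; have [V [nV fV VO]] := small_ncl hL vdL sT cT O1.
have [[A [nA cA A1]]|nex] := pselect (exists A, [/\ ncl setT A, cents A A & A <> [set 1]]).
  have fA := ji_finidx jL nA A1.
  have nAV := nclI nA nV.
  exists (A `&` V); split=> //.
  - by apply: finidxI fA fV; [exact: ncl_sbg nA|exact: ncl_sbg nV].
  - by move=> x [_ /VO].
  - have cAV : cents (A `&` V) (A `&` V) by apply: centsS cA => x [].
    apply: ji_abelian_complement => //.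
    move=> E; have := finidxI (ncl_sbg nA) (ncl_sbg nV) fA fV.
    by rewrite E => /(ji_infinite jL); apply; exact: finite_set1.
exists V; split=> //; apply: ji_nonabelian_complement => // D nD cD.
apply: contrapT => D1; apply: nex; exact: ji_abelian nD D1 cD.
Qed.

End JustInfiniteComplements.

(** * Transfer between complements and (LD) *)

Lemma compact_homeomorphism_on (T U : topologicalType) (A : set T) (B : set U)
    (f : T -> U) : hausdorff_space U -> compact A ->
  {within A, continuous f} -> set_bij A B f -> homeomorphism_on A B f.
Proof.
move=> hU cA cf fbij; have [fAB finj fsurj] := fbij; split=> // O OA.
move=> /open_subspaceP[V oV VA].
have cZ : closed (f @` (A `&` ~` V)).
  apply: compact_closed => //; apply: continuous_compact.
    by apply: continuous_subspaceW cf => x [].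
  by apply: compact_closedI => //; exact: open_closedC.
apply/open_subspaceP; exists (~` (f @` (A `&` ~` V))); first exact: closed_openC.
apply/seteqP; split=> [b [nZ Bb]|_ [[x Ox <-] Bx]]; split=> //.
  have [x Ax fx] := fsurj b Bb; exists x => //.
  have Vx : V x by apply: contrapT => nVx; apply: nZ; exists x.
  by have : (V `&` A) x by []; rewrite VA => -[].
move=> [y [Ay nVy] fyx]; apply: nVy.
have <- : x = y by apply: finj; rewrite ?inE//; exact: OA.
have : (O `&` A) x by split=> //; exact: OA.
by rewrite -VA => -[].
Qed.

Section Transfer.

(* The second factor of the complement turns [K `&` B] into a direct factor. *)
Lemma complemented_LD (G : topologicalGroupType) (B K : set G) :
  hausdorff_space G -> sbg B -> open B -> compact B -> complemented B ->
  sbg K -> closed K -> norms B K -> exists L : set G,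
    [/\ subgroup L, L `<=` K, open (L : set (subspace K)) &
        exists2 H : set G, open_subgroup H & direct_factor L H].
Proof.
move=> hG sB oB cB coB sK cK nK.
have clB := compact_closed hG cB.
have nKB : ncl B (K `&` B).
  split; [exact: sbgI|exact: closedI|by move=> x []|].
  by apply: normsI => //; exact: norms_self.
have [C [nC KC fKC]] := coB _ nKB.
have sKB := ncl_sbg nKB; have sC := ncl_sbg nC.
have cKB := ncl_compact cB nKB; have cC := ncl_compact cB nC.
exists (K `&` B); split; [exact/subgroupP|by move=> x []| |].
  by apply/open_subspaceP; exists B => //; rewrite setIAC setIid setIC.
have nKC : norms (K `&` B) C by apply: normsS (ncl_norms nC) => x [].
have nCK : norms C (K `&` B).
  by apply: normsS (ncl_norms nKB); exact: ncl_sub nC.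
have sH := sbg_mul sKB sC nKC.
have oH : open ((K `&` B) ** C).
  apply: (finidx_open sH _ _ sB oB fKC); first exact: closed_mulS.
  by apply: mulS_sub => //; exact: ncl_sub nC.
exists ((K `&` B) ** C); first by split=> //; exact/subgroupP.
exists C; split; [exact/subgroupP|exact/subgroupP|exact: norms_cents|].
apply: compact_homeomorphism_on => //; first exact: compact_setX.
  exact/continuous_subspaceT/mulg_continuous.
split.
- by move=> [x y] [/= Kx Cy]; exists x, y.
- move=> [x y] [x' y']; rewrite !inE /= => -[Kx Cy] [Kx' Cy'] E.
  have xy : x'^-1 * x = y' * y^-1.
    by rewrite -[x](mulgK y) E mulgA mulKg.
  have : ((K `&` B) `&` C) (x'^-1 * x).
    split; first by apply: sbgM => //; exact: sbgV.
    by rewrite xy; apply: sbgM => //; exact: sbgV.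
  rewrite KC /= => x1; congr (_, _).
    by rewrite -(mulVKg x' x) x1 mulg1.
  by rewrite x1 in xy; apply/esym/divg1_eq.
- by move=> _ [x [y [Kx Cy ->]]]; exists (x, y).
Qed.

Lemma complemented_image (G H : topologicalGroupType) (f : G -> H) (B : set G) :
  hausdorff_space H -> {morph f : x y / x * y} -> injective f -> continuous f ->
  sbg B -> compact B -> complemented B -> complemented (f @` B).
Proof.
move=> hH fM finj cf sB cB coB K [sK cK KB nK].
have f1 : f 1 = 1 by apply: (mulgI (f 1)); rewrite -fM !mulg1.
have fV x : f x^-1 = (f x)^-1 by apply: (mulgI (f x)); rewrite -fM !mulgV.
have fJ x y : f (x ^ y) = f x ^ f y by rewrite !conjgE !fM fV.
pose K' := f @^-1` K.
have K'B : K' `<=` B.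
  by move=> x /KB[y By] /finj <-.
have [|C [[sC cC CB nC] KC fC]] := coB K'.
  split=> //.
  - split; first by rewrite /K' /= f1; exact: sbg1.
      by move=> x y; rewrite /K' /= fM; exact: sbgM.
    by move=> x; rewrite /K' /= fV; exact: sbgV.
  - exact: closed_preimage.
  - by move=> b x Bb; rewrite /K' /= fJ; apply: nK; exists b.
exists (f @` C); split.
- split.
  + split; first by exists 1 => //; exact: sbg1.
      by move=> _ _ [x Cx <-] [y Cy <-]; exists (x * y); [exact: sbgM|].
    by move=> _ [x Cx <-]; exists x^-1; [exact: sbgV|].
  + apply: compact_closed => //; apply: continuous_compact.
      exact: continuous_subspaceT.
    exact: subclosed_compact cC cB CB.
  + by move=> _ [x /CB Bx <-]; exists x.
  + by move=> _ _ [b Bb <-] [x Cx <-]; exists (x ^ b); [exact: nC|].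
- apply/seteqP; split=> [y|_ ->].
    move=> [Ky [x Cx E]]; have : (K' `&` C) x by split=> //; rewrite /K' /= E.
    by rewrite KC => x1; rewrite -E x1 f1.
  by split; [exact: sbg1|exists 1 => //; exact: sbg1].
- have [s sP] := fC; exists [seq f x | x <- s] => _ [b Bb <-].
  have [x xs [k [c [Kk Cc E]]]] := sP b Bb.
  exists (f x); first exact: map_f.
  by exists (f k), (f c); split=> //; rewrite -fV -!fM E.
Qed.

Lemma complemented_preimage (G H : topologicalGroupType) (f : G -> H)
    (V : set G) (B : set H) :
  hausdorff_space H -> sbg V -> compact V -> closed V ->
  {within V, continuous f} -> {in V &, {morph f : x y / x * y}} -> set_inj V f ->
  sbg B -> closed B -> B `<=` f @` V -> complemented B ->
  complemented (V `&` f @^-1` B).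
Proof.
move=> hH sV cV clV cf fM' finj sB cB BV coB K [sK cK KB nK].
have fM x y : V x -> V y -> f (x * y) = f x * f y.
  by move=> Vx Vy; apply: fM'; rewrite inE.
have V1 := sbg1 sV.
have f1 : f 1 = 1 by apply: (mulgI (f 1)); rewrite -fM// !mulg1.
have fV x : V x -> f x^-1 = (f x)^-1.
  by move=> Vx; apply: (mulgI (f x)); rewrite -fM ?mulgV//; exact: sbgV.
have fJ x y : V x -> V y -> f (x ^ y) = f x ^ f y.
  move=> Vx Vy; rewrite !conjgE !fM ?fV//; try exact: sbgV; exact: sbgM.
have KV : K `<=` V by move=> x /KB[].
have nfK : ncl B (f @` K).
  split.
  - split; first by exists 1 => //; exact: sbg1.
      move=> _ _ [x Kx <-] [y Ky <-]; exists (x * y); first exact: sbgM.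
      by apply: fM; exact: KV.
    by move=> _ [x Kx <-]; exists x^-1; [exact: sbgV|apply: fV; exact: KV].
  - apply: compact_closed => //; apply: continuous_compact.
      exact: continuous_subspaceW cf.
    exact: subclosed_compact cK cV KV.
  - by move=> _ [x /KB[_ Bx] <-].
  - move=> b _ Bb [x Kx <-]; have [y Vy yb] := BV b Bb.
    exists (x ^ y); last by rewrite -yb; apply: fJ => //; exact: KV.
    by apply: nK => //; split=> //; rewrite /= yb.
have [C [[sC cC CB nC] KC fC]] := coB _ nfK.
have closedV D : closed D -> closed (V `&` f @^-1` D).
  move=> cD; rewrite setIC closed_setIS//.
  by apply: preimage_closed cD => x _; exact: cf.
have sbgV' D : sbg D -> sbg (V `&` f @^-1` D).
  move=> sD; split; first by split=> //=; rewrite f1; exact: sbg1.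
    move=> x y [Vx Dx] [Vy Dy]; split; first exact: sbgM.
    by rewrite /= fM//; exact: sbgM.
  by move=> x [Vx Dx]; split; [exact: sbgV|rewrite /= fV//; exact: sbgV].
exists (V `&` f @^-1` C); split.
- split; [exact: sbgV'|exact: closedV|by move=> x [Vx /CB]|].
  move=> b x [Vb Bb] [Vx Cx]; split; first exact: sbgJ.
  by rewrite /= fJ//; exact: nC.
- apply/seteqP; split=> [x [Kx [Vx Cx]]|_ ->].
    have : (f @` K `&` C) (f x) by split=> //; exists x.
    by rewrite KC => fx1; apply: finj; rewrite ?inE// f1.
  by split; [exact: sbg1|exact: sbg1 (sbgV' _ sC)].
- have [s [sB' sP]] := finidx_in (sbg_mul (ncl_sbg nfK) sC
    (normsS (ncl_sub nfK) nC)) fC.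
  exists [seq xget 1 [set x | V x /\ f x = y] | y <- s] => b [Vb Bb].
  have [y ys [_ [c [[k Kk <-] Cc E]]]] := sP (f b) Bb.
  set x := xget 1 [set x | V x /\ f x = y].
  have [Vx fx] : V x /\ f x = y.
    rewrite /x; case: xgetP => [z _ //|]; have [z Vz zy] := BV y (sB' y ys).
    by move=> /(_ z) []; split.
  exists x; first exact: (map_f (fun y => xget 1 [set x | V x /\ f x = y])).
  have Vk := KV k Kk.
  have Vxb : V (x^-1 * b) by apply: sbgM => //; exact: sbgV.
  have Vc : V (k^-1 * (x^-1 * b)) by apply: sbgM => //; exact: sbgV.
  exists k, (k^-1 * (x^-1 * b)); split=> //; last by rewrite mulVKg.
  split=> //=; rewrite !fM ?fV//; try exact: sbgV.
  by rewrite fx E mulKg.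
Qed.

End Transfer.

(** * Products *)

Section Product.
Context (I : Type) (L : I -> topologicalGroupType).
Let P : topologicalGroupType := prod_group L.
Implicit Types (A B : set I) (f g : P) (W : forall i, set (L i)).

Lemma prod_groupP f g : (forall i, f i = g i) -> f = g.
Proof. exact: functional_extensionality_dep. Qed.

Lemma prod_group_proj (i : I) : continuous (fun f : P => f i).
Proof. exact: (@proj_continuous {classic I} (fun i => L i : topologicalType) i). Qed.

Lemma prod_group_continuous (X : topologicalType) (F : X -> P) :
  (forall i, continuous (fun x => F x i)) -> continuous F.
Proof.
move=> cF x; apply/cvg_sup => i.
move=> D [B [[C oC <-] Cx] BA] /=.
by apply: (filterS BA); apply: (cF i x); exact: open_nbhs_nbhs.
Qed.

Lemma prod_conjE f g i : (f ^ g) i = f i ^ g i.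
Proof. by []. Qed.

Definition single (i : I) (x : L i) : P := fun j =>
  match pselect (i = j) with
  | left e => eq_rect i (fun k => L k : Type) x j e
  | right _ => 1
  end.

Lemma single_same i (x : L i) : single x i = x.
Proof.
rewrite /single; case: pselect => // e.
by rewrite (Prop_irrelevance e erefl).
Qed.

Lemma single_other i j (x : L i) : i <> j -> single x j = 1.
Proof. by rewrite /single; case: pselect. Qed.

Lemma singleM i : {morph @single i : x y / x * y}.
Proof.
move=> x y; apply: prod_groupP => j.
rewrite -[RHS]/(single x j * single y j).
have [<-|ij] := pselect (i = j); first by rewrite !single_same.
by rewrite !single_other// mulg1.
Qed.

Lemma single1 i : single (1 : L i) = 1.
Proof.
apply: prod_groupP => j.
have [<-|ij] := pselect (i = j); first exact: single_same.
exact: single_other.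
Qed.

Lemma singleV i (x : L i) : single x^-1 = (single x)^-1.
Proof.
apply: prod_groupP => j; rewrite -[RHS]/((single x j)^-1).
have [<-|ij] := pselect (i = j); first by rewrite !single_same.
by rewrite !single_other// invg1.
Qed.

Lemma single_inj i : injective (@single i).
Proof. by move=> x y /(congr1 (fun f : P => f i)); rewrite !single_same. Qed.

Lemma single_continuous i : continuous (@single i).
Proof.
apply: prod_group_continuous => j.
have [ij|ij] := pselect (i = j).
  case: _ / ij; rewrite (_ : (fun x => _) = id); first exact: continuous_id.
  by apply/funext => x; exact: single_same.
rewrite (_ : (fun x => _) = fun=> 1); first exact: cst_continuous.
by apply/funext => x; exact: single_other.
Qed.

Definition box (W : forall i, set (L i)) : set P := [set f | forall i, W i (f i)].

Lemma sbg_box W : (forall i, sbg (W i)) -> sbg (box W).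
Proof.
move=> sW; split.
- by move=> i; exact: sbg1.
- by move=> f g Wf Wg i; exact: (sbgM (sW i) (Wf i) (Wg i)).
- by move=> f Wf i; exact: (sbgV (sW i) (Wf i)).
Qed.

Lemma closed_box W : (forall i, closed (W i)) -> closed (box W).
Proof.
move=> cW.
rewrite (_ : box W = \bigcap_(i in setT) (fun f : P => f i) @^-1` W i).
  by apply: closed_bigI => i _; apply: closed_preimage => //; exact: prod_group_proj.
by apply/seteqP; split=> [f Wf i _|f Wf i]; [exact: Wf|exact: (Wf i Logic.I)].
Qed.

Lemma norms_box W W' : (forall i, norms (W i) (W' i)) -> norms (box W) (box W').
Proof. by move=> nW b k Wb Wk i; rewrite prod_conjE; apply: nW. Qed.

Lemma open_box W (s : seq {classic I}) : (forall i, sbg (W i)) ->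
  (forall i, i \notin s -> W i = setT) -> (forall i, open (W i)) -> open (box W).
Proof.
move=> sW Ws oW; apply: open_sbg; first exact: sbg_box.
suff : nbhs (1 : P) [set f : P | forall i, i \in s -> W i (f i)].
  apply: filterS => f H i; have [/H//|/Ws ->//] := boolP ((i : {classic I}) \in s).
elim: {Ws} s => [|i s IH]; first exact: filterE.
have H : nbhs (1 : P) ((fun f : P => f i) @^-1` W i).
  by apply: (prod_group_proj (x := 1 : P)); exact: open_nbhs1.
apply: filterS (filterI H IH) => f [/= Wi Hf] j.
by rewrite inE => /predU1P[->|]; [exact: Wi|exact: Hf].
Qed.

Definition on (A : set I) (W : forall i, set (L i)) : forall i, set (L i) :=
  fun i => [set x | (A i -> W i x) /\ (~ A i -> x = 1)].

Arguments on : clear implicits.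

Lemma onT A W i : A i -> on A W i = W i.
Proof.
by move=> Ai; apply/seteqP; split=> x; [case=> /(_ Ai)|move=> Wx; split].
Qed.

Lemma onF A W i : ~ A i -> on A W i = [set 1].
Proof.
by move=> Ai; apply/seteqP; split=> x; [case=> _ /(_ Ai)|move=> -> //; split].
Qed.

Lemma on_ind A W (Q : forall i, set (L i) -> Prop) :
  (forall i, A i -> Q i (W i)) -> (forall i, Q i [set 1]) ->
  forall i, Q i (on A W i).
Proof.
move=> QW Q1 i; have [Ai|nAi] := pselect (A i); first by rewrite onT//; exact: QW.
by rewrite onF.
Qed.

Hypothesis hL : forall i, hausdorff_space (L i).
Hypothesis cP : compact [set: P].
Hypothesis hP : hausdorff_space P.

Let full : forall i, set (L i) := fun=> setT.

Lemma sbg_on A W : (forall i, A i -> sbg (W i)) -> sbg (box (on A W)).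
Proof.
move=> sW; apply: sbg_box.
by apply: (on_ind (Q := fun i => @sbg (L i))) => // i; exact: sbg_1.
Qed.

Lemma closed_on A W : (forall i, A i -> closed (W i)) -> closed (box (on A W)).
Proof.
move=> cW; apply: closed_box.
apply: (on_ind (Q := fun i => @closed (L i))) => // i.
exact: closed_1.
Qed.

Lemma sub_closed_compact (D : set P) : closed D -> compact D.
Proof. by move=> cD; exact: subclosed_compact cD cP _. Qed.

(* A minimal set of factors generating [box (on A full)] together with [K]
   meets [K] trivially, since the factors are simple. *)
Lemma simple_prod_complemented A : (forall i, A i -> simple_group (L i)) ->
  complemented (box (on A full)).
Proof.
move=> simL K [sK cK KA nK].
set S := box (on A full) in KA nK *.
have sS B : sbg (box (on B full)) by apply: sbg_on => i _; exact: sbg_T.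
have cS B : closed (box (on B full)) by apply: closed_on => i _; exact: closedT.
(* [B] is a set of factors that can be discarded, so a maximal [B] leaves a minimal set of
   factors. *)
pose Q := [set B : set I | B `<=` A /\ S `<=` K ** box (on (A `\` B) full)].
have [F FQ totF|B [[BA SB] maxB]] := @Zorn_bigcup I Q.
  have [->|/set0P[B0 FB0]] := eqVneq F set0.
    rewrite bigcup_set0; split=> //; rewrite setD0.
    exact: mulS_subr (sbg1 sK).
  split; first by move=> i [B /FQ[BA _] /BA].
  move=> x Sx.
  (* Each [B] of the chain allows a closed nonempty set of choices for the [K]-component of [x];
     these sets are nested, so compactness gives a common choice. *)
  have [| | | |k Kk Fk] := @compact_directed P K
    [set [set k | box (on (A `\` B) full) (k^-1 * x)] | B in F] (sub_closed_compact cK).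
  - by exists [set k | box (on (A `\` B0) full) (k^-1 * x)], B0.
  - move=> _ [B FB <-].
    apply: (@closed_preimage P P (fun k => k^-1 * x) (box (on (A `\` B) full))) => //.
    apply: continuous_mulg; last exact: cst_continuous.
    exact: continuous_invg (@continuous_id _).
  - have dec B B' k : B `<=` B' -> box (on (A `\` B') full) (k^-1 * x) ->
        box (on (A `\` B) full) (k^-1 * x).
      move=> BB' H i; have [AB|AB] := pselect ((A `\` B) i); first by rewrite onT.
      rewrite onF//; have := H i; rewrite onF// => -[Ai nB'].
      by apply: AB; split=> // /BB'.
    move=> _ _ [B FB <-] [B' FB' <-].
    have [BB'|BB'] := totF B B' FB FB'.
      exists [set k | box (on (A `\` B') full) (k^-1 * x)]; first by exists B'.
      by move=> k Hk; split=> //; exact: dec Hk.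
    exists [set k | box (on (A `\` B) full) (k^-1 * x)]; first by exists B.
    by move=> k Hk; split=> //; exact: dec Hk.
  - move=> _ [B FB <-]; have [_ SB] := FQ B FB.
    have [k [y [Kk By xE]]] := SB x Sx; exists k; split=> //=.
    by rewrite xE mulKg.
  have {}Fk B : F B -> box (on (A `\` B) full) (k^-1 * x).
    move=> FB; exact: (Fk [set k | box (on (A `\` B) full) (k^-1 * x)]
      (ex_intro2 _ _ B FB erefl)).
  exists k, (k^-1 * x); split=> //; last by rewrite mulVKg.
  move=> i; have [AB|AB] := pselect ((A `\` \bigcup_(X in F) X) i); first by rewrite onT.
  rewrite onF//.
  have [Ai|nAi] := pselect (A i).
    have [B FB Bi] : (\bigcup_(X in F) X) i by apply: contrapT => H; apply: AB.
    by have := Fk B FB i; rewrite onF// => -[].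
  by have := Fk B0 FB0 i; rewrite onF// => -[].
pose C := box (on (A `\` B) full).
have CS : C `<=` S.
  move=> f Cf i; have [Ai|nAi] := pselect (A i); first by rewrite onT.
  by rewrite onF//; have := Cf i; rewrite onF// => -[].
have nSC : norms S C.
  apply: norms_box => i; have [ABi|nABi] := pselect ((A `\` B) i); first by rewrite (onT _ ABi).
  by rewrite (onF _ nABi); exact: norms1.
exists C; split.
- by split; [exact: sS|exact: cS|exact: CS|exact: nSC].
- apply/seteqP; split=> [x [Kx Cx]|_ ->]; last by split; [exact: sbg1|exact: sbg1 (sS _)].
  apply: contrapT => x1.
  have [i xi] : exists i, x i <> 1.
    apply: contrapT => H; apply: x1; apply: prod_groupP => i.
    by apply: contrapT => xi; apply: H; exists i.
  have [Ai nBi] : (A `\` B) i.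
    by apply: contrapT => nAB; apply: xi; have := Cx i; rewrite onF.
  (* The projection of the intersection to the [i]-th factor is normal and nontrivial, hence
     everything. The [i]-th coordinate can then be cleared by elements of [K], against the
     maximality of [B]. *)
  pose N := [set y i | y in K `&` C].
  have [simT simN] := simL i Ai.
  have NT : N = setT.
    have : normal_subgroup N.
      split.
        apply/subgroupP; split; first by exists 1 => //; split; [exact: sbg1|exact: sbg1 (sS _)].
          move=> _ _ [y [Ky Cy] <-] [z [Kz Cz] <-]; exists (y * z) => //.
          by split; [exact: sbgM|exact: (sbgM (sS _) Cy Cz)].
        move=> _ [y [Ky Cy] <-]; exists y^-1 => //.
        by split; [exact: sbgV|exact: (sbgV (sS _) Cy)].
      apply/norms_normalizer => g _ _ [y [Ky Cy] <-].
      have Sg : S (single g).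
        move=> j; have [Aj|nAj] := pselect (A j); first by rewrite onT.
        by rewrite onF//= single_other// => ij; apply: nAj; rewrite -ij.
      exists (y ^ single g); last by rewrite prod_conjE single_same.
      by split; [exact: nK|exact: nSC].
    case/simN => // N1; have : N (x i) by exists x.
    by rewrite N1.
  apply: (maxB (B `|` [set i])).
    split; first by move=> j Bj; left.
    by move=> /(_ i (or_intror erefl)).
  split; first by move=> j [/BA|->].
  move=> s Ss; have [k [c [Kk Cc ->]]] := SB s Ss.
  have [y [Ky Cy] yi] : N (c i) by rewrite NT.
  exists (k * y), (y^-1 * c); split; [exact: sbgM| |by rewrite !mulgA mulgK].
  have Cyc : C (y^-1 * c) by apply: (sbgM (sS _)) => //; exact: (sbgV (sS _) Cy).
  move=> j; have [ABj|nABj] := pselect ((A `\` (B `|` [set i])) j); first by rewrite onT.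
  rewrite onF//.
  have [->|ij] := pselect (j = i).
    by rewrite /= -[LHS]/((y i)^-1 * c i) yi mulVg.
  have := Cyc j; rewrite onF// => -[Aj nBj]; apply: nABj; split=> //.
  by case.
- apply: (finidx_refl _ (sS A)) => //.
  by apply: (mulS_subl (sbg1 (sS _))); exact: sbg1.
Qed.

Lemma compact_factor i : compact [set: L i].
Proof.
rewrite (_ : [set: L i] = (fun f : P => f i) @` setT).
  apply: continuous_compact => //; apply: continuous_subspaceT.
  exact: prod_group_proj.
by apply/seteqP; split=> // x _; exists (single x) => //; exact: single_same.
Qed.

Lemma box_eq W W' : (forall i, W i = W' i) -> box W = box W'.
Proof.
by move=> E; apply/seteqP; split=> f Wf i; [rewrite -E|rewrite E]; exact: Wf.
Qed.

Lemma box_complemented A W (s : seq {classic I}) : uniq s ->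
  (forall i, i \in s -> ~ A i) -> (forall i, sbg (W i)) ->
  (forall i, closed (W i)) -> (forall i, i \in s -> complemented (W i)) ->
  complemented (box (on A W)) -> complemented (box (on (A `|` [set` s]) W)).
Proof.
move=> us sA sW cW coW coA; elim: s us sA coW => [_ _ _|i s IH /= /andP[is' us] sA coW].
  by rewrite (_ : A `|` _ = A)// set_nil setU0.
have Ai : ~ (A `|` [set` s]) i.
  by case=> [|/= h]; [exact/sA/mem_head|rewrite h in is'].
have -> : box (on (A `|` [set` i :: s]) W) =
    (@single i @` W i) ** box (on (A `|` [set` s]) W).
  apply/seteqP; split=> [f Wf|_ [_ [g [[x Wx <-] Wg ->]]] j].
    exists (single (f i)), ((single (f i))^-1 * f); split.
    - exists (f i) => //; have := Wf i; rewrite onT//; right; exact: mem_head.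
    - move=> j; rewrite -[(_ * f) j]/((single (f i) j)^-1 * f j).
      have [ij|ij] := pselect (i = j).
        by case: _ / ij; rewrite single_same mulVg onF.
      rewrite single_other// invg1 mul1g; have := Wf j.
      have [Aj|nAj] := pselect ((A `|` [set` s]) j).
        rewrite !onT//; case: Aj => [?|/= js]; [by left|right].
        by rewrite /= inE js orbT.
      rewrite !onF// => -[Aj|]; first by apply: nAj; left.
      by rewrite /= inE => /predU1P[/esym//|js]; apply: nAj; right.
    - by rewrite mulVKg.
  rewrite -[(_ * g) j]/(single x j * g j).
  have [ij|ij] := pselect (i = j).
    case: _ / ij; rewrite single_same onT; last by right; exact: mem_head.
    by have := Wg i; rewrite onF// => ->; rewrite mulg1.
  rewrite single_other// mul1g; have := Wg j.
  have [Aj|nAj] := pselect ((A `|` [set` s]) j).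
    rewrite !onT//; case: Aj => [?|/= js]; [by left|right].
    by rewrite /= inE js orbT.
  rewrite !onF// => -[Aj|]; first by apply: nAj; left.
  by rewrite /= inE => /predU1P[/esym//|js]; apply: nAj; right.
have sg : sbg (@single i @` W i).
  split; first by exists 1; [exact: sbg1|exact: single1].
    move=> _ _ [x Wx <-] [y Wy <-]; exists (x * y); first exact: sbgM.
    exact: singleM.
  by move=> _ [x Wx <-]; exists x^-1; [exact: sbgV|exact: singleV].
have cWi : compact (W i) by apply: subclosed_compact (@compact_factor i) _.
apply: complemented_mul => //.
- by apply: sbg_on => j _.
- apply: continuous_compact => //; apply: continuous_subspaceT.
  exact: single_continuous.
- by apply: sub_closed_compact; apply: closed_on => j _.
- move=> _ g [x Wx <-] Wg; apply: prod_groupP => j.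
  change (single x j * g j = g j * single x j).
  have [ij|ij] := pselect (i = j).
    by case: _ / ij; have := Wg i; rewrite onF// => ->; rewrite mulg1 mul1g.
  by rewrite single_other// mulg1 mul1g.
- apply/seteqP; split=> [g|_ ->].
    move=> [[x Wx xg] Wg]; apply: prod_groupP => j.
    have [ij|ij] := pselect (i = j).
      by case: _ / ij; have := Wg i; rewrite onF.
    by rewrite -xg single_other.
  by split; [exact: sbg1|apply: sbg1; apply: sbg_on => j _].
- apply: complemented_image => //; [exact: singleM|exact: single_inj| |].
  + exact: single_continuous.
  + by apply: coW; exact: mem_head.
- apply: IH => // j js; [apply: sA|apply: coW]; by rewrite inE js orbT.
Qed.

(** Such boxes form a directed family of closed sets with intersection 1, so compactness puts one
    inside [O]. *)
Lemma small_box O : (forall i, small_subgroups (L i)) -> nbhs (1 : P) O ->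
  exists (W : forall i, set (L i)) (s : seq {classic I}),
    [/\ forall i, ncl setT (W i) /\ finidx (W i) setT,
        forall i, i \notin s -> W i = setT & box W `<=` O].
Proof.
move=> vL O1.
pose good (W : forall i, set (L i)) (s : seq {classic I}) :=
  (forall i, ncl setT (W i) /\ finidx (W i) setT) /\
  (forall i, i \notin s -> W i = setT).
pose F := [set D : set P | exists W s, good W s /\ D = box W].
have goodT : good full [::].
  split=> // i; split; first by apply: nclT => //; exact: closedT.
  by exists [:: 1] => b _; exists 1; rewrite ?mem_head.
have [| | | | |_ [W [s [[gW Ws] ->]]] WO] := @directed_small P setT F O cP.
- by exists (box full), full, [::].
- move=> _ [W [s [[gW _] ->]]]; split=> //.
  by apply: closed_box => i; have [[]] := gW i.
- move=> _ _ [W [s [[gW Ws] ->]]] [W' [s' [[gW' Ws'] ->]]].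
  exists (box (fun i => W i `&` W' i)); last by move=> f H; split=> i; have [] := H i.
  exists (fun i => W i `&` W' i), (s ++ s'); split=> //; split.
    move=> i; have [nW fW] := gW i; have [nW' fW'] := gW' i.
    split; first exact: nclI.
    by apply: finidxI => //; [exact: ncl_sbg nW|exact: ncl_sbg nW'].
  move=> i; rewrite mem_cat negb_or => /andP[/Ws -> /Ws' ->].
  by rewrite setIT.
- move=> x Fx; apply: prod_groupP => i; apply: contrapT => xi.
  have HV j : exists V : set (L j),
      (ncl setT V /\ finidx V setT) /\ (x j <> 1 -> ~ V (x j)).
    have [x1|x1] := pselect (x j = 1).
      by exists setT; split=> //; have [] := goodT.
    have [| |V [nV fV Vx]] := @ncl_separate (L j) (@hL j) (vL j) setT [set x j]
      (sbg_T _) (@compact_factor j).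
    - by apply: closed_finite => //; exact: finite_set1.
    - by move=> /= /esym.
    by exists V; split=> // _ /Vx; apply.
  pose V j := sval (cid (HV j)).
  have VP j : (ncl setT (V j) /\ finidx (V j) setT) /\ (x j <> 1 -> ~ V j (x j)).
    exact: (svalP (cid (HV j))).
  pose W j := [set y : L j | j = i -> V j y].
  have Wi : W i = V i by apply/seteqP; split=> y; [exact|move=> Vy _].
  have Wj j : j <> i -> W j = setT by move=> ji; apply/seteqP; split=> // y _ /ji.
  have /(_ i) : box W x.
    apply: Fx; exists W, [:: i]; split=> //; split=> j.
      have [->|ji] := pselect (j = i); first by rewrite Wi; have [] := VP i.
      by rewrite Wj//; have [] := goodT.
    by rewrite inE => /eqP/Wj.
  by rewrite Wi; have [_] := VP i; apply.
- by [].
by exists W, s.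
Qed.

Lemma prod_small_complemented (J : set I) O :
  finite_set J -> (forall i, J i -> just_infinite (L i)) ->
  (forall i, ~ J i -> finite_simple (L i)) -> nbhs (1 : P) O ->
  exists B : set P, [/\ sbg B, open B, B `<=` O & complemented B].
Proof.
move=> fJ jJ sJ O1.
have vL i : small_subgroups (L i).
  have [Ji|nJi] := pselect (J i).
    have [[c h t] _ _] := jJ i Ji; apply: small_subgroups_td => //.
    exact: compact_locally_compact.
  have [fi h _] := sJ i nJi => U U1; exists [set 1]; split; first exact: sbg_1.
    apply: (finidx_open (sbg_1 _) _ _ (sbg_T _) openT) => //; first exact: closed_1.
    by apply: finite_finidx.
  by move=> _ ->; exact: nbhs_singleton U1.
have [W [s [gW Ws WO]]] := small_box vL O1.
have HC i : exists V : set (L i), J i ->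
    [/\ ncl setT V, finidx V setT, V `<=` W i & complemented V].
  have [Ji|nJi] := pselect (J i); last by exists setT.
  have [[sW cW _ _] fW] := gW i.
  have oW : open (W i) by exact: (finidx_open sW cW _ (sbg_T _) openT fW).
  have [V HV] := ji_complemented (jJ i Ji) (open_nbhs1 sW oW).
  by exists V.
pose V i := sval (cid (HC i)).
have VP i : J i -> [/\ ncl setT (V i), finidx (V i) setT, V i `<=` W i &
    complemented (V i)] by exact: (svalP (cid (HC i))).
(* On [J] the box takes complemented open subgroups. The finitely many simple factors restricted by
   [W] are dropped, the trivial group being open in them; the others stay whole, as
   [simple_prod_complemented] requires. *)
pose X i : set (L i) := if pselect (J i) then V i else
  if (i : {classic I}) \in s then [set 1] else setT.
have XJ i : J i -> X i = V i by rewrite /X; case: pselect.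
have Xs i : ~ J i -> (i : {classic I}) \in s -> X i = [set 1].
  by move=> nJi iS; rewrite /X; case: pselect => // n /=; rewrite iS.
have XT i : ~ J i -> (i : {classic I}) \notin s -> X i = setT.
  by move=> nJi /negbTE iS; rewrite /X; case: pselect => // n /=; rewrite iS.
have Xind (Q : forall i, set (L i) -> Prop) : (forall i, J i -> Q i (V i)) ->
    (forall i, ~ J i -> Q i [set 1]) -> (forall i, Q i setT) -> forall i, Q i (X i).
  move=> QV Q1 QT i; have [Ji|nJi] := pselect (J i); first by rewrite XJ//; exact: QV.
  have [iS|iS] := boolP ((i : {classic I}) \in s); first by rewrite Xs//; exact: Q1.
  by rewrite XT.
have sX : forall i, sbg (X i).
  apply: (Xind (fun i => @sbg (L i))) => i; first by move=> /VP[/ncl_sbg].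
    by move=> _; exact: sbg_1.
  exact: sbg_T.
have cX : forall i, closed (X i).
  apply: (Xind (fun i => @closed (L i))) => i; first by move=> /VP[/ncl_closed].
    by move=> _; exact: closed_1.
  exact: closedT.
have oX : forall i, open (X i).
  apply: (Xind (fun i => @open (L i))) => i; last exact: openT.
    move=> /VP[[sV cV _ _] fV _ _].
    exact: (finidx_open sV cV _ (sbg_T _) openT fV).
  move=> /sJ[fi h _].
  apply: (finidx_open (sbg_1 _) _ _ (sbg_T _) openT) => //; first exact: closed_1.
  by apply: finite_finidx.
have [t tE] := (finite_seqP (J : set {classic I})).1 fJ.
have tJ i : (i : {classic I}) \in t <-> J i.
  by rewrite -[J i]/((J : set {classic I}) i) tE.
exists (box X); split.
- exact: sbg_box.
- apply: (@open_box _ (s ++ undup t)) => // i.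
  rewrite mem_cat mem_undup negb_or => /andP[iS /negP it]; apply: XT => //.
  by move/tJ.
- apply: subset_trans WO => f Xf i; have := Xf i.
  have [Ji|nJi] := pselect (J i); first by rewrite XJ//; have [_ _ + _] := VP i Ji; apply.
  have [iS|iS] := boolP ((i : {classic I}) \in s); last by rewrite Ws.
  by rewrite Xs// => ->; exact: sbg1 (ncl_sbg (gW i).1).
- pose A := [set i | ~ J i /\ (i : {classic I}) \notin s].
  rewrite (_ : box X = box (on (A `|` [set` undup t]) X)).
    apply: box_complemented => //; first exact: undup_uniq.
    + by move=> i; rewrite mem_undup => /tJ Ji [].
    + by move=> i; rewrite mem_undup => /tJ Ji; rewrite XJ//; have [] := VP i Ji.
    + rewrite (_ : box (on A X) = box (on A full)).
        by apply: simple_prod_complemented => i [/sJ[]].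
      apply: box_eq => i; have [Ai|nAi] := pselect (A i); last by rewrite !onF.
      by rewrite !onT// XT//; case: Ai.
  apply: box_eq => i; have [Ai|nAi] := pselect ((A `|` [set` undup t]) i).
    by rewrite onT.
  rewrite onF//.
  have nJi : ~ J i by move=> /tJ it; apply: nAi; right; rewrite /= mem_undup.
  have [iS|iS] := boolP ((i : {classic I}) \in s); first by rewrite Xs.
  by case: nAi; left.
Qed.

End Product.

(** * From the product to (LD) *)

Section Converse.
Context (G : topologicalGroupType) (I : Type) (L : I -> topologicalGroupType).

Lemma property_LD_prod (J : set I) : hausdorff_space G -> locally_compact [set: G] ->
  totally_disconnected [set: G] -> finite_set J ->
  (forall i, J i -> just_infinite (L i)) ->
  (forall i, ~ J i -> finite_simple (L i)) -> profinite (prod_group L) ->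
  locally_isomorphic G (prod_group L) -> property_LD G.
Proof.
move=> hG lG tG fJ jJ sJ [cP hP _] [U [th [[/subgroupP sU oU] thM cth thI thO]]].
move=> K /subgroupP sK cK oN.
have hL i : hausdorff_space (L i).
  by have [/jJ[[]]|/sJ[]] := pselect (J i).
have N1 : normalizer K 1.
  by apply/seteqP; split=> [_ [k Kk <-]|k Kk]; [rewrite conjg1|exists k; rewrite ?conjg1].
(* [V] is chosen inside the normalizer of [K]; this is why small complemented subgroups of the
   product are needed. *)
have [V [sV oV cV VUN]] : exists V, [/\ sbg V, open V, compact V & V `<=` U `&` normalizer K].
  apply: van_dantzig => //; apply: filterI; first exact: open_nbhs1.
  exact: open_nbhs_nbhs.
have VU : V `<=` U by move=> x /VUN[].
have clV := open_closed_sbg sV oV.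
have thM' : {in V &, {morph th : x y / x * y}}.
  by move=> x y; rewrite !inE => /VU Ux /VU Uy; apply: thM; rewrite inE.
have thI' : set_inj V th.
  by move=> x y; rewrite !inE => /VU Ux /VU Uy; apply: thI; rewrite inE.
have cth' : {within V, continuous th} by exact: continuous_subspaceW cth.
have th1 : th 1 = 1.
  apply: (mulgI (th 1)); rewrite -thM ?mulg1// inE; exact: sbg1.
have O1 : nbhs (1 : prod_group L) (th @` V).
  apply: open_nbhs_nbhs; split; first exact: thO.
  by exists 1 => //; exact: sbg1.
have [B [sB oB BV coB]] := prod_small_complemented hL cP hP fJ jJ sJ O1.
have clB := open_closed_sbg sB oB.
have coVB := complemented_preimage hP sV cV clV cth' thM' thI' sB clB BV coB.
have oVB : open (V `&` th @^-1` B).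
  have cV' : {in V, continuous th} by rewrite -continuous_open_subspace.
  exact: ((continuous_inP th oV).1 cV' B oB).
have sVB : sbg (V `&` th @^-1` B).
  have thV x : V x -> th x^-1 = (th x)^-1.
    move=> Vx; apply: (mulgI (th x)); rewrite -thM' ?mulgV ?inE//; exact: sbgV.
  split; first by split; [exact: sbg1|rewrite /= th1; exact: sbg1].
    move=> x y [Vx Bx] [Vy By]; split; first exact: sbgM.
    by rewrite /= thM' ?inE//; exact: sbgM.
  by move=> x [Vx Bx]; split; [exact: sbgV|rewrite /= thV//; exact: sbgV].
apply: (complemented_LD hG sVB oVB _ coVB) => //.
  apply: subclosed_compact cV _; last by move=> x [].
  exact: open_closed_sbg.
move=> b k [/VUN[_ Nb] _] Kk; rewrite -Nb; by exists k.
Qed.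

End Converse.

(** * Virtual direct factors *)

(** What (LD) yields in a compact open group: [C] comes from the other direct factor and need not be
    normal in [R]. It meets all of [K] trivially, although only the part [K1] is known to commute
    with it. *)
Record virtual_factor (G : topologicalGroupType) (R K K1 C : set G) : Prop :=
  VirtualFactor {
    vf_ncl : ncl R K1;
    vf_sub : K1 `<=` K;
    vf_fin : finidx K1 K;
    vf_sbg : sbg C;
    vf_closed : closed C;
    vf_subC : C `<=` R;
    vf_disj : K `&` C = [set 1];
    vf_cents : cents K1 C;
    vf_finidx : finidx (K1 ** C) R }.

Definition virtually_factored (G : topologicalGroupType) (R : set G) :=
  forall K, ncl R K -> exists K1 C, virtual_factor R K K1 C.

Section VirtualFactors.
Context (G : topologicalGroupType) (hG : hausdorff_space G) (vdG : small_subgroups G).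
Implicit Types A B C D E H K M N R T U V W : set G.

Lemma sbg_normalizer K : sbg (normalizer K).
Proof.
have nE : normalizer K = [set x | conjS K x = K] by [].
rewrite nE; split => [|x y /= Kx Ky|x /= Kx]; first exact: conjS1.
  by rewrite conjSM Kx.
by rewrite -[in LHS]Kx -conjSM mulgV conjS1.
Qed.

Lemma open_setX (T T' : topologicalType) (A : set T) (B : set T') :
  open A -> open B -> open (A `*` B).
Proof.
move=> oA oB; rewrite (_ : A `*` B = fst @^-1` A `&` snd @^-1` B) //.
apply: openI; apply: open_preimage => // z; [exact: cvg_fst|exact: cvg_snd].
Qed.

Lemma norms_sub_normalizer B K : sbg B -> norms B K -> B `<=` normalizer K.
Proof. by move=> sB nK b Bb; exact: conjS_norms nK Bb. Qed.

Lemma LD_virtually_factored U : property_LD G -> sbg U -> open U -> compact U ->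
  virtually_factored U.
Proof.
move=> LD sU oU cU K nK; have [sK cK KU nUK] := nK.
have oN : open (normalizer K).
  apply: open_sbg; first exact: sbg_normalizer.
  apply: filterS (open_nbhs1 sU oU); exact: norms_sub_normalizer.
have [L [/subgroupP sL LK oL [H [/subgroupP sH oH] [M]]]] :=
  LD K ((subgroupP K).2 sK) cK oN.
move=> [_ /subgroupP sM cLM [[fLM iLM surjLM] _ opLM]].
have [V' oV' V'K] := (open_subspaceP _ _).1 oL.
have V'1 : V' 1.
  have : (L `&` K) 1 by split; exact: sbg1.
  by rewrite -V'K => -[].
have LH : L `<=` H.
  by move=> x Lx; have := fLM (x, 1); rewrite /= mulg1; apply; split=> //; exact: sbg1.
have MH : M `<=` H.
  by move=> x Mx; have := fLM (1, x); rewrite /= mul1g; apply; split=> //; exact: sbg1.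
have iLM1 x y x' y' : L x -> M y -> L x' -> M y' -> x * y = x' * y' -> x = x' /\ y = y'.
  move=> Lx My Lx' My' E.
  by have [] : (x, y) = (x', y') by apply: iLM; rewrite ?inE.
have LM1 x : L x -> M x -> x = 1.
  move=> Lx Mx.
  by have [] := @iLM1 x 1 1 x Lx (sbg1 sM) (sbg1 sL) Mx; rewrite ?mulg1 ?mul1g.
(* The complement of [M] in [H] is the image of the open set of pairs with nontrivial first
   component. *)
have cM : closed M.
  have oO : open ((L `\ 1) `*` M : set (subspace (L `*` M))).
    apply/open_subspaceP; exists (~` [set 1] `*` setT).
      apply: open_setX; last exact: openT.
      by apply: closed_openC; exact: closed_1.
    by apply/seteqP; split=> -[x y] /=; tauto.
  have /(_ _)/open_subspaceP[|W oW WH] := opLM _ _ oO.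
    by move=> -[x y] [[Lx _] My].
  have -> : M = H `&` ~` W.
    apply/seteqP; split=> [m Mm|h [Hh nW]].
      split; first exact: MH.
      move=> Wm; have : (W `&` H) m by split=> //; exact: MH.
      rewrite WH => -[[[x y] /= [[Lx x1] My] E] _]; apply: x1.
      by have [] := @iLM1 x y 1 m Lx My (sbg1 sL) Mm; rewrite ?mul1g.
    have [[x y] /= [Lx My] E] := surjLM h Hh.
    have [x1|x1] := pselect (x = 1); first by rewrite -E x1 mul1g.
    exfalso; apply: nW.
    have : (((fun z : G * G => z.1 * z.2) @` ((L `\ 1) `*` M)) `&` H) h.
      by split=> //; exists (x, y).
    by rewrite -WH => -[].
  by apply: closedI; [exact: open_closed_sbg|exact: open_closedC].
(* Inside [V] the groups [K] and [L] coincide, since [V'] cuts the relatively open [L] out of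
   [K]. *)
have [V [nV fV VO]] : exists V, [/\ ncl U V, finidx V U & V `<=` V' `&` H].
  apply: small_ncl => //; apply: filterI; last exact: open_nbhs1.
  exact: open_nbhs_nbhs.
have [sV cV VU nUV] := nV.
have oV := finidx_open sV cV VU sU oU fV.
have VKL x : V x -> K x -> L x.
  move=> /VO[V'x _] Kx; have : (V' `&` K) x by [].
  by rewrite V'K => -[].
have cKV : cents (K `&` V) (M `&` V).
  by move=> x y [Kx Vx] [My _]; apply: cLM => //; exact: VKL.
exists (K `&` V), (M `&` V); split.
- exact: nclI.
- by move=> x [].
- by rewrite setIC; exact: (finidx_sub sV sK fV).
- exact: sbgI.
- exact: closedI.
- by move=> x [_ /VU].
- apply/seteqP; split=> [x [Kx [Mx Vx]]|_ ->]; first exact: LM1 (VKL _ Vx Kx) Mx.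
  by split; [exact: sbg1|split; exact: sbg1].
- exact: cKV.
- have oO : open ((L `*` M) `&` (V `*` V) : set (subspace (L `*` M))).
    apply/open_subspaceP; exists (V `*` V); [exact: open_setX|].
    by apply/seteqP; split=> -[x y] /=; tauto.
  have /(_ _)/open_subspaceP[|W oW WH] := opLM _ _ oO; first by move=> z [].
  apply: (@nbhs_finidx _ _ _ (W `&` H)) => //.
  + apply: sbg_mul; [exact: sbgI|exact: sbgI|exact: cents_norms].
  + apply: open_nbhs_nbhs; split; first exact: openI.
    rewrite WH; split; last exact: sbg1.
    by exists (1, 1); [split; split; exact: sbg1|rewrite /= mulg1].
  + rewrite WH => z [[[[x y] /= [[Lx My] [Vx Vy]] <-] _] _].
    by exists x, y; split=> //; split=> //; exact: LK.
Qed.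

Lemma finidx_mul A A' B B' : sbg A -> sbg B -> sbg B' -> A `<=` A' -> cents A' B' ->
  finidx A A' -> finidx B B' -> finidx (A ** B) (A' ** B').
Proof.
move=> sA sB sB' AA' c fA fB.
have [s [sA' sP]] := finidx_in sA fA; have [t [tB' tP]] := finidx_in sB fB.
exists [seq x * y | x <- s, y <- t] => _ [a [b [Aa Bb ->]]].
have [x xs Ax] := sP a Aa; have [y yt By] := tP b Bb.
exists (x * y); first exact: allpairs_f.
exists (x^-1 * a), (y^-1 * b); split=> //.
have cy : commute (x^-1 * a) y^-1.
  by apply: c; [exact: AA'|apply: sbgV => //; exact: tB'].
by rewrite invgM mulgA -(mulgA y^-1) -cy !mulgA.
Qed.

(** (LD) gives factorizations in open subgroups, whereas [R] may be only a commuting factor of one.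
    [E] centralizes the subgroups of [R], so those normal in [R] are normal in [E ** R], and by the
    modular law the complement may be cut down to [R]. *)
Lemma virtual_factor_restrict E R : sbg E -> sbg R -> closed R -> cents E R ->
  virtually_factored (E ** R) -> virtually_factored R.
Proof.
move=> sE sR cR cER vER K [sK cK KR nK].
have RER : R `<=` E ** R by apply: mulS_subr; exact: sbg1.
have [|K1 [C [[sK1 cK1 K1R nK1] K1K fK1 sC cC CR KC cKC fKC]]] := vER K.
  split=> //; first exact: subset_trans RER.
  by apply: norms_mul => //; apply: cents_norms; exact: centsS cER.
have K1R' := subset_trans K1K KR.
exists K1, (C `&` R); split=> //.
- by split=> //; exact: normsS nK1.
- exact: sbgI.
- exact: closedI.
- apply/seteqP; split=> [x [Kx [Cx _]]|_ ->]; first by rewrite -KC.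
  by split; [exact: sbg1|split; exact: sbg1].
- by apply: centsS cKC => // x [].
- have sM : sbg (K1 ** C) by apply: sbg_mul => //; exact: cents_norms.
  apply: finidxS (finidx_sub sM sR fKC RER) => //.
  move=> _ [[x [c [K1x Cc ->]]] Rxc]; exists x, c; split=> //; split=> //.
  exact: sbgMl (K1R' _ K1x) Rxc.
Qed.

Lemma virtual_factor_shrink R K K1 C W : sbg R -> virtual_factor R K K1 C ->
  ncl R W -> finidx W R -> virtual_factor R K (K1 `&` W) (C `&` W).
Proof.
move=> sR [nK1 K1K fK1 sC cC CR KC cKC fKC] nW fW.
have [sW cW WR nRW] := nW; have [sK1 cK1 K1R nRK1] := nK1.
have fKW : finidx (K1 `&` W) K1 by rewrite setIC; exact: (finidx_sub sW sK1 fW).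
have fCW : finidx (C `&` W) C by rewrite setIC; exact: (finidx_sub sW sC fW).
split.
- exact: nclI.
- by move=> x [/K1K].
- exact: finidx_trans fKW fK1.
- exact: sbgI.
- exact: closedI.
- by move=> x [/CR].
- apply/seteqP; split=> [x [Kx [Cx _]]|_ ->]; first by rewrite -KC.
  by split; [exact: (K1K _ (sbg1 sK1))|split; exact: sbg1].
- by apply: centsS cKC => x [].
- apply: finidx_trans fKC; apply: finidx_mul => //; try exact: sbgI.
Qed.

Lemma virtual_factor_sbg R K K1 C : virtual_factor R K K1 C -> sbg (K1 ** C).
Proof.
move=> [nK1 _ _ sC _ _ _ c _]; apply: sbg_mul => //; first exact: ncl_sbg nK1.
exact: cents_norms.
Qed.

Lemma virtual_factor_closed R K K1 C : compact R -> virtual_factor R K K1 C ->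
  closed (K1 ** C).
Proof.
move=> cR [nK1 _ _ _ cC CR _ _ _]; apply: closed_mulS => //.
  exact: ncl_compact cR nK1.
exact: subclosed_compact cC cR CR.
Qed.

Lemma virtual_factor_core R K K1 C : compact R -> sbg R -> virtual_factor R K K1 C ->
  ncl R (core R (K1 ** C)) /\ finidx (core R (K1 ** C)) R.
Proof.
move=> cR sR vf; have sM := virtual_factor_sbg vf.
split; last by apply: finidx_core => //; exact: vf_finidx vf.
apply: ncl_core => //; first exact: virtual_factor_closed cR vf.
apply: mulS_sub => //; first exact: ncl_sub (vf_ncl vf).
exact: vf_subC vf.
Qed.

(** * Finite normal subgroups *)

Section Finite.
Variable U : set G.
Hypotheses (sU : sbg U) (cU : compact U).

Definition finr (E : set G) : set G :=
  [set x | exists T, [/\ sbg T, finite_set T, T `<=` E, norms E T & T x]].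

Lemma finite_mulS A B : finite_set A -> finite_set B -> finite_set (A ** B).
Proof.
move=> fA fB; apply: (@sub_finite_set _ _ ((fun p => p.1 * p.2) @` (A `*` B))).
  by move=> _ [a [b [? ? ->]]]; exists (a, b).
by apply: finite_image; exact: finite_setX.
Qed.

Lemma finr_mul E T T' : sbg E -> sbg T -> finite_set T -> T `<=` E -> norms E T ->
  sbg T' -> finite_set T' -> T' `<=` E -> norms E T' ->
  [/\ sbg (T ** T'), finite_set (T ** T'), T ** T' `<=` E & norms E (T ** T')].
Proof.
move=> sE sT fT TE nT sT' fT' TE' nT'; split.
- by apply: sbg_mul => //; exact: normsS nT'.
- exact: finite_mulS.
- exact: mulS_sub.
- exact: normsM.
Qed.

Lemma sbg_finr E : sbg E -> sbg (finr E).
Proof.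
move=> sE; split.
- exists [set 1]; split=> //; [exact: sbg_1|by move=> _ ->; exact: sbg1|exact: norms1].
- move=> x y [T [sT fT TE nT Tx]] [T' [sT' fT' TE' nT' T'y]].
  have [s f i n] := finr_mul sE sT fT TE nT sT' fT' TE' nT'.
  by exists (T ** T'); split=> //; exists x, y.
- by move=> x [T [sT fT TE nT Tx]]; exists T; split=> //; exact: sbgV.
Qed.

Lemma finr_seq E (s : seq G) : sbg E -> (forall x, x \in s -> finr E x) ->
  exists T, [/\ sbg T, finite_set T, T `<=` E, norms E T & forall x, x \in s -> T x].
Proof.
move=> sE; elim: s => [_|x s IH Es].
  exists [set 1]; split=> //; [exact: sbg_1|by move=> _ ->; exact: sbg1|exact: norms1].
have [|T [sT fT TE nT Ts]] := IH; first by move=> y ys; apply: Es; rewrite inE ys orbT.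
have [T' [sT' fT' TE' nT' T'x]] := Es x (mem_head _ _).
have [s1 f i n] := finr_mul sE sT fT TE nT sT' fT' TE' nT'.
exists (T ** T'); split=> // y; rewrite inE => /predU1P[->|/Ts Ty].
  by apply: (mulS_subr (sbg1 sT)).
by apply: (mulS_subl (sbg1 sT')).
Qed.

Lemma finr_sub E : finr E `<=` E.
Proof. by move=> x [T [_ _ TE _ /TE]]. Qed.

Lemma norms_finr E : norms E (finr E).
Proof. by move=> b x Eb [T [sT fT TE nT Tx]]; exists T; split=> //; exact: nT. Qed.

Lemma ncl_closure_finr E : sbg E -> closed E -> ncl E (closure (finr E)).
Proof.
move=> sE cE; split; [exact/sbg_closure/sbg_finr|exact: closed_closure| |].
  exact: closure_ind cE (@finr_sub E).
exact/norms_closure/norms_finr.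
Qed.

(* [T] is centralised by [E1], hence normal in a normal subgroup of finite index
   of [U], so it has finitely many conjugates and lies in [finr U]. *)
Lemma no_finite_normal E1 C : virtual_factor U (closure (finr U)) E1 C ->
  forall T, sbg T -> finite_set T -> T `<=` C `&` core U (E1 ** C) ->
    norms (C `&` core U (E1 ** C)) T -> T `<=` [set 1].
Proof.
move=> vf T sT fT; set W := core U _; set R := C `&` W => TR nT.
have [nW fW] := virtual_factor_core cU sU vf; rewrite -/W in nW fW.
have WEC : W `<=` E1 ** C by exact: core_sub.
case: vf => [[sE1 cE1 E1U nE1] E1E fE1 sC cC CU EC cEC fEC].
have [sW cW WU nUW] := nW.
have sR : sbg R by exact: sbgI.
have nCR : norms C R by apply: normsI; [exact: norms_self|exact: normsS nUW].
have fRC : finidx R C by rewrite /R setIC; exact: (finidx_sub sW sC fW).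
have [T1 [sT1 fT1 TT1 T1R nT1]] := finite_normal_closure sC sR nCR fRC sT fT TR nT.
have nWT1 : norms W T1.
  apply: normsS WEC _; apply: norms_mul => //; apply: cents_norms.
  by apply: centsS cEC => // x /T1R[].
have T1W : T1 `<=` W by move=> x /T1R[].
have [T2 [sT2 fT2 T12 T2W nT2]] := finite_normal_closure sU sW nUW fW sT1 fT1 T1W nWT1.
move=> x Tx; rewrite -EC; split; last by have [] := TR x Tx.
apply: subset_closure; exists T2; split=> //.
  exact: subset_trans WU.
by apply: T12; exact: TT1.
Qed.

End Finite.
End VirtualFactors.

(** * The Melnikov subgroup *)

Definition max_normal (G : topologicalGroupType) (E M : set G) :=
  [/\ ncl E M, finidx M E, ~ (E `<=` M) &
    forall N, ncl E N -> M `<=` N -> N `<=` M \/ E `<=` N].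

Definition melnikov (G : topologicalGroupType) (E : set G) : set G :=
  E `&` \bigcap_(M in max_normal E) M.

Section Melnikov.
Context (G : topologicalGroupType) (hG : hausdorff_space G) (vdG : small_subgroups G).
Implicit Types A B C D E F H K M N R T U V W X Y : set G.

(* Maximise the number of representatives of the cosets of [N] lying in [M]. *)
Lemma finidx_maximal B N (Q : set (set G)) : sbg N -> finidx N B -> Q !=set0 ->
  (forall M, Q M -> [/\ sbg M, N `<=` M & M `<=` B]) ->
  exists2 M, Q M & forall M', Q M' -> M `<=` M' -> M' `<=` M.
Proof.
move=> sN [s sP] [M0 QM0] QP.
pose c M := count (fun x => `[< M x >]) s.
have exc : exists n, `[< exists2 M, Q M & c M = n >].
  by exists (c M0); apply/asboolP; exists M0.
have bc n : `[< exists2 M, Q M & c M = n >] -> (n <= size s)%N.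
  by move=> /asboolP[M _ <-]; exact: count_size.
have [n /asboolP[M QM cM] maxn] := ex_maxnP exc bc.
exists M => // M' QM' MM' x M'x; apply: contrapT => nMx.
have [sM' NM' M'B] := QP M' QM'; have [sM NM _] := QP M QM.
have [r rs Nr] := sP x (M'B x M'x).
have M'r : M' r.
  rewrite -(invgK r); apply: sbgV => //; apply: (sbgMr sM' M'x); exact: NM'.
have nMr : ~ M r.
  by move=> Mr; apply: nMx; rewrite -(mulVKg r x); apply: sbgM => //; exact: NM.
have : (c M < c M')%N.
  rewrite /c; elim: s rs {sP c exc bc cM maxn} => //= y s IH; rewrite inE => /predU1P[<-|/IH lt].
    have -> : `[< M r >] = false by apply/asboolP.
    have -> : `[< M' r >] = true by apply/asboolP.
    rewrite add0n add1n ltnS; apply: sub_count => z /asboolP Mz.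
    by apply/asboolP; exact: MM'.
  rewrite -addnS; apply: leq_add => //.
  have [My|] := asboolP (M y) => //=.
  by have -> : `[< M' y >] = true by apply/asboolP; exact: MM'.
by rewrite cM ltnNge maxn//; apply/asboolP; exists M'.
Qed.

Lemma ex_max_normal E N : ncl E N -> finidx N E -> ~ (E `<=` N) ->
  exists2 M, max_normal E M & N `<=` M.
Proof.
move=> nN fN EN.
pose Q := [set M | [/\ ncl E M, N `<=` M & ~ (E `<=` M)]].
have [|M [nM NM EM]|M [nM NM EM] maxM] := @finidx_maximal E N Q (ncl_sbg nN) fN.
- by exists N; split.
- by split=> //; [exact: ncl_sbg nM|exact: ncl_sub nM].
exists M => //; split=> //; first by apply: finidxS fN.
move=> N' nN' MN'; have [|EN'] := pselect (E `<=` N'); [by right|left].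
by apply: maxM => //; split=> //; exact: subset_trans MN'.
Qed.

Lemma ncl_melnikov E : sbg E -> closed E -> ncl E (melnikov E).
Proof.
move=> sE cE; split.
- by apply: sbgI => //; apply: sbg_bigcap => M [/ncl_sbg].
- by apply: closedI => //; apply: closed_bigI => M [/ncl_closed].
- by move=> x [].
- apply: normsI; first exact: norms_self.
  by apply: norms_bigcap => M [/ncl_norms].
Qed.

Lemma max_normal_conj U E M u : sbg U -> norms U E -> E `<=` U -> U u ->
  max_normal E M -> max_normal E (conjS M u).
Proof.
move=> sU nUE EU Uu [[sM cM ME nM] fM EM maxM].
have cE v : U v -> conjS E v = E by exact: conjS_norms.
have nJ N v : U v -> ncl E N -> ncl E (conjS N v).
  move=> Uv [sN cN NE nN]; split.
  - exact: sbg_conjS.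
  - by rewrite conjSE; exact: closed_conj.
  - by rewrite -(cE v Uv); exact: conjSS.
  - exact: norms_conjS sU nUE nN Uv.
have sJ A B v : conjS A v `<=` B -> A `<=` conjS B v^-1.
  by move=> /(@conjSS _ _ _ v^-1); rewrite -conjSM mulgV conjS1.
have Uu' := sbgV sU Uu.
split.
- by apply: nJ.
- rewrite -(cE u Uu) !conjSE; exact: finidxJ.
- move=> H; apply: EM; rewrite -(cE _ Uu') -(conjS1 M) -(mulgV u) conjSM.
  exact: conjSS.
- move=> N nN MN; have [H|H] := maxM (conjS N u^-1) (nJ _ _ Uu' nN) (sJ _ _ _ MN).
    by left; have := sJ _ _ _ H; rewrite invgK.
  right; rewrite -(cE u Uu); have := @conjSS _ _ _ u H.
  by rewrite -conjSM mulVg conjS1.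
Qed.

Lemma norms_melnikov U E : sbg U -> norms U E -> E `<=` U -> norms U (melnikov E).
Proof.
move=> sU nE EU u x Uu [Ex Mx]; split; first exact: nE.
move=> M mM; have Uu' := sbgV sU Uu.
have := Mx _ (max_normal_conj sU nE EU Uu' mM).
by rewrite conjSE /= invgK.
Qed.

(* If [Y1] were infinite, it would have a maximal open normal subgroup [X]
   containing the projection [P] of [F `&` (Y1 ** C)], where [F] is a finite
   normal subgroup with [E = F ** (Y1 ** C)]; then [F ** (X ** C)] is maximal in
   [E] without containing [Y1]. *)
Lemma finite_melnikov_factor E Y1 C : sbg E -> compact E ->
  E `<=` closure (finr E) -> ncl E Y1 -> Y1 `<=` melnikov E -> sbg C -> closed C ->
  C `<=` E -> Y1 `&` C = [set 1] -> cents Y1 C -> finidx (Y1 ** C) E ->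
  finite_set Y1.
Proof.
move=> sE cE dE nY Ymel sC cC CE YC cYC fYC.
have [sY cY YE nEY] := nY.
have sH : sbg (Y1 ** C) by apply: sbg_mul => //; exact: cents_norms.
have cpY : compact Y1 by exact: ncl_compact cE nY.
have cpC : compact C by exact: subclosed_compact cC cE CE.
have cH : closed (Y1 ** C) by exact: closed_mulS.
have HE : Y1 ** C `<=` E by exact: mulS_sub.
(* The dense [finr E] meets every coset of the relatively open [Y1 ** C]; one finite normal subgroup
   contains the finitely many representatives so obtained. *)
have [F [sF fF FE nF FH]] : exists F, [/\ sbg F, finite_set F, F `<=` E, norms E F &
    E `<=` F ** (Y1 ** C)].
  have [O O1 OH] := finidx_nbhs sH cH fYC.
  have [s [sE' sP]] := finidx_in sH fYC.
  have key x : E x -> exists2 f, finr E f & (Y1 ** C) (x^-1 * f).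
    move=> Ex; have Ox : nbhs x [set z | O (x^-1 * z)].
      by apply: (@continuous_mulgl G x^-1 x); rewrite mulVg.
    have [f [ff Of]] := dE x Ex _ Ox; exists f => //; apply: OH; split=> //.
    by apply: sbgM => //; [exact: sbgV|exact: finr_sub ff].
  pose ch x := xget 1 [set f | finr E f /\ (Y1 ** C) (x^-1 * f)].
  have chP x : E x -> finr E (ch x) /\ (Y1 ** C) (x^-1 * ch x).
    move=> /key[f ff Hf]; rewrite /ch; case: xgetP => [z _ //|/(_ f)].
    by case; split.
  have [|F [sF fF FE nF Fs]] := @finr_seq G E [seq ch x | x <- s] sE.
    by move=> _ /mapP[x xs ->]; have [] := chP x (sE' x xs).
  exists F; split=> // e Ee; have [x xs Hx] := sP e Ee.
  have [_ Hc] := chP x (sE' x xs).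
  exists (ch x), ((ch x)^-1 * e); split; [by apply: Fs; exact: map_f| |by rewrite mulVKg].
  have -> : (ch x)^-1 * e = (x^-1 * ch x)^-1 * (x^-1 * e).
    by rewrite invgM invgK -mulgA mulVKg.
  by apply: sbgM => //; exact: sbgV.
have uniq y y' c c' : Y1 y -> Y1 y' -> C c -> C c' -> y * c = y' * c' -> y = y'.
  move=> Yy Yy' Cc Cc' E1; have E2 : y'^-1 * y = c' * c^-1.
    by rewrite -[y](mulgK c) E1 mulgA mulKg.
  have : (Y1 `&` C) (y'^-1 * y).
    split; first by apply: sbgM => //; exact: sbgV.
    by rewrite E2; apply: sbgM => //; exact: sbgV.
  by rewrite YC => /= E3; rewrite -(mulVKg y' y) E3 mulg1.
pose P := [set y | Y1 y /\ exists2 c, C c & F (y * c)].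
have sP : sbg P.
  split; first by split; [exact: sbg1|exists 1; rewrite ?mulg1; exact: sbg1].
    move=> y y' [Yy [c Cc Fc]] [Yy' [c' Cc' Fc']]; split; first exact: sbgM.
    exists (c * c'); first exact: sbgM.
    have -> : y * y' * (c * c') = (y * c) * (y' * c').
      by rewrite -!mulgA (mulgA y' c) (cYC _ _ Yy' Cc) -!mulgA.
    exact: sbgM.
  move=> y [Yy [c Cc Fc]]; split; first exact: sbgV.
  exists c^-1; first exact: sbgV.
  by rewrite -invgM -(cYC _ _ Yy Cc); exact: sbgV.
have fP : finite_set P.
  apply: (@sub_finite_set _ _
    ((fun f => xget 1 [set y | Y1 y /\ exists2 c, C c & f = y * c]) @` F)).
    move=> y [Yy [c Cc Fc]]; exists (y * c) => //.
    case: xgetP => [z _ [Yz [c' Cc' E1]]|/(_ y)]; first exact: (uniq _ _ c' c).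
    by case; split=> //; exists c.
  exact: finite_image.
have PY : P `<=` Y1 by move=> y [].
have nP : norms Y1 P.
  move=> y' y Yy' [Yy [c Cc Fc]]; split; first exact: sbgJ.
  exists c => //; have <- : (y * c) ^ y' = y ^ y' * c.
    rewrite conjMg; congr (_ * _); apply/commuteJ/commute_sym; exact: cYC.
  by apply: nF => //; exact: YE.
apply: contrapT => infY.
have [y Yy nPy] : exists2 y, Y1 y & ~ P y.
  apply: contrapT => H; apply: infY; apply: sub_finite_set fP => y Yy.
  by apply: contrapT => nPy; apply: H; exists y.
(* [V] is so small that [y] stays outside [P ** V], which is therefore a proper normal subgroup of
   finite index. *)
have [| |V [nV fV VP]] := @ncl_separate G hG vdG Y1 [set p^-1 * y | p in P] sY cpY.
- by apply: closed_finite => //; exact: finite_image.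
- by move=> [p Pp /mulg1_eq]; rewrite invgK => py; apply: nPy; rewrite -py.
have [sV cV VY nYV] := nV.
have nPn : ncl Y1 P by split=> //; exact: closed_finite.
have nPV : ncl Y1 (P ** V) by exact: ncl_mul.
have [|X [nX fX XY maxX] PVX] := 
  ex_max_normal nPV (finidxS (mulS_subr (sbg1 sP)) (@subset_refl _ _) fV).
  by move=> /(_ y Yy) [p [v [Pp Vv E1]]]; apply: (VP v Vv); exists p => //; rewrite E1 mulKg.
have PX : P `<=` X by apply: subset_trans PVX; apply: mulS_subl; exact: sbg1.
have [sX cX XsY nYX] := nX.
pose Q := F ** (X ** C).
have cXC : cents X C by exact: centsS cYC.
have sXC : sbg (X ** C) by apply: sbg_mul => //; exact: cents_norms.
have XCH : X ** C `<=` Y1 ** C by exact: mulSS.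
have XCE : X ** C `<=` E by exact: subset_trans HE.
have sQ : sbg Q.
  by apply: sbg_mulC => //; exact: normsS nF.
have cpXC : compact (X ** C) by apply: compact_mulS => //; exact: subclosed_compact cX cpY XsY.
have QE : Q `<=` E by exact: mulS_sub.
have FQ : F `<=` Q by apply: mulS_subl; exact: sbg1.
have XCQ : X ** C `<=` Q by apply: mulS_subr; exact: sbg1.
have XQ : X `<=` Q by apply: subset_trans XCQ; apply: mulS_subl; exact: sbg1.
have CQ : C `<=` Q by apply: subset_trans XCQ; apply: mulS_subr; exact: sbg1.
have nHXC : norms (Y1 ** C) (X ** C).
  apply: norms_mul; apply: normsM => //.
  - exact: cents_norms.
  - by apply: cents_norms; exact: centsC.
  - exact: norms_self.
have nQ : norms E Q.
  apply: normsS FH _; apply: norms_mul.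
    by apply: normsS FQ _; exact: norms_self.
  by apply: normsM => //; exact: normsS nF.
have nclQ : ncl E Q.
  split=> //; apply: closed_mulS => //; exact: finite_compact.
have fQ : finidx Q E.
  apply: finidxS (finidx_trans (finidx_mul sX sC sC XsY cYC fX _) fYC) => //.
  by apply: finidx_refl => //; exact: sbg1.
(* If [x] in [Y1] equals [f * (x' * c)], then [x * x'^-1] is the [Y1]-component of [f], so it lies
   in [P] and hence in [X]. *)
have QY x : Q x -> Y1 x -> X x.
  move=> [f [_ [Ff [x' [c [Xx' Cc ->]]] E1]]] Yx.
  have Yx' : Y1 x' by exact: XsY.
  have fE : f = (x * x'^-1) * c^-1.
    rewrite E1 -!mulgA; apply: (mulgI f^-1); rewrite mulVg mulKg.
    by rewrite (mulgA c) -(cYC _ _ (sbgV sY Yx') Cc) -!mulgA mulgV mulg1 mulgV.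
  have : P (x * x'^-1).
    split; first by apply: sbgM => //; exact: sbgV.
    by exists c^-1; [exact: sbgV|rewrite -fE].
  by move=> /PX; apply: sbgMr => //; exact: sbgV.
have maxQ : max_normal E Q.
  split=> //; first by move=> H; apply: XY => z Yz; apply: QY => //; exact/H/YE.
  move=> N nN QN; have [sN cN NE nEN] := nN.
  have CN := subset_trans CQ QN; have FN := subset_trans FQ QN.
  have nNY : ncl Y1 (N `&` Y1) by exact: nclIr nN sY cY YE.
  have [|H|H] := maxX (N `&` Y1) nNY.
  - by move=> z Xz; split; [exact/QN/XQ|exact: XsY].
  - left=> n Nn; have [f [_ [Ff [y' [c [Yy' Cc ->]]] nE]]] := FH n (NE n Nn).
    have Nyc : N (y' * c) by apply: (sbgMl sN (FN f Ff)); rewrite -nE.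
    have Xy' : X y' by apply: H; split=> //; exact: sbgMr sN (CN c Cc) Nyc.
    by exists f, (y' * c); split=> //; exists y', c.
  - right=> e /FH[f [_ [Ff [y' [c [Yy' Cc ->]]] ->]]].
    apply: sbgM => //; first exact: FN.
    by apply: sbgM => //; [have [] := H y' Yy'|exact: CN].
apply: XY => z Yz; apply: QY => //.
by have [_] := Ymel z Yz; apply.
Qed.

(** If [M] is maximal in [E] and does not contain [D], then [E] is [M ** D], and the trace of [M] on
    [D] is maximal in [D], as in the second isomorphism theorem. *)
Lemma melnikov_sub E D : sbg E -> compact E -> ncl E D -> sbg D ->
  melnikov D `<=` melnikov E.
Proof.
move=> sE cE [_ cD DE nD] sD x [Dx Mx]; split; first exact: DE.
move=> M [nM fM EM maxM]; have [sM cM ME nEM] := nM.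
have [DM|DM] := pselect (D `<=` M); first exact: DM.
suff : (M `&` D) x by case.
have cpD : compact D by exact: subclosed_compact cD cE DE.
apply: Mx; split.
- exact: (nclIr nM sD cD DE).
- exact: (finidx_sub sM sD fM DE).
- by move=> H; apply: DM => z /H[].
move=> N [sN cN ND nDN] MDN.
have MD : E `<=` M ** D.
  have [| |H|//] := maxM (M ** D).
  - by apply: ncl_mul.
  - by apply: mulS_subl; exact: sbg1.
  - exfalso; apply: DM; apply: subset_trans H; apply: mulS_subr; exact: sbg1.
(* Commutators of [M] with [D] lie in both groups, hence in [N]; so [M] normalizes [N], which was
   only assumed normal in [D]. *)
have nMN : norms M N.
  move=> m n Mm Nn; have -> : n ^ m = n * [~ n, m] by rewrite commgEl mulVKg.
  apply: sbgM => //; apply: MDN; split.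
    rewrite commgEr; apply: sbgM => //; apply: nEM; [exact/DE/ND|exact: sbgV].
  rewrite commgEl; apply: (sbgM sD); first by apply: (sbgV sD); exact: ND.
  by apply: nD; [exact: ME|exact: ND].
have sMN : sbg (M ** N) by exact: sbg_mul.
have nMNc : ncl E (M ** N).
  split=> //.
  - by apply: closed_mulS => //; [exact: ncl_compact cE nM|exact: subclosed_compact cN cpD ND].
  - by apply: mulS_sub => //; exact: subset_trans DE.
  - apply: normsS MD _; apply: norms_mul.
      by apply: normsS (norms_self sMN); apply: mulS_subl; exact: sbg1.
    by apply: normsM => //; exact: normsS nEM.
have [|H|H] := maxM (M ** N) nMNc; first by apply: mulS_subl; exact: sbg1.
  left=> n Nn; split; last exact: ND.
  by apply: H; apply: mulS_subr => //; exact: sbg1.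
right=> d Dd; have [m [n [Mm Nn dE]]] := H d (DE d Dd).
rewrite dE; apply: sbgM => //; apply: MDN; split=> //.
by apply: (sbgMr sD (ND n Nn)); rewrite -dE.
Qed.

End Melnikov.

(** * Independent families of maximal normal subgroups *)

Section MelnikovFamily.
Context (G : topologicalGroupType) (hG : hausdorff_space G).
Context (E : set G) (sE : sbg E) (cE : compact E).
Implicit Types (A M N : set G) (s : seq (set G)) (F : set (set G)).

Definition seqcap s : set G := foldr setI E s.

Lemma seqcap_ncl s : (forall M, List.In M s -> ncl E M) -> ncl E (seqcap s).
Proof.
elim: s => [_|M s IH Hs] /=; first by apply: nclT => //; exact: compact_closed.
apply: nclI; first by apply: Hs; left.
by apply: IH => N Ns; apply: Hs; right.
Qed.

Lemma seqcap_mem s M : List.In M s -> seqcap s `<=` M.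
Proof.
elim: s => //= N s IH [->|Ms] x [Nx xs] //.
exact: IH xs.
Qed.

Lemma seqcapP s x : E x -> (forall M, List.In M s -> M x) -> seqcap s x.
Proof.
move=> Ex; elim: s => //= M s IH H; split; first by apply: H; left.
by apply: IH => N Ns; apply: H; right.
Qed.

(** The second clause amounts to [E] mapping onto the product of its quotients for every finite part
    of [F]. Only finite lists enter, so unions of chains inherit it. *)
Definition independent F :=
  F `<=` max_normal E /\
  forall M s, F M -> (forall N, List.In N s -> F N /\ N <> M) ->
    E `<=` M ** seqcap s.

Lemma independent_bigcup (T : set (set (set G))) :
  T `<=` independent -> total_on T subset -> independent (\bigcup_(F in T) F).
Proof.
move=> Tind tot; split; first by move=> M [F /Tind[Fm _] /Fm].
move=> M s [F0 TF0 F0M] Hs.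
have [F [TF FM Fs]] : exists F, [/\ T F, F M & forall N, List.In N s -> F N].
  elim: s Hs => [|N s IH] Hs; first by exists F0.
  have [|F [TF FM Fs]] := IH; first by move=> N' N's; apply: Hs; right.
  have [[F' TF' F'N] _] := Hs N (or_introl erefl).
  have [FF'|F'F] := tot F F' TF TF'.
    by exists F'; split=> //; [exact: FF'|move=> N' [<-//|/Fs/FF']].
  by exists F; split=> // N' [<-|/Fs //]; exact: F'F.
have [_ indF] := Tind F TF; apply: indF => // N Ns; split; first exact: Fs.
by have [] := Hs N Ns.
Qed.

Lemma max_normal_mul M A x : max_normal E M -> ncl E A -> A x -> ~ M x ->
  E `<=` M ** A.
Proof.
move=> [nM fM EM maxM] nA Ax nMx.
have [| |H|//] := maxM (M ** A); first exact: ncl_mul.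
  by apply: mulS_subl; exact: sbg1 (ncl_sbg nA).
by exfalso; apply/nMx/H/mulS_subr => //; exact: sbg1 (ncl_sbg nM).
Qed.

(* If a nontrivial [x] lay in all members of a maximal independent family, a
   maximal normal subgroup missing [x] could be added to the family. *)
Lemma ex_independent : melnikov E `<=` [set 1] ->
  exists F, independent F /\ forall x, E x -> (forall M, F M -> M x) -> x = 1.
Proof.
move=> mel1; have [F [[Fm indF] maxF]] := Zorn_bigcup independent_bigcup.
exists F; split=> // x Ex Fx; apply: contrapT => x1.
have [M0 mM0 nM0x] : exists2 M, max_normal E M & ~ M x.
  apply: contrapT => H; apply: x1; apply: mel1; split=> // M mM.
  by apply: contrapT => nMx; apply: H; exists M.
have nFM0 : ~ F M0 by move=> /Fx.
apply: (maxF (F `|` [set M0])).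
  by split=> [M FM|]; [left|move=> /(_ M0 (or_intror erefl))].
split; first by move=> M [/Fm|->].
have nclF s : (forall N, List.In N s -> F N) -> ncl E (seqcap s).
  by move=> Fs; apply: seqcap_ncl => N /Fs/Fm[].
move=> M s FM Hs.
have [E0|MM0] := pselect (M = M0).
  have Fs N : List.In N s -> F N.
    by move=> /Hs[[//|/= NM0] NM]; case: NM; rewrite NM0 E0.
  rewrite E0; apply: (@max_normal_mul _ _ x) => //; first exact: nclF.
  by apply: seqcapP => // N /Fs; exact: Fx.
have {}FM : F M by case: FM.
have [s' [s'F s's]] : exists s', (forall N, List.In N s' -> F N /\ N <> M) /\
    M0 `&` seqcap s' `<=` seqcap s.
  elim: s Hs => [|N s IH] Hs /=; first by exists [::]; split=> // y [].
  have [|s' [s'F s's]] := IH; first by move=> N' N's; apply: Hs; right.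
  have [[FN|/= ->] NM] := Hs N (or_introl erefl).
    exists (N :: s'); split=> [N' [<-//|/s'F//]|y [M0y [Ny s'y]]].
    by split=> //; exact: s's.
  by exists s'; split=> // y [M0y s'y]; split=> //; exact: s's.
have [[sM _ ME nEM] _ _ _] := Fm M FM.
have [[sM0 _ M0E nEM0] _ _ _] := mM0.
have ncl1 : ncl E (seqcap (M :: s')).
  by apply: nclF => N [<-//|/s'F[]].
have E1 : E `<=` M ** seqcap s' by exact: indF.
have E2 : E `<=` M0 ** seqcap (M :: s').
  apply: (@max_normal_mul _ _ x) => //.
  by apply: seqcapP => // N [<-|/s'F[FN _]]; exact: Fx.
(* With [e = m * b] and [b = m0 * c], the element [m0] lies in [M0] and, like [b] and [c], in
   [seqcap s'], while [c] lies in [M] and is moved past [m0] by conjugation. *)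
move=> e /E1[m [b [Mm Bb ->]]].
have sB : sbg (seqcap s') by apply: ncl_sbg; apply: nclF => N /s'F[].
have Eb : E b by apply: (ncl_sub (nclF s' _)) Bb => N /s'F[].
have [m0 [c [M0m0 /= [Mc Bc] bE]]] := E2 b Eb.
exists (m * c ^ m0^-1), m0; split.
- apply: sbgM => //; apply: nEM => //; apply: (sbgV sE); exact: M0E.
- apply: s's; split=> //.
  by rewrite bE in Bb; exact: sbgMr sB Bc Bb.
- by rewrite bE (conjgCV m0 c) mulgA.
Qed.

(** Chinese remainder theorem: correcting [x] by an element of [seqcap s] preserves the congruences
    already achieved. *)
Lemma independent_seq F (y : set G -> G) s : independent F ->
  (forall M, F M -> E (y M)) -> (forall M, List.In M s -> F M) ->
  exists2 x, E x & forall M, List.In M s -> M (x^-1 * y M).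
Proof.
move=> [Fm indF] Ey; elim: s => [_|M s IH Fs]; first by exists 1; [exact: sbg1|].
have [|x Ex xs] := IH; first by move=> N Ns; apply: Fs; right.
have [Ms|nMs] := pselect (List.In M s).
  by exists x => // N [<-|]; exact: xs.
have FM : F M by apply: Fs; left.
have [[sM _ ME nEM] _ _ _] := Fm M FM.
have sub : E `<=` M ** seqcap s.
  apply: indF => // N Ns; split; first by apply: Fs; right.
  by move=> NM; apply: nMs; rewrite -NM.
have sB : ncl E (seqcap s) by apply: seqcap_ncl => N Ns; have [] := Fm N (Fs N (or_intror Ns)).
have [|m [a [Mm Ba yE]]] := sub (x^-1 * y M).
  by apply: sbgM; [exact: sE|exact: sbgV|exact: Ey].
have Ea := ncl_sub sB Ba.
exists (x * a); first exact: sbgM.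
move=> N [<-|Ns].
  rewrite invgM -mulgA yE -conjgE.
  exact: nEM.
rewrite invgM -mulgA; have [[sN _ _ _] _ _ _] := Fm N (Fs N (or_intror Ns)).
by apply: (sbgM sN); [apply: (sbgV sN); exact: seqcap_mem Ns _ Ba|exact: xs].
Qed.

(** Compactness passes from finitely many congruences to all of them. *)
Lemma independent_surjective F (y : set G -> G) : independent F ->
  (forall M, F M -> E (y M)) -> exists2 x, E x & forall M, F M -> M (x^-1 * y M).
Proof.
move=> indF Ey; have [Fm _] := indF.
pose D s := [set x | E x /\ forall M, List.In M s -> M (x^-1 * y M)].
have [| | | |x Ex Dx] := @compact_directed G E
  [set D s | s in [set s | forall M, List.In M s -> F M]] cE.
- by exists (D [::]), [::].
- move=> _ [s Fs <-].
  rewrite (_ : D s = E `&` \bigcap_(M in [set M | List.In M s])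
      (fun x => x^-1 * y M) @^-1` M).
    apply: closedI; first exact: compact_closed.
    apply: closed_bigI => M /Fs/Fm[nM _ _ _].
    apply: closed_preimage (ncl_closed nM).
    apply: continuous_mulg; last exact: cst_continuous.
    exact: continuous_invg (@continuous_id _).
  by apply/seteqP; split.
- move=> _ _ [s Fs <-] [s' Fs' <-]; exists (D (s ++ s')).
    by exists (s ++ s') => // M MS; case: (List.in_app_or _ _ _ MS) => [/Fs|/Fs'].
  move=> x [Ex H]; split; split=> // M Ms; apply: H; apply: List.in_or_app; [left|right] => //.
- move=> _ [s Fs <-]; have [x Ex xs] := independent_seq indF Ey Fs.
  by exists x.
exists x => // M FM.
have [_ H] : D [:: M] x by apply: Dx; exists [:: M] => // N [<-|[]].
by apply: H; left.
Qed.

End MelnikovFamily.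

(** * Groups without finite normal subgroups *)

Section NoFiniteNormal.
Context (G : topologicalGroupType) (hG : hausdorff_space G) (vdG : small_subgroups G).
Context (R : set G) (sR : sbg R) (cR : compact R) (vR : virtually_factored R).
Context (nfR : forall T : set G, sbg T -> finite_set T -> T `<=` R -> norms R T ->
  T `<=` [set 1]).
Implicit Types A B C D E F H K M N T U V W X Y : set G.

Let clR : closed R := compact_closed hG cR.

Lemma locally_finite1 T W : ncl R W -> finidx W R -> sbg T -> finite_set T ->
  T `<=` W -> norms W T -> T `<=` [set 1].
Proof.
move=> [sW cW WR nW] fW sT fT TW nT.
have [T' [sT' fT' TT' T'W nT']] := finite_normal_closure sR sW nW fW sT fT TW nT.
by apply: subset_trans TT' _; apply: nfR => //; exact: subset_trans WR.
Qed.

Lemma ncl_infinite N : ncl R N -> ~ (N `<=` [set 1]) -> ~ finite_set N.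
Proof. by move=> [sN cN NR nN] N1 fN; apply: N1; exact: nfR. Qed.

Lemma ncl_finidx1 N N' : ncl R N -> ~ (N `<=` [set 1]) -> finidx N' N ->
  ~ (N' `<=` [set 1]).
Proof.
move=> nN N1 fN' N'1; apply: (ncl_infinite nN N1).
by apply: finidx_finite fN' _; apply: sub_finite_set N'1 _; exact: finite_set1.
Qed.

Lemma neq1P N : ~ (N `<=` [set 1]) -> exists2 x, N x & x <> 1.
Proof.
move=> N1; apply: contrapT => H; apply: N1 => x Nx.
by apply: contrapT => x1; apply: H; exists x.
Qed.

Lemma disj1 N N' x : N `&` N' = [set 1] -> N x -> N' x -> x = 1.
Proof. by move=> NN' Nx N'x; have : (N `&` N') x by []; rewrite NN'. Qed.

Lemma sbg_disj N N' : sbg N -> sbg N' -> (forall x, N x -> N' x -> x = 1) ->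
  N `&` N' = [set 1].
Proof.
move=> sN sN' H; apply/seteqP; split=> [x [Nx N'x]|_ ->]; first exact: H.
by split; exact: sbg1.
Qed.

(* With [D' n] a proper subgroup of finite index in [D n], the intersection [T]
   of the groups [D' 0 ** .. ** D' n ** K n.+1] meets [D n] in [D' n].  If [C] is
   a virtual complement of [T], then [C `&` (D n ** T)] is finite, normal up to
   finite index, and nontrivial for large [n]. *)
Lemma no_independent_sequence (D K : nat -> set G) :
  (forall n, ncl R (D n)) -> (forall n, ~ (D n `<=` [set 1])) ->
  (forall n, ncl R (K n)) -> (forall n, D n `<=` K n) ->
  (forall n, K n.+1 `<=` K n) -> (forall n, D n `&` K n.+1 = [set 1]) -> False.
Proof.
move=> nD D1 nK DK KS DK1.
have /choice [x xP] : forall n, exists x, D n x /\ x <> 1.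
  by move=> n; have [x Dx x1] := neq1P (D1 n); exists x.
have /choice [V VP] : forall n, exists V, [/\ ncl R V, finidx V R & ~ V (x n)].
  move=> n; have [| |V [nV fV Vx]] := @ncl_separate G hG vdG R [set x n] sR cR.
  - by apply: closed_finite => //; exact: finite_set1.
  - by move=> /= /esym; have [] := xP n.
  by exists V; split=> // /Vx; apply.
pose D' n := D n `&` V n.
have nD' n : ncl R (D' n) by apply: nclI => //; have [] := VP n.
have fD' n : finidx (D' n) (D n).
  rewrite /D' setIC; have [nV fV _] := VP n.
  exact: (finidx_sub (ncl_sbg nV) (ncl_sbg (nD n)) fV (ncl_sub (nD n))).
pose P := fix P n := if n is m.+1 then P m ** D' m else [set 1].
have nP n : ncl R (P n).
  by elim: n => [|n IH] /=; [exact: ncl1|exact: ncl_mul].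
pose S n := P n ** K n.
have nS n : ncl R (S n) by exact: ncl_mul.
have SS n : S n.+1 `<=` S n.
  move=> _ [_ [k [[p [d [Pp [Dd _] ->]]] Kk ->]]]; exists p, (d * k); split=> //.
    by apply: (sbgM (ncl_sbg (nK n))); [exact: DK|exact: KS].
  by rewrite mulgA.
have Smono m n : (m <= n)%N -> S n `<=` S m.
  by move=> /subnK <-; elim: (n - m)%N => // k IH; apply: subset_trans (SS _) IH.
have Kmono m n : (m <= n)%N -> K n `<=` K m.
  by move=> /subnK <-; elim: (n - m)%N => // k IH; apply: subset_trans (KS _) IH.
have Pmono m n : (m <= n)%N -> P m `<=` P n.
  move=> /subnK <-; elim: (n - m)%N => // k IH; apply: subset_trans IH _.
  by rewrite addSn /=; apply: mulS_subl; exact: sbg1 (ncl_sbg (nD' _)).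
have PK n y : P n y -> K n y -> y = 1.
  elim: n y => [//|n IH] y /= [p [d [Pp [Dd _] yE]]] Ky.
  have p1 : p = 1.
    apply: IH => //; apply: (sbgMr (ncl_sbg (nK n)) (DK n d Dd)).
    by rewrite -yE; exact: KS.
  by apply: disj1 (DK1 n) _ Ky; rewrite yE p1 mul1g.
pose T := \bigcap_(n in [set: nat]) S n.
have nT : ncl R T.
  split.
  - by apply: sbg_bigcap => n _; exact: ncl_sbg (nS n).
  - by apply: closed_bigI => n _; exact: ncl_closed (nS n).
  - by move=> y Ty; exact: (ncl_sub (nS 0%N) (Ty 0%N Logic.I)).
  - by apply: norms_bigcap => n _; exact: ncl_norms (nS n).
(* At stage [n.+1] the element [d] is [p * d' * k], and independence makes [p] and [k] trivial. *)
have DT n : D n `&` T `<=` D' n.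
  move=> d [Dd /(_ n.+1 Logic.I) [_ [k [[p [d' [Pp D'd' ->]]] Kk dE]]]].
  have p1 : p = 1.
    apply: PK Pp _; apply: (sbgMr (ncl_sbg (nK n)) (y := d' * k)).
      by apply: (sbgM (ncl_sbg (nK n))); [apply: DK; case: D'd'|exact: KS].
    by rewrite mulgA -dE; exact: DK.
  have k1 : k = 1.
    apply: disj1 (DK1 n) _ Kk; apply: (sbgMl (ncl_sbg (nD n)) (x := d')).
      by case: D'd'.
    by rewrite -[d']mul1g -p1 -dE.
  by rewrite dE p1 k1 mul1g mulg1.
have D'T n : D' n `<=` T.
  move=> d Dd m _; have [mn|nm] := leqP m n.
    apply: (mulS_subr (sbg1 (ncl_sbg (nP m)))); apply: (Kmono _ _ mn).
    by apply: DK; case: Dd.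
  apply: (mulS_subl (sbg1 (ncl_sbg (nK m)))); apply: (Pmono _ _ nm).
  by apply: (mulS_subr (sbg1 (ncl_sbg (nP n)))).
have [T0 [C0 vf0]] := vR nT.
have [nW fW] := virtual_factor_core hG cR sR vf0.
set W := core R _ in nW fW.
have WTC : W `<=` T0 ** C0 by exact: core_sub.
have vf := virtual_factor_shrink sR vf0 nW fW.
set T1 := T0 `&` W in vf; set C := C0 `&` W in vf.
have sC : sbg C := vf_sbg vf.
have TC y : T y -> C y -> y = 1 by move=> Ty Cy; exact: disj1 (vf_disj vf) Ty Cy.
have sH := virtual_factor_sbg vf.
have [O O1 OH] := finidx_nbhs sH (virtual_factor_closed hG cR vf) (vf_finidx vf).
(* The intersection of the [K n] lies in [T], so by compactness some [K n] lies in the open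
   neighbourhood [U] of [T], whose trace on [R] is contained in [T ** C]. *)
pose U := \bigcup_(t in T) [set z | O° (t^-1 * z)].
have [| | | | |_ [n _ <-] KU] := @directed_open G R [set K n | n in setT] U cR.
- by exists (K 0%N), 0%N.
- by move=> _ [n _ <-]; split; [exact: ncl_closed (nK n)|exact: ncl_sub (nK n)].
- move=> _ _ [m _ <-] [n _ <-]; exists (K (maxn m n)); first by exists (maxn m n).
  by move=> y Ky; split; apply: Kmono Ky; rewrite ?leq_maxl ?leq_maxr.
- apply: bigcup_open => t _; apply: open_coset; exact: open_interior.
- move=> y Ky; exists y; last by rewrite /= mulVg.
  move=> n _; apply: (mulS_subr (sbg1 (ncl_sbg (nP n)))).
  by apply: Ky; exists n.
have KTC : K n `<=` T ** C.
  move=> y Ky; have [t Tt Oy] := KU y Ky.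
  have [t1 [c [T1t1 Cc E]]] : (T1 ** C) (t^-1 * y).
    apply: OH; split; first exact: interior_subset.
    by apply: (sbgM sR); [apply: (sbgV sR); exact: ncl_sub nT _ Tt|exact: ncl_sub (nK n) _ Ky].
  exists (t * t1), c; split=> //; last by rewrite -mulgA -E mulVKg.
  apply: (sbgM (ncl_sbg nT)) => //; exact: vf_sub vf _ T1t1.
have nDT : ncl R (D n ** T) by exact: ncl_mul.
(* [Q] embeds in the quotient of [D n ** T] by [T], which is finite because [D' n] lies in [T]; [W]
   normalizes [Q], so [Q] is trivial. *)
pose Q := C `&` (D n ** T).
have sQ : sbg Q by apply: sbgI => //; exact: ncl_sbg nDT.
have fQ : finite_set Q.
  have f1 : finidx T (D n ** T).
    have [s sP] := fD' n; exists s => _ [d [t [Dd Tt ->]]].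
    have [y ys D'y] := sP d Dd; exists y => //; rewrite mulgA.
    by apply: (sbgM (ncl_sbg nT)) => //; exact: D'T D'y.
  have f2 : finidx (T `&` Q) Q.
    by apply: (finidx_sub (ncl_sbg nT) sQ f1) => y [].
  apply: finidx_finite f2 _; apply: sub_finite_set (finite_set1 (1 : G)).
  by move=> y [Ty [Cy _]]; exact: TC.
have Q1 : Q `<=` [set 1].
  apply: (locally_finite1 nW fW sQ fQ); first by move=> y [[]].
  apply: normsS WTC _; apply: norms_mul.
    apply: cents_norms; apply: centsS (vf_cents vf0) => // y [[]] //.
  apply: normsI.
    apply: normsI; first by apply: norms_self; exact: vf_sbg vf0.
    by apply: normsS (ncl_norms nW); exact: vf_subC vf0.
  by apply: normsS (ncl_norms nDT); exact: vf_subC vf0.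
have [Dx x1] := xP n; have [_ _ []] := VP n.
suff Tx : T (x n) by have [] := DT n (x n) (conj Dx Tx).
have [t [c [Tt Cc xE]]] := KTC (x n) (DK n _ Dx).
have c1 : c = 1.
  apply: Q1; split=> //; have -> : c = t^-1 * x n by rewrite xE mulKg.
  apply: (sbgM (ncl_sbg nDT)).
    by apply: (sbgV (ncl_sbg nDT)); apply: (mulS_subr (sbg1 (ncl_sbg (nD n)))).
  by apply: (mulS_subl (sbg1 (ncl_sbg nT))).
by rewrite xE c1 mulg1.
Qed.

(** Choice iterates the step into a forbidden sequence, so this serves as a well-founded induction
    on closed normal subgroups. *)
Lemma no_independent_descent (Q : set (set G)) (K0 : set G) :
  (forall K, Q K -> ncl R K) ->
  (forall K, Q K -> exists D K', [/\ ncl R D, ~ (D `<=` [set 1]), D `<=` K,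
     Q K' & K' `<=` K /\ D `&` K' = [set 1]]) -> ~ Q K0.
Proof.
move=> nQ step QK0.
have /choice [f fP] : forall K, exists p : set G * set G, Q K ->
    [/\ ncl R p.1, ~ (p.1 `<=` [set 1]), p.1 `<=` K, Q p.2 &
      p.2 `<=` K /\ p.1 `&` p.2 = [set 1]].
  move=> K; have [QK|nQK] := pselect (Q K); last by exists (set0, set0).
  by have [D [K' H]] := step K QK; exists (D, K').
pose K n := iter n (fun K => (f K).2) K0.
have QK n : Q (K n) by elim: n => //= n IH; have [] := fP _ IH.
apply: (@no_independent_sequence (fun n => (f (K n)).1) K).
- by move=> n; have [] := fP _ (QK n).
- by move=> n; have [] := fP _ (QK n).
- by move=> n; exact: nQ.
- by move=> n; have [] := fP _ (QK n).
- by move=> n; have [_ _ _ _ []] := fP _ (QK n).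
- by move=> n; have [_ _ _ _ []] := fP _ (QK n).
Qed.

(** The analogue of a uniform module; [no_independent_sequence] plays the role of finite uniform
    dimension. *)
Definition uniform D := [/\ ncl R D, ~ (D `<=` [set 1]) &
  forall N N', ncl R N -> ncl R N' -> ~ (N `<=` [set 1]) -> N `<=` D -> N' `<=` D ->
    N `&` N' = [set 1] -> N' `<=` [set 1]].

Lemma ex_uniform N : ncl R N -> ~ (N `<=` [set 1]) -> exists2 D, uniform D & D `<=` N.
Proof.
move=> nN N1; apply: contrapT => nex.
pose Q := [set K | [/\ ncl R K, ~ (K `<=` [set 1]) &
  ~ exists2 D, uniform D & D `<=` K]].
apply: (@no_independent_descent Q N) => // K [nK K1 nu] //.
apply: contrapT => H; apply: (nu); exists K => //; split=> // D K' nD nK' D1 DK K'K DK'.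
apply: contrapT => K'1; apply: H; exists D, K'; split=> //; split=> //.
by move=> [X uX XK']; apply: nu; exists X => //; exact: subset_trans K'K.
Qed.

Lemma vf_sub_finidx D K K1 C : ncl R D -> virtual_factor R K K1 C -> K `<=` D ->
  (forall x, C x -> D x -> x = 1) -> finidx K D.
Proof.
move=> nD vf KD CD.
have f1 : finidx ((K1 ** C) `&` D) D.
  by apply: (finidx_sub (virtual_factor_sbg vf) (ncl_sbg nD) (vf_finidx vf) (ncl_sub nD)).
apply: finidxS f1 => // _ [[x [c [K1x Cc ->]]] Dxc].
have Kx := vf_sub vf K1x.
have c1 : c = 1 by apply: CD => //; exact: sbgMl (ncl_sbg nD) (KD x Kx) Dxc.
by rewrite c1 mulg1.
Qed.

(** * Central subgroups and averaging *)

Section Abelian.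
Context (W Z : set G) (nW : ncl R W) (fW : finidx W R).
Context (nZ : ncl R Z) (ZW : Z `<=` W) (cZ : cents W Z).

Lemma central_torsion_free x n : Z x -> (0 < n)%N -> x ^+ n = 1 -> x = 1.
Proof.
move=> Zx n0 xn1; have [sT fT Tx] := finite_cyclic n0 xn1.
set T := [set x | _] in sT fT Tx.
have TZ : T `<=` Z by move=> _ [i ->]; exact: sbgX (ncl_sbg nZ) Zx.
apply: (locally_finite1 nW fW sT fT) => //; first exact: subset_trans ZW.
by apply: cents_norms; exact: centsS cZ.
Qed.

Lemma central_abelian : cents Z Z.
Proof. exact: centsS cZ. Qed.

(** An element of [Z] in a virtual complement of the [n]-th powers has trivial [n]-th power, hence
    is trivial; so the complement contributes nothing inside [Z]. *)
Lemma power_finidx n : (0 < n)%N -> finidx (power Z n) Z.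
Proof.
move=> n0; have cZZ := central_abelian.
have nP : ncl R (power Z n) by exact: ncl_power.
have [K1 [C vf]] := vR nP.
apply: (vf_sub_finidx nZ vf); first exact: power_sub (ncl_sbg nZ).
move=> x Cx Zx; apply: (central_torsion_free Zx n0).
have Px : power Z n (x ^+ n) by exists x.
exact: disj1 (vf_disj vf) Px (sbgX n (vf_sbg vf) Cx).
Qed.

End Abelian.

(** Exactly one representative per coset, so that left translation by a group element permutes [s],
    as averaging requires. *)
Lemma transversal A B : sbg A -> sbg B -> finidx A B ->
  exists (s : seq G) (rep : G -> G), [/\ uniq s, forall x, x \in s -> B x,
    forall b, B b -> rep b \in s /\ A ((rep b)^-1 * b) &
    forall x y, x \in s -> y \in s -> A (x^-1 * y) -> x = y].
Proof.
move=> sA sB fA; have [t [tB tP]] := finidx_in sA fA.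
pose rep b := xget 1 [set x | x \in t /\ A (x^-1 * b)].
have repP b : B b -> rep b \in t /\ A ((rep b)^-1 * b).
  move=> /tP[x xt Ax]; rewrite /rep; case: xgetP => [z _ //|/(_ x)].
  by case; split.
have repE b c : A (b^-1 * c) -> rep b = rep c.
  move=> Abc; rewrite /rep; congr (xget _ _).
  apply/seteqP; split=> x [xt Ax]; split=> //.
    have -> : x^-1 * c = (x^-1 * b) * (b^-1 * c) by rewrite -mulgA mulVKg.
    exact: sbgM.
  have -> : x^-1 * b = (x^-1 * c) * (b^-1 * c)^-1.
    by rewrite invgM invgK -mulgA mulVKg.
  by apply: sbgM => //; exact: sbgV.
exists (undup [seq rep x | x <- t]), rep; split=> [|x|b Bb|x y].
- exact: undup_uniq.
- rewrite mem_undup => /mapP[y yt ->].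
  by have [ryt _] := repP y (tB y yt); exact: tB ryt.
- have [bt Ab] := repP b Bb; split=> //; rewrite mem_undup.
  by rewrite -(repE _ _ Ab); exact: map_f.
- rewrite !mem_undup => /mapP[u ut ->] /mapP[v vt ->] Auv.
  have [_ Au] := repP u (tB u ut); have [_ Av] := repP v (tB v vt).
  by rewrite -(repE _ _ Au) -(repE _ _ Av); exact: repE.
Qed.

Definition gprod (I : Type) (F : I -> G) (s : seq I) : G :=
  foldr (fun i p => F i * p) 1 s.

Lemma gprod_in (I : eqType) A (F : I -> G) (s : seq I) : sbg A ->
  (forall i, i \in s -> A (F i)) -> A (gprod F s).
Proof.
move=> sA; elim: s => [_|i s IH H] /=; first exact: sbg1.
apply: sbgM => //; first by apply: H; exact: mem_head.
by apply: IH => j js; apply: H; rewrite inE js orbT.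
Qed.

Lemma gprodM (I : eqType) A (F H : I -> G) (s : seq I) : sbg A -> cents A A ->
  (forall i, i \in s -> A (F i)) -> (forall i, i \in s -> A (H i)) ->
  gprod (fun i => F i * H i) s = gprod F s * gprod H s.
Proof.
move=> sA cA; elim: s => [|i s IH] AF AH /=; first by rewrite mulg1.
have AF' j : j \in s -> A (F j) by move=> js; apply: AF; rewrite inE js orbT.
have AH' j : j \in s -> A (H j) by move=> js; apply: AH; rewrite inE js orbT.
rewrite IH// -!mulgA; congr (_ * _); rewrite !mulgA; congr (_ * _).
apply: cA; first by apply: AH; exact: mem_head.
exact: gprod_in.
Qed.

Lemma gprodJ (I : Type) (F : I -> G) (s : seq I) g :
  gprod F s ^ g = gprod (fun i => F i ^ g) s.
Proof. by elim: s => [|i s IH] /=; [rewrite conj1g|rewrite conjMg IH]. Qed.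

Lemma gprod_map (I J : Type) (h : I -> J) (F : J -> G) (s : seq I) :
  gprod F (map h s) = gprod (fun i => F (h i)) s.
Proof. by elim: s => //= i s ->. Qed.

Lemma gprod_eq (I : eqType) (F H : I -> G) (s : seq I) : {in s, F =1 H} ->
  gprod F s = gprod H s.
Proof.
elim: s => //= i s IH E; rewrite E ?mem_head// IH// => j js.
by apply: E; rewrite inE js orbT.
Qed.

Lemma gprod_cat (I : Type) (F : I -> G) (s t : seq I) :
  gprod F (s ++ t) = gprod F s * gprod F t.
Proof. by elim: s => [|i s IH] /=; [rewrite mul1g|rewrite IH mulgA]. Qed.

Lemma gprod_perm (I : eqType) A (F : I -> G) (s t : seq I) : sbg A -> cents A A ->
  (forall i, i \in s -> A (F i)) -> perm_eq s t -> gprod F s = gprod F t.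
Proof.
move=> sA cA AF st; move: (st).
apply: (catCA_perm_ind (P := fun u => perm_eq s u -> gprod F s = gprod F u)) st _ => //.
move=> s1 s2 s3 IH H.
have H' : perm_eq s (s1 ++ s2 ++ s3).
  by apply: perm_trans H _; rewrite perm_sym; exact/permPl/perm_catCA.
have Ai u : {subset u <= s1 ++ s2 ++ s3} -> A (gprod F u).
  by move=> us; apply: gprod_in => // i iu; apply: AF; rewrite (perm_mem H'); exact: us.
rewrite IH// !gprod_cat !mulgA; congr (_ * _); apply: cA; apply: Ai => i iu.
  by rewrite mem_cat iu.
by rewrite !mem_cat iu orbT.
Qed.

(* Averaging a virtual projection onto [Z] over the conjugates by [R / W]. *)
Lemma abelian_complement Z : ncl R Z -> cents Z Z -> exists Z0 K,
  [/\ ncl R Z0, Z0 `<=` Z, finidx Z0 Z, ncl R K &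
      Z0 `&` K = [set 1] /\ finidx (Z0 ** K) R].
Proof.
move=> nZ cZ; have [D [C vf]] := vR nZ.
have [nD DZ fD sC cC CR ZC cDC fH] := vf; have [sD cD DR nRD] := nD.
have sH := virtual_factor_sbg vf.
have [nW fW] := virtual_factor_core hG cR sR vf; set W := core R _ in nW fW.
have WH : W `<=` D ** C by exact: core_sub.
have [sW cW WR nRW] := nW.
have cDD : cents D D by exact: centsS cZ.
have cHD : cents (D ** C) D.
  move=> _ d [d' [c [Dd' Cc ->]]] Dd; apply/commute_sym/commuteM; first exact: cDD.
  exact: cDC.
have DC d : D d -> C d -> d = 1 by move=> /DZ Zd Cd; exact: disj1 ZC Zd Cd.
(* [pr] projects [D ** C] onto its central factor [D], so it is invariant under conjugation by
   [D ** C]. *)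
pose pr h := xget 1 [set d | D d /\ C (d^-1 * h)].
have prE h d : D d -> C (d^-1 * h) -> pr h = d.
  move=> Dd Cd; rewrite /pr; case: xgetP => [z _ [Dz Cz]|/(_ d)]; last by case.
  apply/esym; rewrite -(mulVKg z d).
  suff -> : z^-1 * d = 1 by rewrite mulg1.
  apply: DC; first by apply: sbgM => //; exact: sbgV.
  have -> : z^-1 * d = (z^-1 * h) * (d^-1 * h)^-1.
    by rewrite invgM invgK -mulgA mulVKg.
  by apply: sbgM => //; exact: sbgV.
have prP h : (D ** C) h -> D (pr h) /\ C ((pr h)^-1 * h).
  by move=> [d [c [Dd Cc ->]]]; rewrite (@prE _ d) ?mulKg.
have prM h h' : (D ** C) h -> (D ** C) h' -> pr (h * h') = pr h * pr h'.
  move=> /prP[Dh Ch] /prP[Dh' Ch']; apply: prE; first exact: sbgM.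
  have -> : (pr h * pr h')^-1 * (h * h') = ((pr h)^-1 * h) * ((pr h')^-1 * h').
    rewrite invgM -!mulgA; rewrite (mulgA _ h) (mulgA (pr h')^-1).
    by rewrite (cDC _ _ (sbgV sD Dh') Ch) -!mulgA.
  exact: sbgM.
have pr1 : pr 1 = 1 by apply: prE; rewrite ?invg1 ?mulg1; exact: sbg1.
have prV h : (D ** C) h -> pr h^-1 = (pr h)^-1.
  move=> Hh; apply: (mulgI (pr h)); rewrite -prM ?mulgV//; exact: sbgV.
have prJ h w : (D ** C) h -> (D ** C) w -> pr (h ^ w) = pr h.
  move=> Hh Hw; rewrite conjgE !prM ?prV//; try exact: sbgV; try exact: sbgM.
  have [Dh _] := prP h Hh; have [Dw _] := prP w Hw.
  by rewrite (cDD _ _ Dh Dw) mulKg.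
have [s [rep [us sR' repP repI]]] := transversal sW sR fW.
pose F x r := pr (x ^ r) ^ r^-1.
have HJ x r : W x -> R r -> (D ** C) (x ^ r) by move=> Wx Rr; exact/WH/nRW.
have FD x r : W x -> R r -> D (F x r).
  move=> Wx Rr; apply: nRD; first exact: sbgV.
  by have [] := prP _ (HJ x r Wx Rr).
have FM x y r : W x -> W y -> R r -> F (x * y) r = F x r * F y r.
  by move=> Wx Wy Rr; rewrite /F conjMg prM ?conjMg//; exact: HJ.
have FW x r w : W x -> R r -> W w -> F x (r * w) = F x r.
  move=> Wx Rr Ww; rewrite /F conjgM prJ; [|exact: HJ|exact: WH].
  rewrite invgM conjgM; congr (_ ^ _); apply/commuteJ/commute_sym.
  apply: cHD; first by apply: sbgV => //; exact: WH.
  by have [] := prP _ (HJ x r Wx Rr).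
(* [F x r] depends only on the coset of [r] modulo [W], so the product over a transversal is
   equivariant under all of [R]. *)
pose f x := gprod (F x) s.
have fD' x : W x -> D (f x).
  by move=> Wx; apply: gprod_in => // r rs; apply: FD => //; exact: sR'.
have fM x y : W x -> W y -> f (x * y) = f x * f y.
  move=> Wx Wy; rewrite /f -(gprodM sD cDD).
  - by apply: gprod_eq => r rs; apply: FM => //; exact: sR'.
  - by move=> r rs; apply: FD => //; exact: sR'.
  - by move=> r rs; apply: FD => //; exact: sR'.
have f1 : f 1 = 1.
  by apply: (mulgI (f 1)); rewrite -fM ?mulg1//; exact: (sbg1 sW).
have fV x : W x -> f x^-1 = (f x)^-1.
  by move=> Wx; apply: (mulgI (f x)); rewrite -fM ?mulgV//; exact: (sbgV sW Wx).
have fJ x g : W x -> R g -> f (x ^ g) = f x ^ g.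
  move=> Wx Rg; rewrite /f gprodJ.
  pose h r := rep (g * r).
  have hs r : r \in s -> h r \in s /\ W ((h r)^-1 * (g * r)).
    by move=> rs; apply: repP; apply: sbgM => //; exact: sR'.
  have pe : perm_eq (map h s) s.
    have uh : uniq (map h s).
      rewrite map_inj_in_uniq// => r r' rs r's hh; apply: repI => //.
      have [_ W1] := hs r rs; have [_ W2] := hs r' r's; rewrite hh in W1.
      have -> : r^-1 * r' = ((h r')^-1 * (g * r))^-1 * ((h r')^-1 * (g * r')).
        by rewrite !invgM invgK -!mulgA mulVKg mulKg.
      by apply: (sbgM sW) => //; exact: (sbgV sW W1).
    apply: uniq_perm => //.
    have sub : {subset map h s <= s} by move=> _ /mapP[r rs ->]; have [] := hs r rs.
    by have [] := uniq_min_size uh sub; rewrite ?size_map.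
  rewrite -(@gprod_perm _ D (fun r => F x r ^ g) (map h s) s) //; last first.
    move=> _ /mapP[r rs ->]; apply: nRD => //; apply: FD => //.
    by apply: sR'; have [] := hs r rs.
  rewrite gprod_map; apply: gprod_eq => r rs.
  have [hrs Wr] := hs r rs.
  have -> : F x (h r) = F x (g * r).
    by rewrite -[g * r](mulVKg (h r)) FW//; exact: sR'.
  by rewrite /F -!conjgM invgM mulgVK.
(* [K] is the kernel of the averaged homomorphism. On [Z0] the latter is the power map with exponent
   [size s], injective because [Z0] is torsion-free. *)
pose K := [set x | W x /\ f x = 1].
pose Z0 := D `&` W.
have nZ0 : ncl R Z0 by exact: nclI.
have [sZ0 cZ0 _ nRZ0] := nZ0.
have Z0W : Z0 `<=` W by move=> x [].
have cWZ0 : cents W Z0 by apply: centsS cHD => // x [].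
have fZ0 : finidx Z0 D by rewrite /Z0 setIC; exact: (finidx_sub sW sD fW).
have m0 : (0 < size s)%N by have [+ _] := repP 1 (sbg1 sR); case: (s).
have fZ x : Z0 x -> f x = x ^+ size s.
  move=> [Dx Wx]; rewrite /f.
  have : forall r, r \in s -> F x r = x.
    move=> r rs; rewrite /F (@prE _ (x ^ r)) ?conjgK ?mulVg//; last exact: sbg1.
    by apply: nRD => //; exact: sR'.
  elim: (s) => [|r t IH] H /=; first by rewrite expg0.
  rewrite expgS H ?mem_head// IH// => r' r't; apply: H.
  by rewrite inE r't orbT.
have nK : ncl R K.
  split.
  - split; first by split=> //; exact: (sbg1 sW).
      by move=> x y [Wx fx] [Wy fy]; split; [exact: (sbgM sW Wx Wy)|rewrite fM// fx fy mulg1].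
    by move=> x [Wx fx]; split; [exact: (sbgV sW Wx)|rewrite fV// fx invg1].
  (* Closedness is obtained without continuity of [f]: each [KV V] contains a closed subgroup of
     finite index, hence is closed, and [K] is their intersection. *)
  - pose KV V := [set x | W x /\ V (f x)].
    rewrite (_ : K = \bigcap_(V in [set V | ncl R V /\ finidx V R]) KV V).
      apply: closed_bigI => V [nV fV']; have sV := ncl_sbg nV.
      have vfV := virtual_factor_shrink sR vf nV fV'.
      have [nWV fWV] := virtual_factor_core hG cR sR vfV.
      set WV := core R _ in nWV fWV.
      have sKV : sbg (KV V).
        split; first by split; [exact: (sbg1 sW)|rewrite f1; exact: (sbg1 sV)].
          move=> x y [Wx fx] [Wy fy].
          by split; [exact: (sbgM sW Wx Wy)|rewrite fM//; exact: (sbgM sV fx fy)].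
        by move=> x [Wx fx]; split; [exact: (sbgV sW Wx)|rewrite fV//; exact: (sbgV sV fx)].
      apply: (@closed_finidx _ (W `&` WV)) => //.
      + by apply: sbgI => //; exact: ncl_sbg nWV.
      + by apply: closedI => //; exact: ncl_closed nWV.
      + move=> x [Wx WVx]; split=> //; apply: gprod_in => // r rs.
        have Rr := sR' r rs.
        apply: (ncl_norms nV); first exact: sbgV.
        have [d [c [[Dd Vd] [Cc _] xE]]] := WVx r Rr.
        by rewrite (@prE _ d) // xE mulKg.
      + have := finidxI sW (ncl_sbg nWV) fW fWV; apply: finidxS => // x [] /WR //.
    apply/seteqP; split=> [x [Wx fx] V [nV _]|x Kx].
      by split=> //; rewrite fx; exact: sbg1 (ncl_sbg nV).
    have RR : [set V | ncl R V /\ finidx V R] R.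
      split; first exact: nclT.
      by apply: finidx_refl => //; exact: sbg1.
    have [Wx _] := Kx R RR; split=> //; apply: contrapT => fx.
    have [| |V [nV fV' Vx]] := @ncl_separate G hG vdG R [set f x] sR cR.
    + by apply: closed_finite => //; exact: finite_set1.
    + by move=> /= /esym.
    by have [_ /Vx] := Kx V (conj nV fV'); apply.
  - by move=> x [/WR].
  - move=> b x Rb [Wx fx]; split; first exact: nRW.
    by rewrite fJ// fx conj1g.
exists Z0, K; split=> //.
- by move=> x [/DZ].
- exact: finidx_trans fZ0 fD.
split.
  apply: sbg_disj => //; first exact: ncl_sbg nK.
  move=> x Z0x [_ fx]; rewrite fZ// in fx.
  exact: (central_torsion_free nW fW nZ0 Z0W cWZ0 Z0x m0 fx).
have fP : finidx (power Z0 (size s)) D.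
  apply: finidx_trans fZ0; exact: (power_finidx nW fW nZ0 Z0W cWZ0 m0).
have sP : sbg (power Z0 (size s)) by apply: sbg_power => //; exact: central_abelian Z0W cWZ0.
have [t tP] := fP; apply: finidx_trans fW.
pose y d := xget 1 [set y | W y /\ power Z0 (size s) (d^-1 * f y)].
exists [seq y d | d <- t] => x Wx; have [d dt Px] := tP (f x) (fD' x Wx).
exists (y d); first exact: map_f.
have [Wy Py] : W (y d) /\ power Z0 (size s) (d^-1 * f (y d)).
  by rewrite /y; case: xgetP => [z _ //|/(_ x)]; case.
have Wyx : W ((y d)^-1 * x) by apply: (sbgM sW) => //; exact: (sbgV sW Wy).
have [z Z0z zE] : power Z0 (size s) (f ((y d)^-1 * x)).
  rewrite fM ?fV//; last exact: (sbgV sW Wy).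
  have -> : (f (y d))^-1 * f x = (d^-1 * f (y d))^-1 * (d^-1 * f x).
    by rewrite invgM invgK -mulgA mulVKg.
  by apply: (sbgM sP) => //; exact: (sbgV sP Py).
have Wz := Z0W z Z0z.
exists z, (z^-1 * ((y d)^-1 * x)); split=> //; last by rewrite mulVKg.
split; first by apply: (sbgM sW) => //; exact: (sbgV sW Wz).
by rewrite fM ?fV//; [rewrite -zE fZ// mulVg|exact: (sbgV sW Wz)].
Qed.

End NoFiniteNormal.

(** * Just infinite quotients *)

Section JustInfiniteQuotients.
Context (G : topologicalGroupType) (hG : hausdorff_space G) (vdG : small_subgroups G).
Context (R : set G) (sR : sbg R) (cR : compact R) (vR : virtually_factored R).
Context (nfR : forall T : set G, sbg T -> finite_set T -> T `<=` R -> norms R T ->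
  T `<=` [set 1]).
Implicit Types A B C D E F H K M N T U V W X Y : set G.

Let clR : closed R := compact_closed hG cR.

(** The centralizer of [D] is normal and contains the virtual complement. It serves unless [D] has a
    nontrivial centre; then [abelian_complement] splits off part of that centre instead. *)
Lemma ex_split N : ncl R N -> ~ (N `<=` [set 1]) -> exists D K,
  [/\ ncl R D /\ ~ (D `<=` [set 1]), D `<=` N, ncl R K, D `&` K = [set 1] &
      finidx (D ** K) R].
Proof.
move=> nN N1; have [D [C vf]] := vR nN.
have D1 := ncl_finidx1 nfR nN N1 (vf_fin vf).
have [nD DN _ sC _ CR _ cDC fDC] := vf.
pose K := centralizer R D.
have nK : ncl R K by apply: ncl_centralizer => //; exact: ncl_norms nD.
have CK : C `<=` K by move=> c Cc; split; [exact: CR|move=> d Dd; exact/commute_sym/cDC].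
pose Z := D `&` K.
have nZ : ncl R Z by exact: nclI.
have [Z1|Z1] := pselect (Z `<=` [set 1]).
  exists D, K; split=> //.
    apply/seteqP; split=> // _ ->; exact: sbg1 (ncl_sbg nZ).
  by apply: finidxS fDC => //; exact: mulSS.
have cZ : cents Z Z.
  by move=> x y [Dx [_ Kx]] [Dy [_ Ky]]; apply: Kx.
have [Z0 [K' [nZ0 Z0Z fZ0 nK' [ZK fZK]]]] :=
  abelian_complement hG vdG sR cR vR nfR nZ cZ.
exists Z0, K'; split=> //; last by move=> x /Z0Z[/DN].
by split=> //; exact: (ncl_finidx1 nfR nZ Z1 fZ0).
Qed.

(** [N] contains a nontrivial [D'] with a normal virtual complement [K]; uniformity makes the trace
    of [K] on [D] trivial, so [D'] already has finite index in [D]. *)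
Lemma uniform_finidx D N : uniform R D -> ncl R N -> N `<=` D -> ~ (N `<=` [set 1]) ->
  finidx N D.
Proof.
move=> [nD D1 uD] nN ND N1.
have [D' [K [[nD' D'1] D'N nK D'K fDK]]] := ex_split nN N1.
have D'D := subset_trans D'N ND.
have KD1 : K `&` D `<=` [set 1].
  have nKD : ncl R (K `&` D) by exact: nclI.
  apply: (uD D' (K `&` D)) => //.
  apply/seteqP; split=> [x [D'x [Kx _]]|_ ->]; first by rewrite -D'K.
  by split; [exact: sbg1 (ncl_sbg nD')|split; [exact: sbg1 (ncl_sbg nK)|exact: sbg1 (ncl_sbg nD)]].
have sDK : sbg (D' ** K).
  by apply: ncl_sbg (ncl_mul hG sR cR nD' nK).
apply: finidxS (finidx_sub sDK (ncl_sbg nD) fDK (ncl_sub nD)) => //.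
move=> _ [[d [k [D'd Kk ->]]] Ddk]; apply: D'N.
have -> : k = 1; last by rewrite mulg1.
by apply: KD1; split=> //; exact: sbgMl (ncl_sbg nD) (D'D d D'd) Ddk.
Qed.

Definition ji_quotient M := [/\ ncl R M, ~ finidx M R &
  forall N, ncl R N -> M `<=` N -> ~ (N `<=` M) -> finidx N R].

Lemma finidx_mulr A B M : finidx A B -> finidx (A ** M) (B ** M).
Proof.
move=> [s sP]; exists s => _ [b [m [Bb Mm ->]]]; have [x xs Ax] := sP b Bb.
by exists x => //; exists (x^-1 * b), m; rewrite mulgA.
Qed.

Lemma ex_ji_quotient N : ncl R N -> ~ (N `<=` [set 1]) -> exists D M,
  [/\ ncl R D /\ ~ (D `<=` [set 1]), D `<=` N, ji_quotient M, D `&` M = [set 1] &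
      finidx (D ** M) R].
Proof.
move=> nN N1; have [D0 uD0 D0N] := ex_uniform hG vdG sR cR vR nfR nN N1.
have [nD0 D01 _] := uD0.
have [D [K [[nD D1] DD0 nK DK fDK]]] := ex_split nD0 D01.
have [sD cD DR nRD] := nD; have [sK cK KR nRK] := nK.
(* [M] is to be maximal above [K] among the normal subgroups meeting [D] trivially. Comparing the
   products [D ** M], all above the finite-index [D ** K], makes this a finite maximization. *)
pose Q := [set H | exists M, [/\ ncl R M, K `<=` M, D `&` M = [set 1] & H = D ** M]].
have [|_ [M [nM KM DM ->]]|H [M [nM KM DM HE]] maxH] :=
    @finidx_maximal G R (D ** K) Q (ncl_sbg (ncl_mul hG sR cR nD nK)) fDK.
- by exists (D ** K), K; split.
- split; [exact: ncl_sbg (ncl_mul hG sR cR nD nM)|exact: mulSS|].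
  by apply: mulS_sub => //; exact: ncl_sub nM.
have [sM cM MR nRM] := nM.
have cDK : cents D K.
  by apply: norms_cents => //; [exact: normsS nRK|exact: normsS nRD].
exists D, M; split=> //; first exact: subset_trans D0N.
- split=> //.
    move=> fM; apply: (ncl_finidx1 nfR nD D1 (finidx_sub sM sD fM DR)).
    by rewrite setIC DM.
  move=> M' nM' MM' M'M; have [sM' cM' M'R nRM'] := nM'.
  (* A larger [M'] meeting [D] trivially would have the same product with [D], hence would equal
     [M]. *)
  have [M'D1|M'D1] := pselect (D `&` M' `<=` [set 1]).
    exfalso; apply: M'M => m M'm.
    have DM' : D `&` M' = [set 1].
      by apply: sbg_disj => // x Dx M'x; apply: M'D1.
    have : H m.
      apply: (maxH (D ** M')) => //; last exact: (mulS_subr (sbg1 sD)).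
        by exists M'; split=> //; exact: subset_trans MM'.
      by rewrite HE; exact: mulSS.
    rewrite HE => -[d [m' [Dd Mm' mE]]].
    have d1 : d = 1.
      apply: (disj1 DM' Dd); apply: sbgMr sM' (MM' _ Mm') _.
      by rewrite -mE.
    by rewrite mE d1 mul1g.
  have nDM' : ncl R (D `&` M') by exact: nclI.
  have fD : finidx (D `&` M') D.
    apply: finidxS (uniform_finidx uD0 nDM' _ M'D1) => //.
    by move=> x [/DD0].
  apply: finidxS (finidx_trans (finidx_mulr K fD) fDK) => //.
  by apply: (mulS_sub sM' (@subIsetr _ D M')); exact: subset_trans KM MM'.
- by apply: finidxS fDK => //; exact: mulSS.
Qed.

(** Starting from [R], [K] is the intersection of the members already used; each [M] is independent
    of it up to finite index, and the chain ends once [K] is trivial. *)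
Fixpoint ji_chain K (s : seq (set G)) : Prop :=
  if s is M :: s' then
    [/\ ji_quotient M, finidx (K ** M) R & ji_chain (K `&` M) s']
  else K `<=` [set 1].

(** Each [M] comes with a nontrivial [D] in [K] that meets [M] trivially, so a process without end
    would contradict [no_independent_descent]. *)
Lemma ex_ji_chain : exists s, ji_chain R s.
Proof.
apply: contrapT => nex.
pose Q := [set K | ncl R K /\ ~ exists s, ji_chain K s].
apply: (@no_independent_descent G hG vdG R sR cR vR nfR Q R) => [K [] //| |].
  move=> K [nK nch].
  have K1 : ~ (K `<=` [set 1]) by move=> K1; apply: nch; exists [::].
  have [D [M [[nD D1] DK jM DM fDM]]] := ex_ji_quotient nK K1.
  have [nM _ _] := jM.
  exists D, (K `&` M); split=> //.
    split; first exact: nclI.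
    move=> [s chs]; apply: nch; exists (M :: s); split=> //.
    by apply: finidxS fDM => //; exact: mulSS.
  split; first by move=> x [].
  apply: sbg_disj => [||x Dx [_ Mx]]; first exact: ncl_sbg nD.
    exact: ncl_sbg (nclI nK nM).
  exact: disj1 DM Dx Mx.
by split=> //; exact: nclT.
Qed.

Lemma ji_chain_ji K s i : ji_chain K s -> (i < size s)%N -> ji_quotient (nth set0 s i).
Proof. by elim: s K i => // M s IH K [|i] [jM _ chs] //=; exact: IH chs. Qed.

Lemma ji_chain_trivial K s x : ji_chain K s -> K x ->
  (forall i, (i < size s)%N -> nth set0 s i x) -> x = 1.
Proof.
elim: s K => [|M s IH] K /=; first by move=> K1 Kx _; exact: K1.
move=> [_ _ chs] Kx sx; apply: (IH _ chs) => [|i]; last exact: (sx i.+1).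
by split=> //; exact: (sx 0%N).
Qed.

(** A Chinese remainder theorem near 1: independence only up to finite index confines the prescribed
    residues to [V]. *)
Lemma ji_chain_open K s : ncl R K -> ji_chain K s -> exists V,
  [/\ ncl R V, finidx V R & forall y : nat -> G, (forall i, V (y i)) ->
    exists2 x, K x & forall i, (i < size s)%N -> nth set0 s i (x^-1 * y i)].
Proof.
elim: s K => [|M s IH] K nK /=.
  move=> _; exists R; split; first exact: nclT.
    exact: finidx_refl (sbg1 sR) _ _.
  by move=> y _; exists 1; first exact: sbg1 (ncl_sbg nK).
move=> [[nM _ _] fKM chs].
have [V' [nV' fV' V'P]] := IH _ (nclI nK nM) chs.
have nKV : ncl R ((K `&` V') ** M) by apply: ncl_mul => //; exact: nclI.
have fKV : finidx ((K `&` V') ** M) R.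
  apply: finidx_trans fKM; apply: finidx_mulr; rewrite setIC.
  exact: (finidx_sub (ncl_sbg nV') (ncl_sbg nK) fV' (ncl_sub nK)).
exists (V' `&` ((K `&` V') ** M)); split; first exact: nclI.
  exact: finidxI (ncl_sbg nV') (ncl_sbg nKV) fV' fKV.
move=> y Vy; have [_ [k [m [[Kk V'k] Mm yE]]]] := Vy 0%N.
have [|x [Kx Mx] xs] := V'P (fun i => k^-1 * y i.+1).
  move=> i; apply: (sbgM (ncl_sbg nV')); first exact: (sbgV (ncl_sbg nV')).
  by have [] := Vy i.+1.
exists (k * x); first exact: (sbgM (ncl_sbg nK)).
move=> [|i] /= si; last by rewrite invgM -mulgA; exact: xs.
rewrite yE invgM -mulgA mulKg.
by apply: (sbgM (ncl_sbg nM)) => //; exact: (sbgV (ncl_sbg nM)).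
Qed.

End JustInfiniteQuotients.

(** * Normal subgroups of a direct product *)

Section DirectProduct.
Context (G : topologicalGroupType) (hG : hausdorff_space G).
Context (A B : set G) (sA : sbg A) (sB : sbg B) (cA : compact A) (cB : compact B).
Context (cAB : cents A B) (AB1 : A `&` B = [set 1]).
Implicit Types M N : set G.

Let sAB : sbg (A ** B).
Proof. by apply: sbg_mul => //; exact: cents_norms. Qed.

Lemma direct_modular N x : sbg N -> B `<=` N -> N x -> (A ** B) x ->
  exists a b, [/\ A a, N a, B b & x = a * b].
Proof.
move=> sN BN Nx [a [b [Aa Bb xE]]]; exists a, b; split=> //.
by apply: (sbgMr sN (BN b Bb)); rewrite -xE.
Qed.

Lemma direct_mem M a : M `<=` A -> A a -> (M ** B) a -> M a.
Proof.
move=> MA Aa [m [b [Mm Bb aE]]].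
have b1 : b = 1.
  by apply: (disj1 AB1) => //; apply: (sbgMl sA (MA m Mm)); rewrite -aE.
by rewrite aE b1 mulg1.
Qed.

Lemma ncl_direct M : ncl A M -> ncl (A ** B) (M ** B).
Proof.
move=> [sM cM MA nM]; have cMB : cents M B by exact: centsS cAB.
split.
- by apply: sbg_mul => //; exact: cents_norms.
- by apply: closed_mulS => //; exact: subclosed_compact cM cA MA.
- exact: mulSS.
- apply: norms_mul; apply: normsM => //.
  + exact: cents_norms.
  + by apply: cents_norms; exact: centsC.
  + exact: norms_self.
Qed.

Lemma nclI_direct N : ncl (A ** B) N -> ncl A (N `&` A).
Proof.
move=> nN; apply: nclIr nN sA (compact_closed hG cA) _.
by apply: mulS_subl; exact: sbg1.
Qed.

Lemma max_normal_direct M : max_normal A M -> max_normal (A ** B) (M ** B).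
Proof.
move=> [nM fM AM maxM]; have MA := ncl_sub nM; split.
- exact: ncl_direct.
- exact: finidx_mulr.
- move=> ABM; apply: AM => a Aa; apply: direct_mem => //.
  by apply: ABM; apply: (mulS_subl (sbg1 sB)).
move=> N nN MBN; have sN := ncl_sbg nN.
have BN : B `<=` N by apply: subset_trans MBN; apply: mulS_subr; exact: sbg1 (ncl_sbg nM).
have [|H|H] := maxM _ (nclI_direct nN).
- move=> m Mm; split; last exact: MA.
  by apply: MBN; apply: (mulS_subl (sbg1 sB)).
- left=> x Nx; have [a [b [Aa Na Bb ->]]] := direct_modular sN BN Nx (ncl_sub nN Nx).
  by exists a, b; split=> //; apply: H.
- by right; apply: mulS_sub => // a /H[].
Qed.

Lemma ji_quotient_direct M : ji_quotient A M -> ji_quotient (A ** B) (M ** B).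
Proof.
move=> [nM fM jM]; have MA := ncl_sub nM.
have sMB := ncl_sbg (ncl_direct nM); split.
- exact: ncl_direct.
- move=> f; apply: fM.
  have AAB : A `<=` A ** B by apply: mulS_subl; exact: sbg1.
  apply: finidxS (finidx_sub sMB sA f AAB) => // x [xM Ax].
  exact: direct_mem.
move=> N nN MBN NMB; have sN := ncl_sbg nN.
have BN : B `<=` N by apply: subset_trans MBN; apply: mulS_subr; exact: sbg1 (ncl_sbg nM).
have f : finidx (N `&` A) A.
  apply: jM; first exact: nclI_direct.
    move=> m Mm; split; last exact: MA.
    by apply: MBN; apply: (mulS_subl (sbg1 sB)).
  move=> H; apply: NMB => x Nx.
  have [a [b [Aa Na Bb ->]]] := direct_modular sN BN Nx (ncl_sub nN Nx).
  by exists a, b; split=> //; apply: H.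
apply: finidxS (finidx_mulr B f) => //.
by apply: mulS_sub => // x [].
Qed.

End DirectProduct.

(* [V] controls the factors in [J], so that the image of [R] in the product of
   the groups [R / N i] is a neighbourhood of 1. *)
Definition product_family (G : topologicalGroupType) (R : set G) (I : Type)
    (N : I -> set G) (J : set I) (V : set G) :=
  [/\ finite_set J /\ (forall i, J i -> ji_quotient R (N i)),
      forall i, ~ J i -> max_normal R (N i),
      forall x, R x -> (forall i, N i x) -> x = 1,
      ncl R V /\ finidx V R &
      forall y : I -> G, (forall i, R (y i)) -> (forall i, J i -> V (y i)) ->
        exists2 x, R x & forall i, N i (x^-1 * y i)].

Lemma ex_product_family (G : topologicalGroupType) (hG : hausdorff_space G)
    (vdG : small_subgroups G) (E R : set G) :
  sbg E -> compact E -> melnikov E `<=` [set 1] ->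
  sbg R -> compact R -> virtually_factored R ->
  (forall T, sbg T -> finite_set T -> T `<=` R -> norms R T -> T `<=` [set 1]) ->
  cents E R -> E `&` R = [set 1] ->
  exists (I : Type) (N : I -> set G) J V, product_family (E ** R) N J V.
Proof.
move=> sE cE melE sR cR vR nfR cER ER1.
have cRE := centsC cER; have RE1 : R `&` E = [set 1] by rewrite setIC.
have REC : R ** E = E ** R by apply: mulSC => //; exact: cents_norms.
have [F [indF F1]] := ex_independent hG sE cE melE.
have [s chs] := ex_ji_chain hG vdG sR cR vR nfR.
have [V [nV fV VP]] := ji_chain_open hG sR cR (nclT sR (compact_closed hG cR)) chs.
have [Fm _] := indF.
(* A member for [E] is multiplied by all of [R], and one for [R] by all of [E], so the quotients are
   those of the separate groups. *)
pose I := ({M | F M} + 'I_(size s))%type.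
pose N (i : I) := match i with inl M => sval M ** R | inr j => nth set0 s j ** E end.
exists I, N, (range inr), (V ** E); split.
- split; first exact: finite_image.
  move=> _ [j _ <-] /=; rewrite -REC; apply: ji_quotient_direct => //.
  exact: (ji_chain_ji chs).
- move=> [[M FM] _ /=|j []]; last by exists j.
  by apply: max_normal_direct => //; exact: Fm.
- move=> x [e [r [Ee Rr ->]]] Nx.
  have e1 : e = 1.
    apply: F1 => // M FM; have [nM _ _ _] := Fm M FM.
    apply: (direct_mem sE ER1 (ncl_sub nM) Ee).
    have /= := Nx (inl (exist _ M FM)); apply: sbgMr.
      have nMR : ncl (E ** R) (M ** R) by exact: ncl_direct.
      exact: ncl_sbg nMR.
    exact: (mulS_subr (sbg1 (ncl_sbg nM))).
  rewrite e1 mul1g; apply: (ji_chain_trivial chs) => // i si.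
  have [nM _ _] := ji_chain_ji chs si.
  apply: (direct_mem sR RE1 (ncl_sub nM) Rr).
  by have /= := Nx (inr (Ordinal si)); rewrite e1 mul1g.
- rewrite -REC; split; first exact: ncl_direct.
  exact: finidx_mulr.
move=> y yER Vy.
have /choice [p pP] : forall i, exists p : G * G,
    [/\ E p.1, R p.2, y i = p.1 * p.2 & range inr i -> V p.2].
  move=> i; have [Ji|nJi] := pselect (range inr i).
    have [v [e [Vv Ee yE]]] := Vy i Ji; exists (e, v); split=> //.
      exact: ncl_sub nV _ Vv.
    by rewrite yE cRE//; exact: ncl_sub nV _ Vv.
  by have [e [r [Ee Rr yE]]] := yER i; exists (e, r).
pose yE M := if pselect (F M) is left FM then (p (inl (exist _ M FM))).1 else 1.
have [|x1 Ex1 x1P] := independent_surjective hG sE cE (y := yE) indF.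
  by move=> M FM; rewrite /yE; case: pselect => // FM'; case: (pP (inl (exist _ M FM'))).
(* Beyond the chain the residue is 1, which lies in [V], as [VP] demands for every index. *)
pose yR i := if insub i is Some j then (p (inr j)).2 else 1.
have [|x2 Rx2 x2P] := VP yR.
  move=> i; rewrite /yR; case: insubP => [j _ _|_]; last exact: sbg1 (ncl_sbg nV).
  by have [_ _ _] := pP (inr j); apply; exists j.
exists (x1 * x2); first by exists x1, x2.
have split_y i : (x1 * x2)^-1 * y i = (x1^-1 * (p i).1) * (x2^-1 * (p i).2).
  have [Ee Rr -> _] := pP i.
  have cx2 : commute (x1^-1 * (p i).1) x2^-1.
    by apply: cER; [apply: (sbgM sE) => //; exact: sbgV|exact: sbgV].
  by rewrite [RHS]mulgA cx2 invgM -!mulgA.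
move=> [[M FM]|j] /=; rewrite split_y.
  set i := inl _; have [Ee Rr _ _] := pP i.
  exists (x1^-1 * (p i).1), (x2^-1 * (p i).2); split=> //.
    have := x1P M FM; rewrite /yE; case: pselect => // FM'.
    by rewrite (Prop_irrelevance FM' FM).
  by apply: (sbgM sR) => //; exact: sbgV.
have [Ee Rr _ _] := pP (inr j).
have Ex : E (x1^-1 * (p (inr j)).1) by apply: (sbgM sE) => //; exact: sbgV.
exists (x2^-1 * (p (inr j)).2), (x1^-1 * (p (inr j)).1); split=> //.
  have := x2P j (ltn_ord j); rewrite /yR.
  by case: insubP => [j' _ /val_inj -> //|]; rewrite ltn_ord.
by apply: cER => //; apply: (sbgM sR) => //; exact: sbgV.
Qed.

Lemma LD_product_family (G : topologicalGroupType) (hG : hausdorff_space G) :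
  locally_compact [set: G] -> totally_disconnected [set: G] -> property_LD G ->
  exists R, [/\ sbg R, open R, compact R &
    exists (I : Type) (N : I -> set G) J V, product_family R N J V].
Proof.
move=> lcG tdG LD.
have vdG : small_subgroups G by exact: small_subgroups_td.
have [U [sU oU cU _]] := van_dantzig hG lcG tdG (@filterT _ (nbhs (1 : G)) _).
have vU : virtually_factored U by exact: LD_virtually_factored.
have clU := compact_closed hG cU.
pose E := closure (finr U).
have nE : ncl U E by exact: ncl_closure_finr.
have [sE cE EU nUE] := nE; have cpE := ncl_compact cU nE.
have [E1 [C vf]] := vU E nE.
have nfR := no_finite_normal hG sU cU vf.
have [nW fW] := virtual_factor_core hG cU sU vf.
set W := core U _ in nfR nW fW; pose R := C `&` W; rewrite -/R in nfR.
have [nE1 E1E fE1 sC cC CU EC cEC fEC] := vf.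
have [sE1 cE1 E1U nUE1] := nE1; have [sW cW WU nUW] := nW.
have sR : sbg R by exact: sbgI.
have clR : closed R by exact: closedI.
have RU : R `<=` U by move=> x [_ /WU].
have cR : compact R by exact: subclosed_compact clR cU RU.
pose Y := melnikov E.
have nY : ncl U Y.
  have [sY cY YE _] := ncl_melnikov sE cE; split=> //; first exact: subset_trans EU.
  exact: norms_melnikov.
have fY : finite_set Y.
  have [Y1 [D [nY1 Y1Y fY1 sD cD DU YD cY1D fYD]]] := vU Y nY.
  have Y1E : Y1 `<=` E by move=> y /Y1Y[].
  apply: finidx_finite fY1 _.
  apply: (@finite_melnikov_factor G hG vdG E Y1 (D `&` E)) => //.
  (* A finite normal subgroup of [U] lies in [E] and is normal there, so [finr E] is dense in
     [E]. *)
  - apply: closureS => x [T [sT fT TU nT Tx]]; exists T; split=> //.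
      by move=> t Tt; apply: subset_closure; exists T.
    exact: normsS EU nT.
  - exact: nclS nY1 EU Y1E.
  - exact: sbgI.
  - exact: closedI.
  - apply/seteqP; split=> [x [Y1x [Dx _]]|_ ->].
      by rewrite -YD; split=> //; exact: Y1Y.
    by split; [exact: sbg1 (ncl_sbg nY1)|split; exact: sbg1].
  - by apply: centsS cY1D => // x [].
  - have sYD : sbg (Y1 ** D).
      by apply: sbg_mul => //; [exact: ncl_sbg nY1|exact: cents_norms].
    apply: finidxS (finidx_sub sYD sE fYD EU) => //.
    move=> _ [[y [d [Y1y Dd ->]]] Eyd]; exists y, d; split=> //; split=> //.
    exact: sbgMl sE (Y1E y Y1y) Eyd.
(* [V] avoids the nontrivial elements of the finite group [Y]; as [E2] lies in [V], its Melnikov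
   subgroup is trivial by [melnikov_sub]. *)
have [||V [nV fV VY]] := @ncl_separate G hG vdG U (Y `\ 1) sU cU.
- by apply: closed_finite => //; apply: sub_finite_set fY; move=> x [].
- by move=> [_]; apply.
pose E2 := E1 `&` (V `&` W).
have nVW : ncl U (V `&` W) by exact: nclI.
have nE2 : ncl U E2 by exact: nclI.
have [sE2 cE2 E2U nUE2] := nE2.
have fVW : finidx (V `&` W) U by apply: finidxI => //; exact: ncl_sbg nV.
have E2E : E2 `<=` E by move=> x [/E1E].
have fE2 : finidx E2 E1.
  by rewrite /E2 setIC; exact: (finidx_sub (ncl_sbg nVW) sE1 fVW).
have fR : finidx R C by rewrite /R setIC; exact: (finidx_sub sW sC fW).
have cE2R : cents E2 R by apply: centsS cEC => x [].
have sM : sbg (E2 ** R) by apply: sbg_mul => //; exact: cents_norms.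
have cpE2 : compact E2 by exact: ncl_compact cU nE2.
have cM : compact (E2 ** R) by exact: compact_mulS.
have oM : open (E2 ** R).
  apply: (@finidx_open _ _ U) => //.
  - exact: compact_closed.
  - exact: mulS_sub.
  - by apply: finidx_trans fEC; apply: finidx_mul => // x [].
exists (E2 ** R); split=> //.
apply: ex_product_family => //.
- move=> x mx; have Yx : Y x.
    by apply: (melnikov_sub hG sE cpE (nclS nE2 EU E2E) sE2 mx).
  apply: contrapT => x1; have Vx : V x by case: mx => [[_ []]].
  exact: VY Vx _.
- apply: virtual_factor_restrict sE2 sR clR cE2R _.
  exact: LD_virtually_factored.
- apply/seteqP; split=> [x [E2x [Cx _]]|_ ->]; last by split; exact: sbg1.
  by rewrite -EC; split=> //; exact: E2E.
Qed.

(** * Quotient groups *)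

Section QuotientGroup.
Context (G : topologicalGroupType) (R N : set G).
Hypothesis RN : [/\ sbg R, open R & ncl R N].

Let sR : sbg R. Proof. by case: RN. Qed.
Let oR : open R. Proof. by case: RN. Qed.
Let nN : ncl R N. Proof. by case: RN. Qed.
Let sN : sbg N := ncl_sbg nN.

Let coset (x : G) : set G := [set z | N (x^-1 * z)].

(** The hypotheses are an argument of the type, so that the group structure, which needs them, can
    be attached to it. *)
Definition quotient of [/\ sbg R, open R & ncl R N] : Type :=
  {A : set G | exists2 x, R x & A = coset x}.

Local Notation Q := (quotient RN).

(* Outside [R] the value is the junk coset of 1. *)
Definition quotient_pi (x : G) : Q :=
  match pselect (R x) with
  | left Rx => exist _ (coset x) (ex_intro2 _ _ x Rx erefl)
  | right _ => exist _ (coset 1) (ex_intro2 _ _ 1 (sbg1 sR) erefl)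
  end.

Local Notation pi := quotient_pi.

Lemma quotient_pi_val x : R x -> sval (pi x) = coset x.
Proof. by rewrite /quotient_pi; case: pselect. Qed.

Lemma quotient_pi_eq x y : R x -> R y -> pi x = pi y <-> N (x^-1 * y).
Proof.
move=> Rx Ry; split=> [/(congr1 sval)|Nxy].
  rewrite !quotient_pi_val// => cxy.
  have : coset y y by rewrite /coset /= mulVg; exact: sbg1.
  by rewrite -cxy.
have cE : coset x = coset y.
  apply/seteqP; split=> z Nz.
    rewrite /coset /=; have -> : y^-1 * z = (x^-1 * y)^-1 * (x^-1 * z).
      by rewrite invgM invgK -mulgA mulVKg.
    by apply: (sbgM sN) => //; exact: (sbgV sN).
  rewrite /coset /=; have -> : x^-1 * z = (x^-1 * y) * (y^-1 * z).
    by rewrite -mulgA mulVKg.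
  exact: (sbgM sN).
apply: eq_sig_hprop; first by move=> *; exact: Prop_irrelevance.
by rewrite -!/(sval _) !quotient_pi_val.
Qed.

Lemma quotient_pi_surj (a : Q) : exists2 x, R x & pi x = a.
Proof.
case: a => A [x Rx AE]; exists x => //.
apply: eq_sig_hprop; first by move=> *; exact: Prop_irrelevance.
by rewrite -/(sval _) quotient_pi_val.
Qed.

HB.instance Definition _ := gen_eqMixin Q.
HB.instance Definition _ := gen_choiceMixin Q.

Let op (O : set Q) : Prop := open [set x | R x /\ O (pi x)].

Let opT : op setT.
Proof. by rewrite /op (_ : [set x | _] = R)//; apply/seteqP; split=> x // []. Qed.

Let opI : setI_closed op.
Proof.
move=> A B oA oB; rewrite /op (_ : [set x | _] =
  [set x | R x /\ A (pi x)] `&` [set x | R x /\ B (pi x)]); first exact: openI.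
by apply/seteqP; split=> x [] => [Rx [Ax Bx]|[Rx Ax] [_ Bx]].
Qed.

Let op_bigU (I : Type) (f : I -> set Q) : (forall i, op (f i)) -> op (\bigcup_i f i).
Proof.
move=> of_; rewrite /op (_ : [set x | _] = \bigcup_i [set x | R x /\ f i (pi x)]).
  by apply: bigcup_open => i _; exact: of_.
apply/seteqP; split=> x; first by move=> [Rx [i _ fx]]; exists i.
by move=> [i _ [Rx fx]]; split=> //; exists i.
Qed.

HB.instance Definition _ := isOpenTopological.Build Q opT opI op_bigU.

Lemma quotient_openE (O : set Q) : open O <-> open [set x | R x /\ O (pi x)].
Proof. by []. Qed.

Let rep (a : Q) : G := xget 1 [set x | R x /\ pi x = a].

Let repP a : R (rep a) /\ pi (rep a) = a.
Proof.
rewrite /rep; case: xgetP => [z _ //|H].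
by have [x Rx xa] := quotient_pi_surj a; have := H x; case.
Qed.

Let one : Q := pi 1.
Let mul (a b : Q) : Q := pi (rep a * rep b).
Let inv (a : Q) : Q := pi (rep a)^-1.

Let mulE x y : R x -> R y -> mul (pi x) (pi y) = pi (x * y).
Proof.
move=> Rx Ry; rewrite /mul.
have [Rx' xE] := repP (pi x); have [Ry' yE] := repP (pi y).
have /quotient_pi_eq -/(_ Rx' Rx) Nx := xE.
have /quotient_pi_eq -/(_ Ry' Ry) Ny := yE.
apply/quotient_pi_eq; [exact: (sbgM sR)|exact: (sbgM sR)|].
set x' := rep _ in Rx' xE Nx *; set y' := rep _ in Ry' yE Ny *.
have -> : (x' * y')^-1 * (x * y) = (x'^-1 * x) ^ y' * (y'^-1 * y).
  by rewrite conjgE invgM -!mulgA mulVKg.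
by apply: (sbgM sN) => //; exact: (ncl_norms nN).
Qed.

Let invE x : R x -> inv (pi x) = pi x^-1.
Proof.
move=> Rx; rewrite /inv; have [Rx' xE] := repP (pi x).
have /quotient_pi_eq -/(_ Rx' Rx) Nx := xE.
apply/quotient_pi_eq; [exact: (sbgV sR)|exact: (sbgV sR)|].
set x' := rep _ in Rx' xE Nx *.
have -> : (x'^-1)^-1 * x^-1 = ((x'^-1 * x) ^ x^-1)^-1.
  by rewrite conjgE !invgK !mulgA mulgK invgM invgK.
by apply: (sbgV sN); apply: (ncl_norms nN) => //; exact: (sbgV sR).
Qed.

Let mulA : associative mul.
Proof.
move=> a b c; have [x Rx <-] := quotient_pi_surj a.
have [y Ry <-] := quotient_pi_surj b; have [z Rz <-] := quotient_pi_surj c.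
by rewrite !mulE// ?mulgA//; exact: (sbgM sR).
Qed.

Let mul1 : left_id one mul.
Proof.
move=> a; have [x Rx <-] := quotient_pi_surj a.
by rewrite mulE ?mul1g//; exact: (sbg1 sR).
Qed.

Let mulr1 : right_id one mul.
Proof.
move=> a; have [x Rx <-] := quotient_pi_surj a.
by rewrite mulE ?mulg1//; exact: (sbg1 sR).
Qed.

Let mulV : left_inverse one inv mul.
Proof.
move=> a; have [x Rx <-] := quotient_pi_surj a.
by rewrite invE// mulE ?mulVg//; exact: (sbgV sR).
Qed.

Let mulrV : right_inverse one inv mul.
Proof.
move=> a; have [x Rx <-] := quotient_pi_surj a.
by rewrite invE// mulE ?mulgV//; exact: (sbgV sR).
Qed.

HB.instance Definition _ := isGroup.Build Q mulA mul1 mulr1 mulV mulrV.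

Lemma quotient_pi_continuous x (O : set Q) : R x -> nbhs (pi x) O ->
  nbhs x [set z | R z /\ O (pi z)].
Proof.
move=> Rx; rewrite nbhsE => -[O' [oO' O'x] O'O].
rewrite nbhsE; exists [set z | R z /\ O' (pi z)].
  by split=> //; exact/quotient_openE.
by move=> z [Rz /O'O].
Qed.

(** The preimage of the image of [O] is a union of translates of [O] by elements of [N], taken
    inside [R]. *)
Lemma quotient_pi_open (O : set G) : open O -> open (pi @` (O `&` R)).
Proof.
move=> oO; apply/quotient_openE.
rewrite (_ : [set x | _] = \bigcup_(n in N) [set x | (O `&` R) (x * n)]).
  apply: bigcup_open => n _; apply: (@open_preimage _ _ (fun x => x * n)).
    exact: continuous_mulgr.
  exact: openI.
apply/seteqP; split=> [x [Rx [z [Oz Rz] /esym xz]]|x [n Nn [Oxn Rxn]]].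
  exists (x^-1 * z); first exact/quotient_pi_eq.
  by rewrite /= mulVKg.
have Rx : R x by apply: (sbgMr sR) Rxn; exact: ncl_sub nN _ Nn.
split=> //; exists (x * n) => //.
by apply/quotient_pi_eq => //; rewrite invgM -mulgA mulVg mulg1; exact: (sbgV sN).
Qed.

Lemma nbhs_quotient_pi x (O : set G) : R x -> nbhs x O -> nbhs (pi x) (pi @` (O `&` R)).
Proof.
move=> Rx; rewrite nbhsE => -[O' [oO' O'x] O'O].
apply: (@filterS _ _ _ (pi @` (O' `&` R))).
  by move=> _ [z [/O'O Oz Rz] <-]; exists z.
apply: open_nbhs_nbhs; split; first exact: quotient_pi_open.
by exists x.
Qed.

Let mul_cts : continuous (fun z : Q * Q => z.1 * z.2).
Proof.
move=> [a b] O /=; have [x Rx <-] := quotient_pi_surj a.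
have [y Ry <-] := quotient_pi_surj b.
have -> : pi x * pi y = pi (x * y) by exact: mulE.
move=> /quotient_pi_continuous -/(_ (sbgM sR Rx Ry)) H.
have [[A B] /= [Ax By] AB] := @mulg_continuous G (x, y) _ H.
exists (pi @` (A `&` R), pi @` (B `&` R)).
  by split; exact: nbhs_quotient_pi.
move=> [c d] [[x' [Ax' Rx'] /= <-] [y' [By' Ry'] /= <-]] /=.
have -> : pi x' * pi y' = pi (x' * y') by exact: mulE.
by have [] := AB (x', y') (conj Ax' By').
Qed.

Let inv_cts : continuous (fun a : Q => a^-1).
Proof.
move=> a O /=; have [x Rx <-] := quotient_pi_surj a.
have -> : (pi x)^-1 = pi x^-1 by exact: invE.
move=> /quotient_pi_continuous -/(_ (sbgV sR Rx)) H.
have H' := @invg_continuous G x _ H.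
apply: filterS (nbhs_quotient_pi Rx H') => _ [y [[_ Oy] Ry] <-] /=.
have -> // : (pi y)^-1 = pi y^-1 by exact: invE.
Qed.

HB.instance Definition _ := isTopologicalGroup.Build Q mul_cts inv_cts.

Definition quotient_group : topologicalGroupType := Q.

Lemma quotient_piM x y : R x -> R y -> pi (x * y) = (pi x : quotient_group) * pi y.
Proof. by move=> Rx Ry; apply/esym; exact: mulE. Qed.

Lemma quotient_pi1 : pi 1 = 1 :> quotient_group. Proof. by []. Qed.

Lemma quotient_piV x : R x -> pi x^-1 = (pi x : quotient_group)^-1.
Proof. by move=> Rx; apply/esym; exact: invE. Qed.

Lemma quotient_piJ x y : R x -> R y -> pi (x ^ y) = (pi x : quotient_group) ^ pi y.
Proof.
move=> Rx Ry; have Ry' := sbgV sR Ry.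
by rewrite !conjgE !quotient_piM// ?quotient_piV//; exact: (sbgM sR).
Qed.

Lemma quotient_pi_eq1 x : R x -> pi x = 1 :> quotient_group <-> N x.
Proof.
move=> Rx; rewrite -quotient_pi1.
have -> : (pi x = pi 1) = (pi 1 = pi x) by apply/propext; split=> ->.
by rewrite quotient_pi_eq ?invg1 ?mul1g//; exact: (sbg1 sR).
Qed.

Definition quotient_preim (K : set quotient_group) : set G := [set x | R x /\ K (pi x)].

Lemma open_preim (K : set quotient_group) : open K <-> open (quotient_preim K).
Proof. by []. Qed.

Lemma sbg_preim K : sbg K -> sbg (quotient_preim K).
Proof.
move=> sK; split.
- by split; [exact: (sbg1 sR)|rewrite quotient_pi1; exact: (sbg1 sK)].
- move=> x y [Rx Kx] [Ry Ky]; split; first exact: (sbgM sR).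
  by rewrite quotient_piM//; exact: (sbgM sK).
- move=> x [Rx Kx]; split; first exact: (sbgV sR).
  by rewrite quotient_piV//; exact: (sbgV sK).
Qed.

Lemma ncl_preim K : sbg K -> closed K -> norms setT K -> ncl R (quotient_preim K).
Proof.
move=> sK cK nK; split; first exact: sbg_preim.
- rewrite (_ : quotient_preim K = R `&` ~` quotient_preim (~` K)).
    apply: closedI; first exact: open_closed_sbg.
    by apply: open_closedC; exact: (open_preim _).1 (closed_openC cK).
  apply/seteqP; split=> x; first by move=> [Rx Kx]; split=> // -[].
  by move=> [Rx Kx]; split=> //; apply: contrapT => nKx; apply: Kx.
- by move=> x [].
- move=> b x Rb [Rx Kx]; split; first exact: (sbgJ sR).
  by rewrite quotient_piJ//; exact: nK.
Qed.

Lemma preim_sub1 K : sbg K -> K <> [set 1] -> ~ (quotient_preim K `<=` N).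
Proof.
move=> sK K1 H; apply: K1; apply/seteqP; split=> [a Ka|_ ->]; last exact: (sbg1 sK).
have [x Rx xa] := quotient_pi_surj a; rewrite -xa in Ka *.
by apply/quotient_pi_eq1 => //; exact: H.
Qed.

Lemma sub_preim K : sbg K -> N `<=` quotient_preim K.
Proof.
move=> sK x Nx; have Rx := ncl_sub nN Nx; split=> //.
by rewrite (quotient_pi_eq1 Rx).2//; exact: (sbg1 sK).
Qed.

Lemma finidx_preim K : sbg K -> finidx (quotient_preim K) R -> finidx K setT.
Proof.
move=> sK f; have [s [sR' sP]] := finidx_in (sbg_preim sK) f.
exists [seq (pi x : quotient_group) | x <- s] => a _.
have [y Ry <-] := quotient_pi_surj a; have [x xs [Rxy Kxy]] := sP y Ry.
exists (pi x); first exact: map_f.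
have Rx := sR' x xs.
by rewrite -quotient_piV// -quotient_piM//; exact: (sbgV sR).
Qed.

Lemma finite_quotient : finite_set [set: quotient_group] <-> finidx N R.
Proof.
split=> [/finite_seqP[s sE]|f].
  exists [seq rep a | a <- s] => y Ry; exists (rep (pi y)).
    by apply: map_f; have : [set` s] (pi y) by rewrite -sE.
  have [Ry' yE] := repP (pi y); exact/quotient_pi_eq.
have [s [sR' sP]] := finidx_in sN f.
apply/finite_seqP; exists [seq (pi x : quotient_group) | x <- s].
apply/seteqP; split=> // a _; have [y Ry <-] := quotient_pi_surj a.
have [x xs Nxy] := sP y Ry; apply/mapP; exists x => //.
by apply/esym/quotient_pi_eq => //; exact: sR'.
Qed.

Lemma within_quotient_pi : {within R, continuous (pi : G -> quotient_group)}.
Proof.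
apply: continuous_in_subspaceT => x /set_mem Rx O H.
by apply: filterS (quotient_pi_continuous Rx H) => z [].
Qed.

Hypotheses (hG : hausdorff_space G) (vdG : small_subgroups G) (cR : compact R).

Lemma compact_quotient : compact [set: quotient_group].
Proof.
rewrite (_ : setT = (pi : G -> quotient_group) @` R).
  by apply: continuous_compact => //; exact: within_quotient_pi.
by apply/seteqP; split=> // a _; have [x Rx <-] := quotient_pi_surj a; exists x.
Qed.

(** A small open normal [V] keeps [x^-1 * y] out of [V ** N]; the coset of [x] modulo [V ** N] is
    clopen, is a union of cosets of [N], and separates the two points. *)
Lemma zero_dimensional_quotient : zero_dimensional quotient_group.
Proof.
move=> a b /eqP; have [x Rx <-] := quotient_pi_surj a.
have [y Ry <-] := quotient_pi_surj b => ab.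
have nNxy : ~ N (x^-1 * y) by move=> H; apply: ab; exact/quotient_pi_eq.
have [| |V [nV fV VA]] :=
  @ncl_separate G hG vdG R [set v | N (v^-1 * (x^-1 * y))] sR cR.
- apply: closed_preimage (ncl_closed nN).
  apply: continuous_mulg; last exact: cst_continuous.
  exact: continuous_invg (@continuous_id _).
- by rewrite /= invg1 mul1g.
have nVN : ncl R (V ** N) by exact: ncl_mul.
have [sVN cVN VNR nRVN] := nVN.
have oVN : open (V ** N).
  apply: (finidx_open sVN cVN VNR sR oR); apply: finidxS fV => //.
  exact: mulS_subl (sbg1 sN).
pose D := [set z | (V ** N) (x^-1 * z)].
have DE z : R z -> ((pi @` (D `&` R)) (pi z)) <-> D z.
  move=> Rz; split=> [[z' [Dz' Rz'] /quotient_pi_eq -/(_ Rz' Rz) H]|Dz]; last by exists z.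
  rewrite /D /= -(mulVKg z' z) mulgA; apply: (sbgM sVN) => //.
  exact: (mulS_subr (sbg1 (ncl_sbg nV))).
exists (pi @` (D `&` R)); split.
- split.
    apply/open_preim; rewrite (_ : quotient_preim _ = R `&` D).
      by apply: openI => //; exact: open_coset.
    by apply/seteqP; split=> z [Rz] /(DE z Rz).
  rewrite -[X in closed X]setCK; apply/open_closedC/open_preim.
  have -> : quotient_preim (~` (pi @` (D `&` R))) = R `&` ~` D.
    by apply/seteqP; split=> z [Rz nD]; split=> //; apply: contra_not nD => /(DE z Rz).
  by apply: openI => //; apply: closed_openC; exact: closed_coset.
- by exists x => //; split=> //; rewrite /D /= mulVg; exact: (sbg1 sVN).
- move=> /(DE y Ry) [v [n [Vv Nn E]]]; apply: (VA v Vv) => /=.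
  by rewrite E mulKg.
Qed.

End QuotientGroup.

Lemma zero_dimensional_hausdorff (T : topologicalType) :
  zero_dimensional T -> hausdorff_space T.
Proof.
move=> zT; rewrite open_hausdorff => x y /zT[U [[oU cU] Ux nUy]].
exists (U, ~` U); first by rewrite /= !inE.
by split=> //=; [exact: closed_openC|rewrite setICr].
Qed.

(** * Just infinite and simple quotient groups *)

Section QuotientFactors.
Context (G : topologicalGroupType) (hG : hausdorff_space G) (vdG : small_subgroups G).
Context (R N : set G) (RN : [/\ sbg R, open R & ncl R N]) (cR : compact R).

Let Q := quotient_group RN.

Lemma profinite_quotient : profinite Q.
Proof.
have zQ : zero_dimensional Q by exact: zero_dimensional_quotient.
split; first exact: compact_quotient.
  exact: zero_dimensional_hausdorff.
exact: zero_dimension_totally_disconnected.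
Qed.

Lemma just_infinite_quotient : ji_quotient R N -> just_infinite Q.
Proof.
move=> [_ infN jN]; split; first exact: profinite_quotient.
  by move=> /finite_quotient.
move=> K [/subgroupP sK nK] cK K1; apply/finite_index_finidx => //.
apply: finidx_preim => //; apply: jN.
- by apply: ncl_preim => //; exact/norms_normalizer.
- exact: sub_preim.
- exact: preim_sub1.
Qed.

Lemma finite_simple_quotient : max_normal R N -> finite_simple Q.
Proof.
move=> [_ fN RN' maxN].
have fQ : finite_set [set: Q] by exact/finite_quotient.
have [_ hQ _] := profinite_quotient.
split=> //; split.
  move=> H; apply: RN' => x Rx; apply/(quotient_pi_eq1 RN Rx).
  by have : [set: Q] (quotient_pi RN x) by []; rewrite H.
move=> K [/subgroupP sK nK].
have cK : closed K by apply: closed_finite => //; exact: sub_finite_set fQ.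
have nP : ncl R (quotient_preim K) by apply: ncl_preim => //; exact/norms_normalizer.
have [|H|H] := maxN _ nP; first exact: sub_preim.
  by left; apply: contrapT => K1; exact: preim_sub1 K1 H.
right; apply/seteqP; split=> // a _; have [x Rx <-] := quotient_pi_surj a.
by have [] := H x Rx.
Qed.

End QuotientFactors.

Lemma zero_dimensional_prod (I : Type) (L : I -> topologicalGroupType) :
  (forall i, zero_dimensional (L i)) -> zero_dimensional (prod_group L).
Proof.
move=> zL f g /eqP fg.
have [i fgi] : exists i, f i <> g i.
  apply: contrapT => H; apply: fg; apply: prod_groupP => i.
  by apply: contrapT => ?; apply: H; exists i.
have [|U [[oU cU] Uf nUg]] := zL i (f i) (g i); first exact/eqP.
exists ((fun h : prod_group L => h i) @^-1` U); split=> //; split.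
  by apply: open_preimage => //; exact: prod_group_proj.
by apply: closed_preimage => //; exact: prod_group_proj.
Qed.

Lemma compact_prod_group (I : Type) (L : I -> topologicalGroupType) :
  (forall i, compact [set: L i]) -> compact [set: prod_group L].
Proof.
move=> cL; have := @tychonoff {classic I} (fun i => L i : topologicalType)
  (fun i => [set: L i]) cL.
by rewrite (_ : [set f | _] = setT)//; apply/seteqP; split.
Qed.

(** * Embedding an open subgroup into the product of its quotients *)

Section Embedding.
Context (G : topologicalGroupType) (hG : hausdorff_space G) (vdG : small_subgroups G).
Context (R : set G) (sR : sbg R) (oR : open R) (cR : compact R).
Context (I : Type) (N : I -> set G) (J : set I) (V : set G).
Hypothesis fam : product_family R N J V.

Lemma family_ncl i : [/\ sbg R, open R & ncl R (N i)].
Proof.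
have [[_ jN] mN _ _ _] := fam; split=> //.
have [Ji|nJi] := pselect (J i); first by have [] := jN i Ji.
by have [] := mN i nJi.
Qed.

Definition factor i : topologicalGroupType := quotient_group (family_ncl i).

Definition embedding (x : G) : prod_group factor :=
  fun i => quotient_pi (family_ncl i) x.

Lemma embedding_inj : set_inj R embedding.
Proof.
have [_ _ triv _ _] := fam.
move=> x y /set_mem Rx /set_mem Ry E.
have : x^-1 * y = 1; last by move=> /mulg1_eq; rewrite invgK.
apply: triv => [|i]; first by apply: (sbgM sR) => //; exact: (sbgV sR).
by apply/(quotient_pi_eq (family_ncl i) Rx Ry); have := congr1 (fun f => f i) E.
Qed.

Lemma embeddingM : {in R &, {morph embedding : x y / x * y}}.
Proof.
move=> x y /set_mem Rx /set_mem Ry; apply: prod_groupP => i.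
exact: (quotient_piM (family_ncl i)).
Qed.

Lemma embedding_continuous : {within R, continuous embedding}.
Proof.
apply: (@prod_group_continuous _ _ (subspace R)) => i.
have H := @within_quotient_pi _ _ _ (family_ncl i).
move=> x; exact: (H x).
Qed.

Lemma profinite_factors : profinite (prod_group factor).
Proof.
have zP : zero_dimensional (prod_group factor).
  by apply: zero_dimensional_prod => i; exact: zero_dimensional_quotient.
split.
- by apply: compact_prod_group => i; exact: compact_quotient.
- exact: zero_dimensional_hausdorff.
- exact: zero_dimension_totally_disconnected.
Qed.

Lemma sbg_embedding : sbg (embedding @` R).
Proof.
have e1 : embedding 1 = 1 by [].
split; first by exists 1; first exact: (sbg1 sR).
  move=> _ _ [x Rx <-] [y Ry <-]; exists (x * y); first exact: (sbgM sR).
  by rewrite embeddingM ?inE.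
move=> _ [x Rx <-]; exists x^-1; first exact: (sbgV sR).
have Rx' := sbgV sR Rx.
by apply: (mulgI (embedding x)); rewrite -embeddingM ?inE// !mulgV.
Qed.

(** By the last clause of [product_family] the image contains the box given by the classes of [V]
    over [J] and unrestricted elsewhere, which is open since [J] is finite. *)
Lemma embedding_open_image : open (embedding @` R).
Proof.
have [[fJ _] _ _ [nV fV] surj] := fam.
have [s JE] := (@finite_seqP {classic I} J).1 fJ.
have [sV cV VR nRV] := nV.
have oV := finidx_open sV cV VR sR oR fV.
apply: open_sbg; first exact: sbg_embedding.
pose W i : set (factor i) :=
  if pselect (J i) then (quotient_pi (family_ncl i)) @` (V `&` R) else setT.
apply: (@filterS _ _ _ (box W)).
  move=> f Wf.
  have /choice [y yP] : forall i, exists y,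
      [/\ R y, J i -> V y & quotient_pi (family_ncl i) y = f i].
    move=> i; have := Wf i; rewrite /W; case: pselect => [Ji|nJi] /=.
      by move=> [y [Vy Ry] <-]; exists y.
    by move=> _; have [y Ry yE] := quotient_pi_surj (f i); exists y.
  have [||x Rx xP] := surj y.
  - by move=> i; have [] := yP i.
  - by move=> i Ji; have [_ yV _] := yP i; exact: yV.
  exists x => //; apply: prod_groupP => i; have [Ry _ <-] := yP i.
  by apply/(quotient_pi_eq (family_ncl i) Rx Ry).
apply: open_nbhs_nbhs; split; last first.
  move=> i; rewrite /W; case: pselect => // Ji.
  by exists 1 => //; split; exact: sbg1.
apply: (@open_box _ _ W s) => [i|i si|i]; rewrite /W; case: pselect => //= Ji.
- split.
  + by exists 1 => //; split; exact: sbg1.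
  + move=> _ _ [x [Vx Rx] <-] [y [Vy Ry] <-]; exists (x * y).
      by split; exact: sbgM.
    exact: (quotient_piM (family_ncl i)).
  + move=> _ [x [Vx Rx] <-]; exists x^-1; first by split; exact: sbgV.
    exact: (quotient_piV (family_ncl i)).
- by move: si; rewrite (_ : (i \in s) = true)//; have : [set` s] i by rewrite -JE.
- exact: (quotient_pi_open (family_ncl i)).
- exact: openT.
Qed.

Lemma embedding_open O : O `<=` R -> open O -> open (embedding @` O).
Proof.
move=> OR oO; have [_ hP _] := profinite_factors.
(* By injectivity the image of [O] is the open image of [R] minus the compact image of the rest of
   [R]. *)
rewrite (_ : embedding @` O = embedding @` R `&` ~` (embedding @` (R `&` ~` O))).
  apply: openI; first exact: embedding_open_image.
  apply: closed_openC; apply: compact_closed => //; apply: continuous_compact.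
    apply: continuous_subspaceW embedding_continuous; by move=> x [].
  apply: subclosed_compact cR _; last by move=> x [].
  by apply: closedI; [exact: compact_closed|exact: open_closedC].
apply/seteqP; split=> [_ [x Ox <-]|_ [[x Rx <-] nO]].
  split; first by exists x => //; exact: OR.
  move=> [y [Ry nOy] /embedding_inj E]; apply: nOy.
  by rewrite E ?inE//; exact: OR.
exists x => //; apply: contrapT => nOx; apply: nO; exists x => //.
Qed.

Lemma locally_isomorphic_factors : locally_isomorphic G (prod_group factor).
Proof.
exists R, embedding; split.
- by split=> //; exact/subgroupP.
- exact: embeddingM.
- exact: embedding_continuous.
- exact: embedding_inj.
- exact: embedding_open.
Qed.

End Embedding.

Theorem theorem1p7 (G : topologicalGroupType)
    (lcG : locally_compact [set: G]) (hG : hausdorff_space G)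
    (tdG : totally_disconnected [set: G]) :
  property_LD G <->
  exists (I : Type) (L : I -> topologicalGroupType) (J : set I),
    [/\ finite_set J,
        forall i, J i -> just_infinite (L i),
        forall i, ~ J i -> finite_simple (L i),
        profinite (prod_group L) &
        locally_isomorphic G (prod_group L)].
Proof.
split=> [LD|[I [L [J [fJ jiL simL pL isoL]]]]]; last exact: (@property_LD_prod G I L J).
have vdG : small_subgroups G by exact: small_subgroups_td.
have [R [sR oR cR [I [N [J [V fam]]]]]] := LD_product_family hG lcG tdG LD.
have [[fJ jiN] mN _ _ _] := fam.
exists I, (factor sR oR fam), J; split=> //.
- by move=> i Ji; apply: just_infinite_quotient => //; exact: jiN.
- by move=> i nJi; apply: finite_simple_quotient => //; exact: mN.
- exact: profinite_factors.
- exact: locally_isomorphic_factors.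
Qed.
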